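(* Let $k$ be an infinite field, and let $\Delta$ be a connected finite simple graph with $n\ge3$ vertices, regarded as a one-dimensional simplicial complex. Put $R=k[\Delta]$ and $\mathfrak m_R=R_+$. Then the following conditions are equivalent: (i) There exist a graded exact sequence $$0\longrightarrow R\longrightarrow\omega_R(-a(R))\longrightarrow C\longrightarrow0$$ and a linear form $f\in R_1$ regular on both $R$ and $C$ such that $C/fC$ has a graded $k$-summand. (ii) There exists a graded exact sequence $$0\longrightarrow R\longrightarrow\omega_R(-a(R))\longrightarrow C\longrightarrow0$$ such that $e^0_{\mathfrak m_R}(C)<2\mu_R(C)$. (iii) $\Delta$ is a tree with $n\ge4$, or $\Delta$ has no bridges and has a cut vertex.
   Context: For a finite simple graph $\Delta$ on vertex set $\{1,\dots,n\}$ with at least one edge, the faces of the associated simplicial complex are the empty set, the vertices, and the edges. The Stanley--Reisner ring is $k[\Delta]=k[x_1,\ldots,x_n]/\bigl(\prod_{i\in F}x_i \mid F\subseteq\{1,\ldots,n\},\ F\notin\Delta\bigr)$, a standard graded $k$-algebra of dimension two, Cohen--Macaulay when $\Delta$ is connected. $R_+$ is the ideal generated by elements of positive degree. $\omega_R$ is the graded canonical module of $R$, and $a(R)=-\min\{j\in\mathbb Z\mid[\omega_R]_j\neq0\}$ is the $a$-invariant. $M(j)$ denotes the graded shift, $M(j)_i=M_{i+j}$; graded exact sequences have degree-zero homogeneous maps. $M$ has a graded $k$-summand if $M$ has, as a graded module, a direct summand isomorphic to $k(-j)$ for some $j\in\mathbb Z$ (with $k=R/R_+$). For a finitely generated graded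 module $M$ of dimension $s$, $\mu_R(M)$ is the minimal number of generators, and $e^0_{\mathfrak m_R}(M)$ is the multiplicity: the leading coefficient of the polynomial agreeing with $(s-1)!\cdot\dim_kM_i$ for $i\gg0$ if $s>0$, and the length $\ell_R(M)$ if $s=0$ (so $e^0_{\mathfrak m_R}(0)=0$). A bridge of a connected graph is an edge whose deletion disconnects the graph; a cut vertex is a vertex whose deletion (together with all incident edges) disconnects the graph. *)

(* Defs.v *)
From HB Require Import structures.
From mathcomp Require Import all_boot all_order all_algebra.
From mathcomp Require Import generic_quotient ring_quotient mpoly zify ring.
From mathcomp Require Import boolp classical_sets functions cardinality fsbigop.

Set Implicit Arguments.
Unset Strict Implicit.
Unset Printing Implicit Defensive.

Import GRing.Theory.
Local Open Scope classical_set_scope.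
Local Open Scope ring_scope.
Local Open Scope quotient_scope.

(** * Submodules and quotient modules *)

Section Span.
Variables (A : comNzRingType) (M : lmodType A) (N : set M).

Definition span : set M := [set m | exists s : seq (A * M),
  (forall p, p \in s -> N p.2) /\ m = \sum_(p <- s) p.1 *: p.2].

Definition in_span : {pred M} := fun m => `[< span m >].

Lemma in_span_submod_closed : submod_closed in_span.
Proof.
split=> [|a u v /asboolP[s [sN ->]] /asboolP[t [tN ->]]]; apply/asboolP.
  by exists [::]; rewrite big_nil.
exists ([seq (a * p.1, p.2) | p <- s] ++ t); split=> [p|].
  rewrite mem_cat => /orP[/mapP[q qs ->]|/tN //]; exact: sN qs.
rewrite big_cat big_map /= scaler_sumr; congr (_ + _).
by apply: eq_bigr => p _; rewrite scalerA.
Qed.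

HB.instance Definition _ :=
  GRing.isSubmodClosed.Build A M in_span in_span_submod_closed.

Lemma span_sub : N `<=` span.
Proof.
move=> m Nm; exists [:: (1, m)]; rewrite big_seq1 scale1r; split=> // p.
by rewrite inE => /eqP->.
Qed.

Definition submod := {m : M | in_span m}.
HB.instance Definition _ := [isSub of submod for @sval M in_span].
HB.instance Definition _ := [Choice of submod by <:].
HB.instance Definition _ := [SubChoice_isSubLmodule of submod by <:].

Definition quotmod := Quotient.quot in_span.
HB.instance Definition _ := Choice.on quotmod.
HB.instance Definition _ := GRing.Zmodule.on quotmod.

Definition quotmod_pi (m : M) : quotmod := \pi_(Quotient.quot in_span) m.

Lemma quotmod_pi_eq u v : (quotmod_pi u == quotmod_pi v) = (u - v \in in_span).
Proof. by rewrite /quotmod_pi -Quotient.idealrBE. Qed.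

Lemma quotmod_piB : zmod_morphism quotmod_pi.
Proof. by move=> u v; rewrite /quotmod_pi raddfB. Qed.
HB.instance Definition _ := GRing.isZmodMorphism.Build M quotmod quotmod_pi
  quotmod_piB.

Lemma quotmod_reprK u : quotmod_pi (repr u) = u.
Proof. exact: reprK. Qed.

Definition quotmod_scale (a : A) (u : quotmod) : quotmod :=
  quotmod_pi (a *: repr u).

Lemma quotmod_scale_pi a m : quotmod_scale a (quotmod_pi m) = quotmod_pi (a *: m).
Proof.
apply/eqP; rewrite quotmod_pi_eq -scalerBr rpredZ //.
by rewrite -quotmod_pi_eq quotmod_reprK.
Qed.

Fact quotmod_scaleA a b u :
  quotmod_scale a (quotmod_scale b u) = quotmod_scale (a * b) u.
Proof. by rewrite -[u]quotmod_reprK !quotmod_scale_pi scalerA. Qed.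
Fact quotmod_scale1 : left_id 1 quotmod_scale.
Proof. by move=> u; rewrite -[u]quotmod_reprK quotmod_scale_pi scale1r. Qed.
Fact quotmod_scaleDr : right_distributive quotmod_scale +%R.
Proof.
move=> a u v; rewrite -[u]quotmod_reprK -[v]quotmod_reprK -raddfD.
by rewrite !quotmod_scale_pi scalerDr raddfD.
Qed.
Fact quotmod_scaleDl u : {morph quotmod_scale^~ u : a b / a + b}.
Proof.
by move=> a b; rewrite -[u]quotmod_reprK !quotmod_scale_pi scalerDl raddfD.
Qed.
HB.instance Definition _ := GRing.Zmodule_isLmodule.Build A quotmod
  quotmod_scaleA quotmod_scale1 quotmod_scaleDr quotmod_scaleDl.

Lemma quotmod_piZ : scalable quotmod_pi.
Proof. by move=> a m; rewrite -quotmod_scale_pi. Qed.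
HB.instance Definition _ := GRing.isScalable.Build A M quotmod _ quotmod_pi
  quotmod_piZ.

End Span.

(** * Localization at the powers of an element *)

Section Localization.
Variables (A : comNzRingType) (f : A).

(* (r, s) stands for the fraction r / f ^+ s. *)
Definition loc_equiv : rel (A * nat) := fun u v =>
  `[< exists t, f ^+ (t + v.2) * u.1 = f ^+ (t + u.2) * v.1 >].

Lemma loc_equiv_class : equiv_class_of loc_equiv.
Proof.
split=> [u|u v|v u w].
- by apply/asboolP; exists 0%N.
- by apply/asboolP/asboolP => -[t ht]; exists t.
move=> /asboolP[t ht] /asboolP[t' ht']; apply/asboolP.
exists (t + t' + v.2)%N.
transitivity (f ^+ (t' + w.2) * (f ^+ (t + v.2) * u.1)).
  by rewrite mulrA -exprD; congr (f ^+ _ * _); lia.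
rewrite ht mulrCA ht' mulrA -exprD; congr (f ^+ _ * _); lia.
Qed.

Canonical loc_equiv_rel := EquivRelPack loc_equiv_class.
Canonical loc_encModRel := defaultEncModRel loc_equiv.

Definition loc := {eq_quot loc_equiv}.
HB.instance Definition _ := Choice.on loc.

Definition frac (r : A) (s : nat) : loc := \pi_({eq_quot loc_equiv}) (r, s).

Lemma frac_eq r s r' s' : frac r s = frac r' s' <->
  exists t, f ^+ (t + s') * r = f ^+ (t + s) * r'.
Proof.
by split=> [/eqmodP/asboolP|h]; [|apply/eqmodP/asboolP].
Qed.

Lemma fracK (u : loc) : frac (repr u).1 (repr u).2 = u.
Proof. by rewrite /frac -surjective_pairing; exact: reprK. Qed.

Lemma fracP (u : loc) : exists r s, u = frac r s.
Proof. by exists (repr u).1, (repr u).2; rewrite fracK. Qed.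

Definition loc_add (u v : loc) : loc :=
  frac (f ^+ (repr v).2 * (repr u).1 + f ^+ (repr u).2 * (repr v).1)
       ((repr u).2 + (repr v).2).
Definition loc_opp (u : loc) : loc := frac (- (repr u).1) (repr u).2.
Definition loc_scale (a : A) (u : loc) : loc := frac (a * (repr u).1) (repr u).2.

Lemma loc_addE r s r' s' : loc_add (frac r s) (frac r' s') =
  frac (f ^+ s' * r + f ^+ s * r') (s + s').
Proof.
rewrite /loc_add; move: (repr _) (fracK (frac r s)) => [a i] /frac_eq[t /= h].
move: (repr _) (fracK (frac r' s')) => [b j] /frac_eq[t' /= h'].
apply/frac_eq; exists (t + t')%N; rewrite !mulrDr !mulrA -!exprD.
congr (_ + _).
  transitivity (f ^+ (t' + s' + j) * (f ^+ (t + s) * a)).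
    by rewrite mulrA -exprD; congr (f ^+ _ * _); lia.
  by rewrite h mulrA -exprD; congr (f ^+ _ * _); lia.
transitivity (f ^+ (t + s + i) * (f ^+ (t' + s') * b)).
  by rewrite mulrA -exprD; congr (f ^+ _ * _); lia.
by rewrite h' mulrA -exprD; congr (f ^+ _ * _); lia.
Qed.

Lemma loc_oppE r s : loc_opp (frac r s) = frac (- r) s.
Proof.
rewrite /loc_opp; move: (repr _) (fracK (frac r s)) => [a i] /frac_eq[t /= h].
by apply/frac_eq; exists t; rewrite !mulrN h.
Qed.

Lemma loc_scaleE a r s : loc_scale a (frac r s) = frac (a * r) s.
Proof.
rewrite /loc_scale; move: (repr _) (fracK (frac r s)) => [b i] /frac_eq[t /= h].
by apply/frac_eq; exists t; rewrite mulrCA h mulrCA.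
Qed.

Fact loc_addA : associative loc_add.
Proof.
move=> u v w; have [[r [i ->]] [r' [i' ->]] [r'' [i'' ->]]] :=
  And3 (fracP u) (fracP v) (fracP w).
rewrite !loc_addE; apply/frac_eq; exists 0%N; congr (_ * _).
  by congr (f ^+ _); lia.
by rewrite !mulrDr !mulrA -!exprD addrA (addnC i'') (addnC i'').
Qed.
Fact loc_addC : commutative loc_add.
Proof.
move=> u v; have [[r [i ->]] [r' [i' ->]]] := conj (fracP u) (fracP v).
by rewrite !loc_addE addrC addnC.
Qed.
Fact loc_add0 : left_id (frac 0 0) loc_add.
Proof.
move=> u; have [r [i ->]] := fracP u.
by rewrite loc_addE mulr0 add0r expr0 mul1r.
Qed.
Fact loc_addN : left_inverse (frac 0 0) loc_opp loc_add.
Proof.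
move=> u; have [r [i ->]] := fracP u.
by rewrite loc_oppE loc_addE mulrN addNr; apply/frac_eq; exists 0%N; rewrite !mulr0.
Qed.
HB.instance Definition _ :=
  GRing.isZmodule.Build loc loc_addA loc_addC loc_add0 loc_addN.

Fact loc_scaleA a b u : loc_scale a (loc_scale b u) = loc_scale (a * b) u.
Proof. by have [r [i ->]] := fracP u; rewrite !loc_scaleE mulrA. Qed.
Fact loc_scale1 : left_id 1 loc_scale.
Proof. by move=> u; have [r [i ->]] := fracP u; rewrite loc_scaleE mul1r. Qed.
Fact loc_scaleDr : right_distributive loc_scale +%R.
Proof.
move=> a u v; have [[r [i ->]] [r' [i' ->]]] := conj (fracP u) (fracP v).
rewrite [frac r i + _]loc_addE !loc_scaleE [RHS]loc_addE mulrDr.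
by rewrite (mulrCA a) (mulrCA a).
Qed.
Fact loc_scaleDl u : {morph loc_scale^~ u : a b / a + b}.
Proof.
move=> a b; have [r [i ->]] := fracP u.
rewrite !loc_scaleE [RHS]loc_addE; apply/frac_eq; exists 0%N.
by rewrite !add0n mulrDl -mulrDr mulrA -exprD.
Qed.
HB.instance Definition _ := GRing.Zmodule_isLmodule.Build A loc
  loc_scaleA loc_scale1 loc_scaleDr loc_scaleDl.

End Localization.

(* The canonical map A_f -> A_h in the case where h = f * g, which sends
   r / f ^+ s to r * g ^+ s / h ^+ s. *)
Definition locmap (A : comNzRingType) (f g h : A) (u : loc f) : loc h :=
  frac h ((repr u).1 * g ^+ (repr u).2) (repr u).2.

Lemma locmapE (A : comNzRingType) (f g : A) r s :
  locmap g (f * g) (frac f r s) = frac (f * g) (r * g ^+ s) s.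
Proof.
rewrite /locmap; move: (repr _) (fracK (frac f r s)) => [a i] /frac_eq[t /= h].
apply/frac_eq; exists t; rewrite !exprMn.
rewrite mulrACA -[RHS]mulrACA h; congr (_ * _).
by rewrite -!exprD; congr (g ^+ _); lia.
Qed.

Lemma locmap_linear (A : comNzRingType) (f g h : A) : h = f * g ->
  linear (locmap g h : loc f -> loc h).
Proof.
move=> -> a u v; have [[r [i ->]] [r' [j ->]]] := conj (fracP u) (fracP v).
rewrite [a *: _]loc_scaleE [_ + frac f r' j]loc_addE !locmapE.
rewrite [a *: _]loc_scaleE [RHS]loc_addE; congr (frac _ _ _).
by rewrite mulrDl !exprMn exprD; ring.
Qed.

(** * Graded algebras and graded modules

   These records hold the data of a grading only; [graded] is the condition
   that a module is the direct sum of its homogeneous parts. *)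

Record gralg (k : fieldType) := GrAlg {
  galg :> comAlgType k;
  apart : int -> set galg }.

Record gmod (k : fieldType) (A : gralg k) := GMod {
  gcarrier :> lmodType A;
  part : int -> set gcarrier }.

Arguments apart {k} A j : rename.
Arguments part {k A} M j : rename.

Section Graded.
Variables (k : fieldType) (A : gralg k).
Implicit Types M : gmod A.

Definition graded M :=
  [/\ forall j, part M j 0 /\ (forall u v, part M j u -> part M j v -> part M j (u - v)),
      forall i j (a : A) (u : M), apart A i a -> part M j u -> part M (i + j) (a *: u)
    & forall m : M, exists! c : int -> M,
        [/\ forall j, part M j (c j), finite_set [set j | c j <> 0]
          & m = \sum_(j \in [set: int]) c j]].

Definition gself : gmod A := @GMod k A A^o (apart A).

(* M(d), where M(d)_i = M_(i + d). *)
Definition shift M (d : int) : gmod A :=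
  @GMod k A M (fun i => part M (i + d)).

Definition gprod (M N : gmod A) : gmod A :=
  @GMod k A (M * N)%type (fun i => [set u | part M i u.1 /\ part N i u.2]).

Definition gsub M (N : set M) : gmod A :=
  @GMod k A (submod N) (fun i => [set u | part M i (val u)]).

Definition gquot M (N : set M) : gmod A :=
  @GMod k A (quotmod N) (fun i => [set quotmod_pi N m | m in part M i]).

Definition gmorph (M N : gmod A) (f : M -> N) :=
  forall i m, part M i m -> part N i (f m).

Definition short_exact (M N P : gmod A)
    (f : {linear M -> N}) (g : {linear N -> P}) :=
  [/\ gmorph f /\ gmorph g, injective f,
      range f = g @^-1` [set 0] & range g = [set: P]].

Definition gisom (M N : gmod A) := exists (f : {linear M -> N}),
  bijective f /\ forall i m, part M i m <-> part N i (f m).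

(* A_+, generated by the homogeneous elements of positive degree, and the
   residue field A / A_+. *)
Definition posdeg : set gself := [set a | exists2 i : int, (0 < i)%R & apart A i a].
Definition gresidue : gmod A := gquot posdeg.

Definition has_k_summand M := exists (j : int) (L : gmod A),
  graded L /\ gisom (gprod (shift gresidue (- j)) L) M.

Definition regular_on (f : A) M := forall m : M, f *: m = 0 -> m = 0.

Definition gmodf M (f : A) : gmod A := gquot [set f *: m | m in [set: M]].

(** ** The graded dual *)

Section Dual.
Variable M : gmod A.

Definition klinear : {pred M -> k} := fun phi =>
  `[< forall (c : k) (u v : M), phi (c%:A *: u + v) = c * phi u + phi v >].

Lemma klinear_zmod_closed : zmod_closed klinear.
Proof.
split=> [|f g /asboolP fl /asboolP gl]; apply/asboolP => c u v.
  by rewrite mulr0 addr0.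
by rewrite /= -![(f - g) _]/(f _ - g _) fl gl mulrBr opprD addrACA.
Qed.
HB.instance Definition _ :=
  GRing.isZmodClosed.Build (M -> k) klinear klinear_zmod_closed.

(* Hom_k(M, k), on which A acts by (a phi)(m) = phi(a m). *)
Definition homk := {phi : M -> k | klinear phi}.
HB.instance Definition _ := [isSub of homk for @sval (M -> k) klinear].
HB.instance Definition _ := [Choice of homk by <:].
HB.instance Definition _ := [SubChoice_isSubZmodule of homk by <:].

Fact homk_scale_subproof (a : A) (phi : homk) :
  (fun m => val phi (a *: m)) \in klinear.
Proof.
apply/asboolP => c u v; have /asboolP phil := valP phi.
by rewrite -phil scalerDr !scalerA -scalerAl -scalerAr mul1r mulr1.
Qed.
Definition homk_scale a phi : homk :=
  exist (fun psi => klinear psi) _ (homk_scale_subproof a phi).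

Fact homk_scaleA a b u : homk_scale a (homk_scale b u) = homk_scale (a * b) u.
Proof. by apply/val_inj/funext => m /=; rewrite scalerA mulrC. Qed.
Fact homk_scale1 : left_id 1 homk_scale.
Proof. by move=> u; apply/val_inj/funext => m /=; rewrite scale1r. Qed.
Fact homk_scaleDr : right_distributive homk_scale +%R.
Proof. by move=> a u v; apply/val_inj/funext => m. Qed.
Fact homk_scaleDl u : {morph homk_scale^~ u : a b / a + b}.
Proof.
move=> a b; apply/val_inj/funext => m /=; rewrite scalerDl.
have /asboolP ul := valP u.
by have := ul 1 (a *: m) (b *: m); rewrite !scale1r mul1r.
Qed.
HB.instance Definition _ := GRing.Zmodule_isLmodule.Build A homk
  homk_scaleA homk_scale1 homk_scaleDr homk_scaleDl.

Definition homk_part (j : int) : set homk :=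
  [set phi | forall (i : int) (m : M), i != - j -> part M i m -> val phi m = 0].

(* The direct sum over j of Hom_k(M_(- j), k), as the submodule of Hom_k(M, k)
   generated by the homogeneous functionals. *)
Definition gdual : gmod A :=
  @gsub (@GMod k A homk homk_part) (\bigcup_j homk_part j).

End Dual.

(** ** The Cech complex and local cohomology *)

Section Cech.
Variables (n : nat) (x : 'I_n -> A).

Definition xprod (F : {set 'I_n}) : A := \prod_(i in F) x i.

(* The sum over all F of the localizations A_(x_F), of which the summands with
   #|F| = p form the module of Cech p-cochains. *)
Definition cochain := forall F : {set 'I_n}, loc (xprod F).
HB.instance Definition _ := Choice.on cochain.

Definition cochain_add (c c' : cochain) : cochain := fun F => c F + c' F.
Definition cochain_opp (c : cochain) : cochain := fun F => - c F.
Definition cochain0 : cochain := fun F => 0.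
Definition cochain_scale (a : A) (c : cochain) : cochain := fun F => a *: c F.

Fact cochain_addA : associative cochain_add.
Proof. by move=> u v w; apply: functional_extensionality_dep => F; apply: addrA. Qed.
Fact cochain_addC : commutative cochain_add.
Proof. by move=> u v; apply: functional_extensionality_dep => F; apply: addrC. Qed.
Fact cochain_add0 : left_id cochain0 cochain_add.
Proof. by move=> u; apply: functional_extensionality_dep => F; apply: add0r. Qed.
Fact cochain_addN : left_inverse cochain0 cochain_opp cochain_add.
Proof. by move=> u; apply: functional_extensionality_dep => F; apply: addNr. Qed.
HB.instance Definition _ := GRing.isZmodule.Build cochain
  cochain_addA cochain_addC cochain_add0 cochain_addN.

Fact cochain_scaleA a b u :
  cochain_scale a (cochain_scale b u) = cochain_scale (a * b) u.
Proof. by apply: functional_extensionality_dep => F; apply: scalerA. Qed.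
Fact cochain_scale1 : left_id 1 cochain_scale.
Proof. by move=> u; apply: functional_extensionality_dep => F; apply: scale1r. Qed.
Fact cochain_scaleDr : right_distributive cochain_scale +%R.
Proof. by move=> a u v; apply: functional_extensionality_dep => F; apply: scalerDr. Qed.
Fact cochain_scaleDl u : {morph cochain_scale^~ u : a b / a + b}.
Proof. by move=> a b; apply: functional_extensionality_dep => F; apply: scalerDl. Qed.
HB.instance Definition _ := GRing.Zmodule_isLmodule.Build A cochain
  cochain_scaleA cochain_scale1 cochain_scaleDr cochain_scaleDl.

(* The x_i have degree 1, so that r / x_F ^+ s has degree deg r - s * #|F|. *)
Definition cech : gmod A := @GMod k A cochain (fun j => [set c : cochain |
  forall F : {set 'I_n}, exists s r, apart A (j + (s * #|F|)%:Z) r /\ c F = frac (xprod F) r s]).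

Definition cech_deg (p : nat) : set cech :=
  [set c : cochain | forall F : {set 'I_n}, #|F| != p -> c F = 0].

Definition cech_d (c : cochain) : cochain := fun F =>
  \sum_(i in F) (-1) ^+ #|[set j in F | (j < i)%N]|
                *: locmap (x i) (xprod F) (c (F :\ i)).

Definition cocycle (p : nat) : set cech :=
  [set c | cech_deg p c /\ cech_d c = 0].

Lemma cech_d_linear : linear cech_d.
Proof.
move=> a u v; apply: functional_extensionality_dep => F.
rewrite -[RHS]/(a *: cech_d u F + cech_d v F) /cech_d scaler_sumr -big_split.
apply: eq_bigr => i iF /=.
have xF : xprod F = xprod (F :\ i) * x i by rewrite /xprod (big_setD1 i) //= mulrC.
rewrite -[(a *: u + v) _]/(a *: u (F :\ i) + v (F :\ i)) (locmap_linear xF).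
by rewrite scalerDr !scalerA mulrC.
Qed.

(* The cocycles form a submodule, so that [gsub (cocycle p)] adds no elements. *)
Lemma span_cocycle p : span (cocycle p) = cocycle p.
Proof.
apply/seteqP; split; last exact: span_sub.
move=> _ [s [sZ ->]]; elim: s sZ => [|q s IH] sZ.
  rewrite big_nil; split=> //.
  have := cech_d_linear (-1) 0 0; rewrite scaler0 addr0 => ->.
  by rewrite scaleN1r addNr.
have [qs q0] := sZ q (mem_head _ _).
have [//|ss s0] := IH; first by move=> r rs; apply: sZ; rewrite inE rs orbT.
rewrite big_cons; split; last by rewrite cech_d_linear q0 s0 scaler0 addr0.
move=> F Fp; rewrite -[LHS]/(q.1 *: (q.2 : cochain) F + _) (qs F Fp).
by rewrite scaler0 add0r; exact: ss.
Qed.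

Definition coboundary (p : nat) : set cech :=
  [set b | exists c : cochain,
     (forall F : {set 'I_n}, #|F|.+1 != p -> c F = 0) /\ cech_d c = b].

(* H^p_I(A), where I is the ideal generated by the x_i. *)
Definition local_cohomology (p : nat) : gmod A :=
  @gquot (gsub (cocycle p)) [set z | coboundary p (val z)].

End Cech.

(** ** Numerical invariants *)

(* The largest length l of a strict chain c_0 < ... < c_l of sets which satisfy
   P; the value is 0 if there is no chain, or if the lengths are unbounded. *)
Definition chain (T : Type) (P : set T -> Prop) (l : nat) :=
  exists c : nat -> set T, (forall i, (i <= l)%N -> P (c i)) /\
                           (forall i, (i < l)%N -> c i `<` c i.+1).
Definition max_chain (T : Type) (P : set T -> Prop) : nat :=
  xget 0%N [set l | chain P l /\ ~ chain P l.+1].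

Definition prime_ideal (P : set A) :=
  [/\ P 0, forall a b, P a -> P b -> P (a + b), forall a b, P b -> P (a * b),
      ~ P 1 & forall a b, P (a * b) -> P a \/ P b].

Definition ann M : set A := [set a | forall m : M, a *: m = 0].

Definition krull_dim M : nat :=
  max_chain (fun P : set A => prime_ideal P /\ ann M `<=` P).

Definition submodule M (N : set M) :=
  N 0 /\ forall a u v, N u -> N v -> N (a *: u + v).

Definition length M : nat := max_chain (@submodule M).

Definition dimk M (V : set M) : nat :=
  xget 0%N [set d | exists b : 'I_d -> M, (forall t, V (b t)) /\
    forall m, V m -> exists! c : 'rV[k]_d, m = \sum_t (c 0 t)%:A *: b t].

(* The leading coefficient of the polynomial p with p(i) = (s - 1)! dim_k M_i
   for i >> 0, where s > 0 is the dimension of M, and the length if s = 0. *)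
Definition multiplicity M : rat :=
  let s := krull_dim M in
  if s == 0%N then (length M)%:R else
  xget 0 [set e | exists p : {poly rat}, e = lead_coef p /\
    exists i0 : nat, forall i : nat, (i0 <= i)%N ->
      p.[i%:R] = ((s.-1)`! * dimk (part M i%:Z))%:R].

Definition generated_by M (m : nat) :=
  exists g : 'I_m -> M, span (range g) = [set: M].
Definition min_gens M : nat := xget 0%N
  [set m | generated_by M m /\ forall m', generated_by M m' -> (m <= m')%N].

Definition initial_degree M : int :=
  let nonzero j := exists2 m : M, part M j m & m <> 0 in
  xget 0 [set j | nonzero j /\ forall i, nonzero i -> (j <= i)%R].

End Graded.

(** * Graphs and Stanley-Reisner rings *)

Section StanleyReisner.
Variables (k : fieldType) (n : nat) (e : rel 'I_n).

Definition face (F : {set 'I_n}) : bool :=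
  [|| F == finset.set0, [exists i, F == [set i]%SET]
    | [exists i, exists j, e i j && (F == [set i; j]%SET)]].

Definition nonface_monomials : set {mpoly k[n]}^o :=
  [set \prod_(i in F) 'X_i | F in [set F | ~~ face F]].

Definition SRideal : {pred {mpoly k[n]}} := @in_span _ {mpoly k[n]}^o nonface_monomials.

Lemma SRideal_meval0 p : p \in SRideal -> p.@[fun=> 0] = 0.
Proof.
move=> /asboolP[s [sN ->]]; rewrite rmorph_sum big_seq big1 //= => q /sN[F /= nF <-].
have [i iF] : exists i, i \in F.
  by apply/finset.set0Pn; apply: contra nF => /eqP->; rewrite /face eqxx.
by rewrite -[q.1 *: _]/(q.1 * _) (bigD1 i) //= !mevalM mevalXU mul0r mulr0.
Qed.

Lemma SRideal_idealr_closed : idealr_closed SRideal.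
Proof.
split; first exact: rpred0.
  by apply/negP => /SRideal_meval0 /eqP; rewrite meval1 oner_eq0.
move=> a u v; exact: (in_span_submod_closed (M := {mpoly k[n]}^o) _).2.
Qed.
HB.instance Definition _ := isIdealr.Build {mpoly k[n]} SRideal
  SRideal_idealr_closed.

Definition SR := {ideal_quot SRideal}.
HB.instance Definition _ := GRing.ComNzRing.on SR.

Definition SRpi (p : {mpoly k[n]}) : SR := \pi_({ideal_quot SRideal}) p.

Lemma SRpi_eq p q : (SRpi p == SRpi q) = (p - q \in SRideal).
Proof. by rewrite /SRpi -Quotient.idealrBE. Qed.

Lemma SRpi_reprK (r : SR) : SRpi (repr r) = r.
Proof. exact: reprK. Qed.

Fact SRpi_zmod_morphism : zmod_morphism SRpi.
Proof. by move=> p q; rewrite /SRpi rmorphB. Qed.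
HB.instance Definition _ :=
  GRing.isZmodMorphism.Build {mpoly k[n]} SR SRpi SRpi_zmod_morphism.
Fact SRpi_monoid_morphism : monoid_morphism SRpi.
Proof. by split=> [|p q]; rewrite /SRpi ?rmorph1 ?rmorphM. Qed.
HB.instance Definition _ :=
  GRing.isMonoidMorphism.Build {mpoly k[n]} SR SRpi SRpi_monoid_morphism.

Definition SR_scale (c : k) (r : SR) : SR := SRpi c%:MP * r.

Fact SR_scaleA b c r : SR_scale b (SR_scale c r) = SR_scale (b * c) r.
Proof. by rewrite /SR_scale mulrA -rmorphM mpolyCM. Qed.
Fact SR_scale1 : left_id 1 SR_scale.
Proof. by move=> r; rewrite /SR_scale mpolyC1 rmorph1 mul1r. Qed.
Fact SR_scaleDr : right_distributive SR_scale +%R.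
Proof. by move=> c r r'; apply: mulrDr. Qed.
Fact SR_scaleDl r : {morph SR_scale^~ r : b c / b + c}.
Proof. by move=> b c; rewrite /SR_scale mpolyCD rmorphD mulrDl. Qed.
HB.instance Definition _ := GRing.Zmodule_isLmodule.Build k SR
  SR_scaleA SR_scale1 SR_scaleDr SR_scaleDl.
Fact SR_scaleAl (c : k) (r r' : SR) : c *: (r * r') = (c *: r) * r'.
Proof. exact: mulrA. Qed.
HB.instance Definition _ := GRing.Lmodule_isLalgebra.Build k SR SR_scaleAl.
Fact SR_scaleAr (c : k) (r r' : SR) : c *: (r * r') = r * (c *: r').
Proof. exact: mulrCA. Qed.
HB.instance Definition _ := GRing.Lalgebra_isAlgebra.Build k SR SR_scaleAr.

Definition SRpart (j : int) : set SR :=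
  if j is Posz d then [set SRpi p | p in [set p : {mpoly k[n]} | p \is d.-homog]]
  else [set 0].

Definition SRring : gralg k := GrAlg SRpart.

(* k[Delta] has dimension 2, and its irrelevant ideal is generated by the
   classes of the variables; the canonical module is the graded k-dual of
   the top local cohomology module H^2. *)
Definition SRvar (i : 'I_n) : SRring := SRpi 'X_i.
Definition omega : gmod SRring := gdual (local_cohomology SRvar 2).

Definition a_invariant : int := - initial_degree omega.

End StanleyReisner.

Section Graph.
Variables (n : nat) (e : rel 'I_n).

Definition connected (f : rel 'I_n) := forall x y, connect f x y.

Definition tree := connected e /\ ~ exists c : seq 'I_n, (2 < size c)%N /\ ucycle e c.

Definition bridge (u v : 'I_n) := e u v /\ ~ connected
  [rel x y | [&& e x y, (x, y) != (u, v) & (x, y) != (v, u)]].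

Definition cut_vertex (v : 'I_n) := ~ forall x y, x != v -> y != v ->
  connect [rel x y | [&& e x y, x != v & y != v]] x y.

End Graph.

(* Main.v *)
(**
The elements of the canonical module are realized, through a residue pairing
with the second local cohomology, as families g_ij in k[x_i, x_j] indexed by
oriented edges with g_ji = - g_ij, such that for every vertex i the restrictions
of the g_ij to the x_i-axis add up to 0. In degree 0 these are the cycles Z of
the graph with coefficients in k. In each positive degree the restrictions to
the axes form the space V of functions v on oriented edges with
sum_j v_ij = 0 for every i, and dim V + 2 = 2 dim Z + n.

A map R -> omega(-a) is given by w = phi(1), and is injective if and only if w
vanishes on no edge. If Z is not 0 (so a = 0), then w is a nowhere zero cycle;
as k is infinite, it exists if and only if there are no bridges. Then C has
dimension dim V - n = 2 (dim Z - 1) in positive degrees. Without cut vertices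
omega is generated in degree 0, so C needs at most dim Z - 1 generators; a cut
vertex v adds a generator in degree 1, detected by the sum of the coefficients
of x_v in g_vj for j in a component of the complement of v. If Z = 0, the graph
is a tree and a = -1; w is an element of V, C has dimension dim V - 1 = n - 3 in
every nonnegative degree, and the degree 0 part consists of generators. As for
the summands of C / fC, such functionals on generators split off a copy of k,
whereas without cut vertices a socle element of degree 0 is a cycle proportional
to w on every star, hence a multiple of w.
*)
From HB Require Import structures.
From mathcomp Require Import mpoly polyXY fsbigop.
Require Import Defs.
From mathcomp Require Import all_boot all_order all_algebra.
From mathcomp Require Import boolp classical_sets functions cardinality zify ring.

Set Implicit Arguments.
Unset Strict Implicit.
Unset Printing Implicit Defensive.

Import Order.TTheory GRing.Theory Num.Theory.
Local Open Scope ring_scope.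

Local Notation span := Defs.span.
Local Notation frac := Defs.frac.

(** Multiplicity and summands both rest on one fact: for a suitable linear form f, everything of
    degree at least 2 in the model lies in f omega + R w (the predicate [Nf]). As f is regular on C,
    powers of f then identify every positive degree part of C with V modulo the multiples of w in V.
    Moreover an element of degree 1 in the model becomes a socle element of C / fC, so a functional
    on generators that does not kill it splits off a copy of k. The obstacle is the family equal to
    x_i x_j on a single edge. If w is a nowhere zero cycle, it is a multiple of w; in a tree it is
    obtained by summing over the vertices on one side of the edge. There, as in the regularity of f
    on C, f and w must have no common line of zeros in the plane of an edge, which is another use of
    the infinite field. The initial degree of omega is 0 or 1, so the argument is run for an
    abstract copy [W] of omega(-a) with coordinates [Psi] and offset [d0] = -a. Multiplicity is
    defined through the Krull dimension, so C also has to be shown to have dimension exactly 1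
    whenever its multiplicity is computed and C is not 0. *)

Lemma infinite_notin (k : fieldType) (s : seq k) :
  infinite_set [set: k] -> exists x, x \notin s.
Proof.
move=> kinf; apply: contrapT => /forallNP h; apply: kinf.
apply: sub_finite_set (finite_seq s) => x _ /=.
by apply: contrapT => /negP; exact: h.
Qed.

(** Over an infinite field, U is not a finite union of proper subspaces; the functionals are handled
    one at a time. *)
Lemma avoid_zeros (k : fieldType) (V : vectType k) (U : {vspace V})
    (I : eqType) (s : seq I) (l : I -> V -> k) :
  infinite_set [set: k] ->
  (forall i a u v, l i (a *: u + v) = a * l i u + l i v) ->
  (forall i, i \in s -> exists2 u, u \in U & l i u != 0) ->
  exists2 u, u \in U & forall i, i \in s -> l i u != 0.
Proof.
move=> kinf ll; elim: s => [|i s IH] h; first by exists 0; rewrite ?mem0v.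
have [|u uU us] := IH; first by move=> j js; apply: h; rewrite inE js orbT.
have [u' u'U iu'] := h i (mem_head _ _).
(* The excluded values are the roots t of l_j(t u + u'). If l_j(u) = 0, then j = i by the choice of
   u, and l_i(u') is already nonzero. *)
have [t ts] := infinite_notin [seq - l j u' / l j u | j <- i :: s] kinf.
exists (t *: u + u'); first by rewrite memvD ?memvZ.
move=> j jis; rewrite ll; have [ju|ju] := eqVneq (l j u) 0.
  rewrite ju mulr0 add0r; move: jis; rewrite inE => /predU1P[->//|/us].
  by rewrite ju eqxx.
apply: contraNneq ts => /eqP; rewrite addr_eq0 => /eqP tl.
by apply/mapP; exists j; rewrite // -tl mulfK.
Qed.

(** * Linear algebra of cycles and star functions on the graph *)

Section Circulations.
Variables (k : fieldType) (n : nat) (e : rel 'I_n).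
Implicit Types (u v z : 'M[k]_n).

Definition rowsum v : 'cV[k]_n := v *m const_mx 1.

Lemma rowsumE v i j : rowsum v i j = \sum_l v i l.
Proof. by rewrite mxE; apply: eq_bigr => l _; rewrite mxE mulr1. Qed.

Definition mask (f : rel 'I_n) v : 'M[k]_n :=
  \matrix_(i, j) if f i j then v i j else 0.

Fact mask_linear f : linear (mask f).
Proof.
by move=> a u v; apply/matrixP=> i j; rewrite !mxE; case: ifP; rewrite ?mulr0 ?addr0.
Qed.
HB.instance Definition _ f := GRing.isLinear.Build k 'M[k]_n 'M[k]_n _ (mask f)
  (mask_linear f).

Definition asym v : 'M[k]_n := v + v^T.
Fact asym_linear : linear asym.
Proof. by move=> a u v; rewrite /asym linearP scalerDr addrACA. Qed.
HB.instance Definition _ := GRing.isLinear.Build k 'M[k]_n 'M[k]_n _ asym asym_linear.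

Fact rowsum_linear : linear rowsum.
Proof. by move=> a u v; rewrite /rowsum mulmxDl scalemxAl. Qed.
HB.instance Definition _ := GRing.isLinear.Build k 'M[k]_n 'cV[k]_n _ rowsum rowsum_linear.

(** Matrices encode functions on oriented edges, the entry (i, j) being the value on the edge
    directed from i to j. [altsp] is the space of 1-chains and [rowsum] is the boundary map on it;
    [cyclesp] and [starsp] are the spaces Z and V of the overview. *)
Definition dartsp : {vspace 'M[k]_n} := lker (linfun (mask (fun i j => ~~ e i j))).
Definition altsp : {vspace 'M[k]_n} := (dartsp :&: lker (linfun asym))%VS.
Definition starsp : {vspace 'M[k]_n} := (dartsp :&: lker (linfun rowsum))%VS.
Definition cyclesp : {vspace 'M[k]_n} := (altsp :&: lker (linfun rowsum))%VS.

Lemma mem_dartsp v : reflect (forall i j, ~~ e i j -> v i j = 0) (v \in dartsp).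
Proof.
rewrite memv_ker lfunE /=; apply: (iffP eqP) => [/matrixP h i j nij|h].
  by have := h i j; rewrite !mxE nij.
by apply/matrixP=> i j; rewrite !mxE; case: ifP => // /h.
Qed.

Lemma mem_altsp v : reflect ((forall i j, ~~ e i j -> v i j = 0) /\
  forall i j, v i j = - v j i) (v \in altsp).
Proof.
rewrite memv_cap memv_ker lfunE /= addr_eq0.
apply: (iffP andP) => -[].
  by move=> /mem_dartsp vd /eqP/matrixP h; split=> // i j; rewrite h !mxE.
move=> vd h; split; first exact/mem_dartsp.
by apply/eqP/matrixP=> i j; rewrite !mxE -h.
Qed.

Lemma rowsum0P v : reflect (forall i, \sum_j v i j = 0) (v \in lker (linfun rowsum)).
Proof.
rewrite memv_ker lfunE /=; apply: (iffP eqP) => [/colP h i|h].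
  by rewrite -(rowsumE v i 0) h mxE.
by apply/colP => i; rewrite rowsumE h mxE.
Qed.

Lemma mem_starsp v : reflect ((forall i j, ~~ e i j -> v i j = 0) /\
  forall i, \sum_j v i j = 0) (v \in starsp).
Proof.
rewrite memv_cap; apply: (iffP andP) => -[]; first by move=> /mem_dartsp ? /rowsum0P.
by move=> ? ?; split; [exact/mem_dartsp|exact/rowsum0P].
Qed.

Lemma mem_cyclesp v : reflect [/\ forall i j, ~~ e i j -> v i j = 0,
  forall i j, v i j = - v j i & forall i, \sum_j v i j = 0] (v \in cyclesp).
Proof.
rewrite memv_cap; apply: (iffP andP) => [[/mem_altsp[? ?] /rowsum0P ?] //|[? ? ?]].
by split; [exact/mem_altsp|exact/rowsum0P].
Qed.

Lemma rowsum_delta i j : rowsum (delta_mx i j) = delta_mx i 0.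
Proof.
apply/colP => a; rewrite rowsumE (bigD1 j) //= big1 ?addr0 ?mxE ?eqxx ?andbT //.
by move=> l /negPf lj; rewrite !mxE lj andbF.
Qed.

(** A unit flow is sent along a path; the boundaries of its steps telescope. *)
Lemma path_flow (f : rel 'I_n) x y : irreflexive f -> connect f x y ->
  exists u, [/\ u^T = - u, forall i j, u i j != 0 -> f i j || f j i
    & rowsum u = delta_mx x 0 - delta_mx y 0].
Proof.
move=> f_irr /connectP[p]; elim: p x => [|x' p IH] x /=.
  move=> _ ->; exists 0; rewrite trmx0 oppr0 subrr /rowsum mul0mx; split=> //.
  by move=> i j; rewrite mxE eqxx.
move=> /andP[fx fp] /(IH _ fp)[u [uT uf us]].
exists (delta_mx x x' - delta_mx x' x + u); split.
- by rewrite linearD linearB /= !trmx_delta uT opprD opprB.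
- move=> i j; apply: contraNT; rewrite negb_or => /andP[nij nji].
  rewrite !mxE; have -> : u i j = 0.
    by apply: contraTeq nij => /uf/orP[-> //|]; rewrite (negPf nji).
  rewrite addr0; case: andP => [[/eqP ii /eqP jj]|_].
    by rewrite ii jj fx in nij.
  case: andP => [[/eqP ii /eqP jj]|_]; last by rewrite subrr.
  by rewrite ii jj fx in nji.
- by rewrite linearD linearB /= !rowsum_delta us addrA subrK.
Qed.

(** The terms at (i, j) and (j, i) cancel. The diagonal is treated by a hypothesis of its own, since
    in characteristic 2 it is not determined by antisymmetry. *)
Lemma alternating_sum0 z (q : 'M[k]_n) : (forall i, z i i = 0) -> z^T = - z -> q^T = q ->
  \sum_i \sum_j z i j * q i j = 0.
Proof.
move=> z0 zT qT.
have zE i j : z i j = - z j i by move/matrixP/(_ j i): zT; rewrite !mxE.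
have qE i j : q i j = q j i by move/matrixP/(_ j i): qT; rewrite !mxE.
pose t i j := z i j * q i j.
have tE i j : t i j = - t j i by rewrite /t zE qE mulNr.
have split3 (i : 'I_n) : \sum_j t i j = \sum_(j < n | (i < j)%N) t i j +
    \sum_(j < n | (j < i)%N) t i j.
  rewrite (bigID (fun j : 'I_n => (i < j)%N)) /=; congr (_ + _).
  rewrite (bigD1 i) ?ltnn //= /t z0 mul0r add0r; apply: eq_bigl => j.
  by rewrite -leqNgt ltn_neqAle andbC -val_eqE.
rewrite (eq_bigr _ (fun i _ => split3 i)) big_split /=.
rewrite [X in _ + X](exchange_big_dep xpredT) //= -big_split big1 //= => i _.
by rewrite -big_split big1 //= => j _; rewrite (tE j) addrN.
Qed.

End Circulations.

Section Connected.
Variables (k : fieldType) (n : nat) (e : rel 'I_n).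
Hypotheses (e_sym : symmetric e) (e_irr : irreflexive e) (e_conn : connected e).
Hypothesis n_ge3 : (3 <= n)%N.
Implicit Types (u v z : 'M[k]_n).

Local Notation dartsp := (dartsp k e).
Local Notation altsp := (altsp k e).
Local Notation starsp := (starsp k e).
Local Notation cyclesp := (cyclesp k e).

Lemma connected_mem (S : {pred 'I_n}) x y : x \in S ->
  (forall i j, i \in S -> e i j -> j \in S) -> y \in S.
Proof.
move=> xS Se; have /connectP[p ep ->] := e_conn x y.
by elim: p x xS ep => //= z p IH x xS /andP[/(Se _ _ xS) zS]; apply: IH.
Qed.

Lemma exists_neighbour i : exists j, e i j.
Proof.
apply: contrapT => /forallNP ni.
have ii j : j = i.
  by apply/eqP; apply: (@connected_mem (pred1 i) i j); rewrite ?inE //= => a b /eqP->/ni.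
have /card_le1P : (#|'I_n| <= 1)%N by apply/card_le1P => x _ y; rewrite (ii x) (ii y) !inE eqxx.
by move/card_le1P; rewrite card_ord leqNgt (leq_trans _ n_ge3).
Qed.

(** Otherwise i and j would form a whole component, with fewer than three vertices. *)
Lemma exists_nonleaf i j : e i j ->
  (exists2 l, e i l & l != j) \/ (exists2 l, e j l & l != i).
Proof.
move=> eij; apply: contrapT => /not_orP[ni nj].
have cl x : x \in pred2 i j.
  apply: (@connected_mem (pred2 i j) i); rewrite ?inE ?eqxx // => a b.
  rewrite !inE => /orP[/eqP->|/eqP->] ab; apply: contraT; rewrite negb_or => /andP[bi bj].
    by case: ni; exists b.
  by case: nj; exists b.
have : (#|'I_n| <= #|[set i; j]%SET|)%N.
  by rewrite -cardsT subset_leq_card //; apply/fintype.subsetP => x _; have := cl x; rewrite !inE.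
by rewrite card_ord cards2 leqNgt (leq_trans _ n_ge3) //; case: (i != j).
Qed.

(** Both dimensions are governed by the number of edges, but no edge is counted: a function on
    oriented edges splits into its parts above and below the diagonal, and an alternating matrix is
    determined by either part. *)
Lemma dim_dartsp : \dim dartsp = (\dim altsp).*2.
Proof.
pose up := linfun (@mask k n (fun i j => i < j)%N).
pose lo := linfun (@mask k n (fun i j => j < i)%N).
have upE v i j : up v i j = if (i < j)%N then v i j else 0 by rewrite lfunE /= mxE.
have loE v i j : lo v i j = if (j < i)%N then v i j else 0 by rewrite lfunE /= mxE.
have up_inj : (altsp :&: lker up = 0)%VS.
  apply/eqP; rewrite -subv0; apply/subvP => v; rewrite memv_cap memv0.
  move=> /andP[/mem_altsp[vd va] /[!memv_ker]/eqP/matrixP uv]; apply/eqP/matrixP => i j.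
  rewrite mxE; have [ij|ji|/val_inj->] := ltngtP i j; last by apply: vd; rewrite e_irr.
    by have := uv i j; rewrite upE ij mxE.
  by have := uv j i; rewrite upE ji mxE va => /eqP; rewrite oppr_eq0 => /eqP.
have lo_inj : (altsp :&: lker lo = 0)%VS.
  apply/eqP; rewrite -subv0; apply/subvP => v; rewrite memv_cap memv0.
  move=> /andP[/mem_altsp[vd va] /[!memv_ker]/eqP/matrixP uv]; apply/eqP/matrixP => i j.
  rewrite mxE; have [ij|ji|/val_inj->] := ltngtP i j; last by apply: vd; rewrite e_irr.
    by have := uv j i; rewrite loE ij mxE va => /eqP; rewrite oppr_eq0 => /eqP.
  by have := uv i j; rewrite loE ji mxE.
rewrite -(limg_ker_dim up dartsp) -addnn -{1}(limg_dim_eq lo_inj) -(limg_dim_eq up_inj).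
congr (_ + _)%N; congr (\dim _); apply/eqP; rewrite eqEsubv; apply/andP; split.
- apply/subvP => v; rewrite memv_cap memv_ker => /andP[/mem_dartsp vd /eqP/matrixP uv].
  have lv : v = lo (v - v^T).
    apply/matrixP => i j; rewrite loE !mxE.
    have := uv i j; rewrite upE mxE => ij0; have := uv j i; rewrite upE mxE.
    case: ltngtP ij0 => [ij ->|ji _ ->|/val_inj->] //; first by rewrite subr0.
    by rewrite vd // e_irr.
  rewrite lv memv_img //; apply/mem_altsp; split=> i j; last by rewrite !mxE opprB.
  by move=> nij; rewrite !mxE !vd ?subrr // e_sym.
- apply/subvP => _ /memv_imgP[v /mem_altsp[vd va] ->]; rewrite memv_cap memv_ker.
  apply/andP; split; last first.
    by apply/eqP/matrixP=> i j; rewrite upE loE mxE; case: ltngtP.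
  by apply/mem_dartsp => i j ij; rewrite loE vd // if_same.
- apply/subvP => _ /memv_imgP[v /mem_dartsp vd ->].
  have -> : up v = up (up v - (up v)^T).
    apply/matrixP => i j; rewrite !upE !mxE !upE; case: ltngtP => // _.
    by rewrite subr0.
  rewrite memv_img //; apply/mem_altsp; split=> i j; last by rewrite !mxE opprB.
  by move=> nij; rewrite !mxE !upE !vd ?if_same ?subrr // e_sym.
- by rewrite limgS // capvSl.
Qed.

Lemma dim_starsp : (\dim starsp + n)%N = \dim dartsp.
Proof.
rewrite -(limg_ker_dim (linfun (@rowsum k n)) dartsp); congr (_ + _)%N.
suff -> : (linfun (@rowsum k n) @: dartsp)%VS = fullv.
  by rewrite dimvf /dim /= muln1.
have [nb nbP] := choice exists_neighbour.
apply/eqP; rewrite eqEsubv subvf /=; apply/subvP => c _.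
suff -> : c = linfun (@rowsum k n) (\matrix_(i, j) if j == nb i then c i 0 else 0).
  rewrite memv_img //; apply/mem_dartsp => i j ij; rewrite mxE.
  by case: eqP ij => // ->; rewrite nbP.
rewrite lfunE; apply/colP => i; rewrite rowsumE (bigD1 (nb i)) //= mxE eqxx big1 ?addr0 //.
by move=> j /negPf ij; rewrite mxE ij.
Qed.

Lemma path_flow_altsp (f : rel 'I_n) x y : subrel f e -> connect f x y ->
  exists u, [/\ u \in altsp, forall i j, u i j != 0 -> f i j || f j i
    & rowsum u = delta_mx x 0 - delta_mx y 0].
Proof.
move=> fe fxy; have [|u [uT uf us]] := path_flow k _ fxy.
  by move=> i; apply/negbTE/negP => /fe; rewrite e_irr.
exists u; split=> //; apply/mem_altsp; split=> [i j|i j].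
  apply: contraNeq => /uf /orP[/fe//|/fe]; by rewrite e_sym.
by move/matrixP/(_ j i): uT; rewrite !mxE.
Qed.

(** Rank and nullity of the boundary map. By connectedness its image consists of all vectors of
    total 0: flows from each vertex to a base vertex [x0] produce them. *)
Lemma dim_altsp : (\dim cyclesp + n.-1)%N = \dim altsp.
Proof.
rewrite -(limg_ker_dim (linfun (@rowsum k n)) altsp); congr (_ + _)%N.
pose tot := linfun (mulmx (const_mx 1 : 'rV[k]_n) : 'cV[k]_n -> 'M_1).
have totE c : tot c = const_mx (\sum_i c i 0).
  rewrite lfunE /=; apply/matrixP => i j; rewrite !mxE; apply: eq_bigr => l _.
  by rewrite mxE mul1r ord1.
have x0 : 'I_n by apply: (Ordinal (n := n) (m := 0)); apply: leq_trans n_ge3.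
have -> : n.-1 = \dim (lker tot).
  have := limg_ker_dim tot fullv; rewrite capfv dimvf /dim /= muln1.
  suff -> : limg tot = fullv by rewrite dimvf /dim /= addn1 => d; rewrite -[RHS]/(_.+1.-1) d.
  apply/eqP; rewrite eqEsubv subvf /=; apply/subvP => c _.
  suff -> : c = tot (c 0 0 *: delta_mx x0 0) by apply: memv_img; apply: memvf.
  rewrite totE; apply/matrixP => i j; rewrite !ord1 mxE (bigD1 x0) //= !mxE !eqxx mulr1.
  by rewrite big1 ?addr0 // => l /negPf lx; rewrite !mxE lx mulr0.
congr (\dim _); apply/eqP; rewrite eqEsubv; apply/andP; split; last first.
  apply/subvP => _ /memv_imgP[v /mem_altsp[vd va] ->].
  rewrite memv_ker totE; apply/eqP/matrixP => a b; rewrite !mxE.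
  rewrite lfunE /= (eq_bigr (fun i => \sum_j v i j * (const_mx 1 : 'M_n) i j)).
    apply: alternating_sum0; rewrite ?trmx_const //; first by move=> i; rewrite vd ?e_irr.
    by apply/matrixP => i j; rewrite !mxE va.
  by move=> i _; rewrite rowsumE; apply: eq_bigr => j _; rewrite mxE mulr1.
apply/subvP => c; rewrite memv_ker totE => /eqP/matrixP/(_ 0 0); rewrite !mxE => c0.
have [g gP] := choice (fun i => @path_flow_altsp e i x0 (fun _ _ => id) (e_conn i x0)).
suff -> : c = linfun (@rowsum k n) (\sum_i c i 0 *: g i).
  by rewrite memv_img // memv_suml // => i _; rewrite memvZ //; have [] := gP i.
rewrite linear_sum /=; under eq_bigr => i _.
  by rewrite linearZ /= lfunE; have [_ _ /= ->] := gP i; rewrite scalerBr; over.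
rewrite sumrB -scaler_suml c0 scale0r subr0 {1}[c]matrix_sum_delta.
by under eq_bigr do rewrite big_ord1.
Qed.

Lemma dim_starsp_cyclesp : (\dim starsp + 2 = (\dim cyclesp).*2 + n)%N.
Proof. have := dim_starsp; have := dim_dartsp; have := dim_altsp; lia. Qed.

(** The net flow of a cycle out of S is 0: all rows sum to 0, and the flow inside S cancels by
    antisymmetry. *)
Lemma cut_sum0 z (S : {pred 'I_n}) : z \in cyclesp ->
  \sum_(i in S) \sum_(j | j \notin S) z i j = 0.
Proof.
move=> /mem_cyclesp[zd za zs].
have zSS : \sum_(i in S) \sum_(j in S) z i j = 0.
  rewrite -[RHS](@alternating_sum0 _ _ z (\matrix_(i, j) ((i \in S) && (j \in S))%:R)).
  - rewrite big_mkcond; apply: eq_bigr => i _; rewrite big_mkcond.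
    case: ifP => iS; last by rewrite big1 // => j _; rewrite mxE iS mulr0.
    by apply: eq_bigr => j _; rewrite mxE iS; case: ifP; rewrite ?mulr1 ?mulr0.
  - by move=> i; rewrite zd // e_irr.
  - by apply/matrixP => i j; rewrite !mxE za.
  - by apply/matrixP => i j; rewrite !mxE andbC.
rewrite -[LHS]add0r -{1}zSS -big_split big1 //= => i _.
by rewrite -[RHS](zs i) [RHS](bigID (mem S)).
Qed.

Definition del_edge (x y : 'I_n) :=
  [rel i j | [&& e i j, (i, j) != (x, y) & (i, j) != (y, x)]].

Lemma del_edge_sym x y : symmetric (del_edge x y).
Proof.
move=> i j; rewrite /= e_sym !xpair_eqE; congr (_ && _).
by rewrite andbC (andbC (i == x)) (andbC (i == y)).
Qed.

(** The bridge is the only edge leaving the component of x in the graph without it, so it carries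
    the whole net flow out of this component. *)
Lemma bridge_cycle0 x y z : bridge e x y -> z \in cyclesp -> z x y = 0.
Proof.
move=> [exy nconn] zc; have f_sym := del_edge_sym x y.
have yS : ~~ connect (del_edge x y) x y.
  apply: contra_notN nconn => xy a b; have := e_conn a b; apply: connect_sub => {a b} a b ab.
  have [[-> ->]|abxy] := eqVneq (a, b) (x, y); first exact: xy.
  have [[-> ->]|abyx] := eqVneq (a, b) (y, x).
    by rewrite (sym_connect_sym f_sym) // ; exact: xy.
  by apply: connect1; rewrite /= ab abxy.
have := cut_sum0 (connect (del_edge x y) x) zc.
rewrite (bigD1 x) ?inE ?connect0 //= (bigD1 y) //= !big1 ?addr0 //.
  move=> i /andP[]; rewrite !inE => iS ix; apply: big1 => j jS.
  have /mem_cyclesp[zd _ _] := zc; apply: zd; apply: contra jS => ij.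
  have [[ii jj]|ijxy] := eqVneq (i, j) (x, y); first by rewrite ii eqxx in ix.
  have [[ii jj]|ijyx] := eqVneq (i, j) (y, x); first by rewrite ii (negPf yS) in iS.
  by apply: connect_trans iS (connect1 _); rewrite /= ij ijxy.
move=> j /andP[jS jy]; have /mem_cyclesp[zd _ _] := zc; apply: zd; apply: contra jS => ij.
rewrite inE connect1 //= ij !xpair_eqE eqxx (negPf jy) /=.
by apply: contraTN ij => /andP[_ /eqP->]; rewrite e_irr.
Qed.

Definition dart x y : 'M[k]_n := delta_mx x y - delta_mx y x.

Lemma dart_starsp i j l : e i j -> e i l -> delta_mx i j - delta_mx i l \in starsp.
Proof.
move=> ij il; apply/mem_starsp; split=> [a b|a].
  move=> ab; rewrite !mxE; case: andP => [[/eqP aa /eqP bb]|_].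
    by rewrite aa bb ij in ab.
  case: andP => [[/eqP aa /eqP bb]|_]; last by rewrite subrr.
  by rewrite aa bb il in ab.
have := rowsumE (delta_mx i j - delta_mx i l) a 0 => <-; rewrite linearB /=.
by rewrite !rowsum_delta subrr mxE.
Qed.

Lemma rowsum_dart x y : rowsum (dart x y) = delta_mx x 0 - delta_mx y 0.
Proof.
by rewrite linearB /= !rowsum_delta.
Qed.

Lemma dart_altsp x y : e x y -> dart x y \in altsp.
Proof.
move=> xy; apply/mem_altsp; split=> i j; last first.
  by rewrite !mxE opprB (andbC (j == y)) (andbC (j == x)).
move=> ij; rewrite !mxE; case: andP => [[/eqP ii /eqP jj]|_].
  by rewrite ii jj xy in ij.
case: andP => [[/eqP ii /eqP jj]|_]; last by rewrite subrr.
by rewrite ii jj e_sym xy in ij.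
Qed.

Lemma rowsum_cyclesp z : z \in altsp -> rowsum z = 0 -> z \in cyclesp.
Proof. by move=> za zs; rewrite memv_cap za memv_ker lfunE /= zs. Qed.

(** A flow from x to y avoiding the edge is closed up by the edge itself. *)
Lemma connect_del_edge_cycle x y : e x y -> connect (del_edge x y) x y ->
  exists2 z, z \in cyclesp & z x y != 0.
Proof.
move=> exy xy; have [|u [ua uf us]] := path_flow_altsp _ xy.
  by move=> i j /and3P[].
exists (u - dart x y).
  apply: rowsum_cyclesp; first by rewrite memvB ?dart_altsp.
  by rewrite linearB /= us rowsum_dart subrr.
rewrite !mxE !eqxx; have -> : u x y = 0.
  by apply/eqP; apply: contraT => /uf /=; rewrite !eqxx !andbF.
have -> : (x == y) = false by apply: contraTF exy => /eqP->; rewrite e_irr.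
by rewrite subr0 sub0r oppr_eq0 oner_eq0.
Qed.

Lemma no_bridge_cycle x y : e x y -> ~ bridge e x y ->
  exists2 z, z \in cyclesp & z x y != 0.
Proof.
move=> exy /not_andP[//|/contrapT h]; apply: connect_del_edge_cycle => //; exact: h.
Qed.

Lemma bridgeless_nowhere_zero : infinite_set [set: k]%classic ->
  (forall x y, ~ bridge e x y) ->
  exists2 z, z \in cyclesp & forall i j, e i j -> z i j != 0.
Proof.
move=> kinf nb; have [p a u v|p|z zc zs] := @avoid_zeros _ _ cyclesp ('I_n * 'I_n)%type
  (enum [pred p | e p.1 p.2]) (fun p z => z p.1 p.2) kinf.
- by rewrite !mxE.
- by rewrite mem_enum => pe; have [z] := no_bridge_cycle pe (@nb _ _); exists z.
- by exists z => // i j ij; apply: (zs (i, j)); rewrite mem_enum.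
Qed.

(** A closed simple walk gives a nonzero cycle through its first edge. Conversely the support of a
    nonzero z has no leaves, since its rows sum to 0, so simple paths in it can be prolonged until
    one closes up. *)
Lemma cyclesp0_tree : tree e <-> cyclesp = 0%VS.
Proof.
split=> [[_ nocycle]|c0]; last first.
  split=> // -[c [sc /andP[ec u]]]; case: c sc ec u => [|x [|y [|w p]]] // _ /and3P[xy yw wp] u.
  have [|z zc] := connect_del_edge_cycle xy; last first.
    by move: zc; rewrite c0 memv0 => /eqP->; rewrite mxE eqxx.
  rewrite (sym_connect_sym (del_edge_sym x y)).
  move: u; rewrite /= !inE !negb_or => /and4P[/and3P[xny xnw xp] /andP[ynw yp] wnp up].
  have neq : (y != x) && (w != x) && (w != y).
    by rewrite eq_sym xny eq_sym xnw eq_sym ynw.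
  (* The closed walk x, y, w, ... returns from y to x through w without using the edge xy. *)
  apply: (@connect_trans _ _ w); first apply: connect1.
    by rewrite /= yw !xpair_eqE eqxx; move: neq; do 3!case: eqP.
  apply/connectP; exists (rcons p x); last by rewrite last_rcons.
  move: wp; apply: (@sub_in_path _ (predC1 y)).
    move=> i j; rewrite !inE /= => iy jy ->.
    by rewrite !xpair_eqE (negPf iy) (negPf jy) andbF.
  rewrite /= eq_sym ynw all_rcons /= xny; apply/allP => i ip /=.
  by apply: contraNneq yp => <-.
apply/eqP; rewrite -subv0; apply/subvP => z /mem_cyclesp[zd za zs]; rewrite memv0.
apply: contraT => z0; pose h i j := z i j != 0.
have h_sym i j : h i j = h j i by rewrite /h za oppr_eq0.
have h_e i j : h i j -> e i j by apply: contraNT => /zd->.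
have h_next x y : h x y -> exists2 y', h x y' & y' != y.
  move=> xy; apply: contrapT => ny; move: xy; rewrite /h; apply/negP; rewrite negbK.
  rewrite -[_ == 0]/(z x y == 0); have := zs x; rewrite (bigD1 y) //= big1 ?addr0 => [->//|j jy].
  by apply: contra_notP ny => /eqP xj; exists j.
have [x0 [y0 xy0]] : exists x y, h x y.
  apply: contrapT => nh; case/negP: z0; apply/eqP/matrixP => i j; rewrite mxE.
  by apply: contrapT => /eqP zij; case: nh; exists i, j.
(* The path grows at its initial vertex x: a second neighbour of x in the support either is new or
   closes a cycle, which a tree forbids. *)
have long m : exists x y p, [/\ path h x (y :: p), uniq [:: x, y & p] & size p = m].
  elim: m => [|m [x [y [p [xp u pm]]]]].
    exists x0, y0, [::]; rewrite /= xy0 inE !andbT; split=> //.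
    by apply: contraTneq xy0 => ->; rewrite /h zd ?e_irr ?eqxx.
  have xy : h x y by case/andP: xp.
  have [y' xy' yy'] := h_next x y xy.
  have xny' : y' != x by apply: contraTneq xy' => ->; rewrite /h zd ?e_irr ?eqxx.
  have [y'p|y'p] := boolP (y' \in p); last first.
    exists y', x, (y :: p); rewrite -[path _ _ _]/(h y' x && path h x (y :: p)) h_sym xy' xp.
    by rewrite /= pm; split=> //; move: u => /= ->; rewrite !inE !negb_or xny' yy' y'p.
  case: nocycle; case/splitPr: y'p xp u pm => p1 p2 /= xp u _.
  exists [:: x, y & rcons p1 y']; split; first by rewrite /= size_rcons.
  apply/andP; split.
    move: xp; rewrite -cat_rcons cat_path => /and3P[_ yp _] /=.
    rewrite (h_e _ _ xy) rcons_path last_rcons (h_e y' x) 1?h_sym // andbT.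
    by apply: sub_path yp => i j /h_e.
  move: u; rewrite -cat_rcons -!cat_cons -[_ && _]/(uniq ([:: x, y & rcons p1 y'] ++ p2)).
  by rewrite cat_uniq => /and3P[].
(* This simple path would have n + 2 vertices. *)
have [x [y [p [_ /card_uniqP pc pn]]]] := long n.
have := max_card (mem [:: x, y & p]); rewrite pc /= pn card_ord => h2.
by move: h2; rewrite ltnNge leqnSn.
Qed.

Definition del_vertex (v : 'I_n) := [rel x y | [&& e x y, x != v & y != v]].

(** Every neighbour j of v is joined to a fixed neighbour [j0] away from v. Closing these paths
    through v gives cycles whose rows at v are the differences of the unit vectors at j and [j0];
    these span the rows of sum 0. *)
Lemma not_cut_vertex_row (v : 'I_n) c : ~ cut_vertex e v -> c \in starsp ->
  exists2 z, z \in cyclesp & forall j, z v j = c v j.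
Proof.
move=> /contrapT nc /mem_starsp[cd cs]; have [j0 vj0] := exists_neighbour v.
have neq j : e v j -> j != v by apply: contraTneq => ->; rewrite e_irr.
have ex j : exists z, (e v j -> z \in cyclesp /\ forall i, z v i = (i == j)%:R - (i == j0)%:R).
  have [vj|nvj] := boolP (e v j); last by exists 0.
  have [|u [ua uf us]] := path_flow_altsp _ (nc j j0 (neq _ vj) (neq _ vj0)).
    by move=> a b /and3P[].
  exists (dart v j - dart v j0 + u) => _; split.
    apply: rowsum_cyclesp; first by rewrite memvD // memvB // dart_altsp.
    rewrite linearD linearB /= us !rowsum_dart opprB.
    by rewrite [X in X + _ = _]addrC [X in X + _ = _]addrA subrK addrA subrK subrr.
  move=> i; rewrite !mxE !eqxx /= (eq_sym v) (negPf (neq _ vj)) (eq_sym v) (negPf (neq _ vj0)) !subr0.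
  have -> : u v i = 0 by apply/eqP; apply: contraT => /uf; rewrite /= eqxx !andbF.
  by rewrite addr0.
have [g gP] := choice ex.
exists (\sum_(j | e v j) c v j *: g j).
  by apply: memv_suml => j vj; rewrite memvZ //; have [] := gP j vj.
move=> i; rewrite summxE; under eq_bigr => j vj.
  by have [_ /(_ i) gi] := gP j vj; rewrite !mxE gi mulrBr; over.
rewrite sumrB -mulr_suml [X in _ - X * _](_ : _ = 0) ?mul0r ?subr0; last first.
  by rewrite -[RHS](cs v) [RHS](bigID (e v)) /= [X in _ + X]big1 ?addr0 // => j /cd.
have [vi|nvi] := boolP (e v i); last first.
  rewrite cd // big1 // => j vj; case: eqP => [ij|]; rewrite ?mulr0 //.
  by rewrite -ij (negPf nvi) in vj.
rewrite (bigD1 i) //= eqxx mulr1 big1 ?addr0 // => j /andP[_ /negPf ji].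
by rewrite eq_sym ji mulr0.
Qed.

(** S is a component of the complement of v. All flow out of S goes to v, so the sum vanishes on
    cycles. It does not vanish on the star function at v that compares a neighbour inside S with one
    outside. *)
Lemma cut_vertex_functional (v : 'I_n) : cut_vertex e v -> exists S : {pred 'I_n},
  (forall z, z \in cyclesp -> \sum_(j in S) z v j = 0) /\
  exists2 c, c \in starsp & \sum_(j in S) c v j != 0.
Proof.
rewrite /cut_vertex -/(del_vertex v) => /existsNP[x /existsNP[y /not_implyP[xv /not_implyP[yv nxy]]]].
have f_sym : symmetric (del_vertex v).
  by move=> i j; rewrite /= e_sym; congr (_ && _); rewrite andbC.
pose S : {pred 'I_n} := [pred i | connect (del_vertex v) x i]; exists S.
have vS : v \notin S.
  rewrite inE; apply/negP => /connectP[p]; case/lastP: p => [_ vx|p w].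
    by rewrite vx eqxx in xv.
  by rewrite rcons_path last_rcons => /andP[_ /and3P[_ _ wv]] vw; rewrite vw eqxx in wv.
have S_cl i j : i \in S -> e i j -> j != v -> j \in S.
  rewrite !inE => iS ij jv; apply: connect_trans (iS) (connect1 _); rewrite /= ij jv andbT.
  by apply: contraNneq vS => <-; rewrite inE.
split=> [z zc|].
  have /mem_cyclesp[zd za _] := zc.
  apply/eqP; rewrite -oppr_eq0 -sumrN; apply/eqP; rewrite -[RHS](cut_sum0 S zc).
  apply: eq_bigr => i iS; rewrite -za [RHS](bigD1 v vS) /= [X in _ + X]big1 ?addr0 //.
  move=> j /andP[jS jv]; apply: zd; apply: contra jS => ij; exact: S_cl iS ij jv.
have [j jS vj] : exists2 j, j \in S & e v j.
  apply: contrapT => nS; have : v \in S; last by rewrite (negPf vS).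
  apply: (@connected_mem S x); first by rewrite inE connect0.
  move=> i j iS ij; apply: S_cl (iS) (ij) _; apply: contra_notN nS => /eqP jv.
  by exists i; rewrite // e_sym -jv.
have [l lS vl] : exists2 l, l \notin S & e v l.
  apply: contrapT => nS; have : v \in [predC [predU1 v & S]]; last by rewrite !inE eqxx.
  apply: (@connected_mem [predC [predU1 v & S]] y).
    by rewrite !inE (negPf yv) /=; exact/negP.
  move=> i l; rewrite !inE !negb_or => /andP[iv iS] il.
  have lv : l != v.
    apply: contra_notN nS => /eqP lv; exists i; first by rewrite inE.
    by rewrite e_sym -lv.
  by rewrite lv; apply: contra iS => lS; apply: (S_cl l); rewrite ?inE // e_sym.
exists (delta_mx v j - delta_mx v l); first exact: dart_starsp.
rewrite (bigD1 j) //= big1 => [|i /andP[iS ij]].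
  rewrite !mxE !eqxx; case: (j =P l) => [jl|_] /=; last by rewrite subr0 addr0 oner_eq0.
  by rewrite -jl jS in lS.
rewrite !mxE !eqxx (negPf ij); case: eqP => [il|_] /=; last by rewrite subrr.
by rewrite -il iS in lS.
Qed.

(** A second neighbour of i is required because the row of a star function at a leaf is 0. *)
Lemma star_nowhere_zero : infinite_set [set: k]%classic ->
  exists2 v, v \in starsp & forall i j l, e i j -> e i l -> l != j -> v i j != 0.
Proof.
move=> kinf; have [p a u v|p|z zc zs] := @avoid_zeros _ _ starsp ('I_n * 'I_n)%type
  (enum [pred p | e p.1 p.2 && [exists l, e p.1 l && (l != p.2)]]) (fun p z => z p.1 p.2) kinf.
- by rewrite !mxE.
- rewrite mem_enum inE => /andP[ij /existsP[l /andP[il lj]]].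
  exists (delta_mx p.1 p.2 - delta_mx p.1 l); first exact: dart_starsp.
  by rewrite !mxE !eqxx (eq_sym p.2) (negPf lj) subr0 oner_eq0.
- exists z => // i j l ij il lj; apply: (zs (i, j)); rewrite mem_enum inE /= ij.
  by apply/existsP; exists l; rewrite il.
Qed.

End Connected.

(** * Polynomials in two variables, one for each end of an edge *)

Section Bivariate.
Variable k : fieldType.
Local Notation S := {poly {poly k}}.
Local Notation X := ('X%:P : S).
Local Notation Y := ('X : S).

(** Throughout, the coefficient of X^a Y^b is found at outer index b and inner index a, since X is
    the inner variable. *)
Lemma coef_mulX (p : S) a b : (X * p)`_b`_a = if a is a'.+1 then p`_b`_a' else 0.
Proof. by rewrite coefCM coefXM; case: a. Qed.

Lemma coef_mulY (p : S) a b : (Y * p)`_b`_a = if b is b'.+1 then p`_b'`_a else 0.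
Proof. by rewrite coefXM; case: b => //=; rewrite coef0. Qed.

(** The four summands are the pieces from which an element of k[Delta] is glued: a constant, one
    part on each axis, and a part proper to the edge. *)
Lemma poly2_split (p : S) : p = (p`_0`_0)%:P%:P + X * (drop_poly 1 p`_0)%:P
  + Y * map_poly polyC (drop_poly 1 (swapXY p)`_0)
  + X * Y * drop_poly 1 (map_poly (drop_poly 1) p).
Proof.
apply/polyP => b; apply/polyP => a; rewrite -mulrA !coefD !coef_mulX !coef_mulY.
have dE c d : (drop_poly 1 (map_poly (drop_poly 1) p))`_c`_d = p`_c.+1`_d.+1.
  by rewrite coef_drop_poly coef_map_id0 ?drop_poly0r // coef_drop_poly !addn1.
case: a => [|a]; case: b => [|b]; rewrite ?coef_mulY ?dE ?(coef_map polyC) /= !coefC /=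
  ?coef0 ?coef_drop_poly ?coef_swapXY ?addn1 ?addr0 ?add0r //.
by rewrite if_same add0r.
Qed.

Lemma map_polyCC_X (q : {poly k}) : (map_poly (polyC \o polyC) q).[X] = q%:P.
Proof.
elim/poly_ind: q => [|q c IH]; first by rewrite !rmorph0 horner0.
by rewrite !rmorphD !rmorphM /= map_polyX map_polyC !hornerE /= IH.
Qed.

Lemma map_polyCC_Y (q : {poly k}) : (map_poly (polyC \o polyC) q).[Y] = map_poly polyC q.
Proof.
elim/poly_ind: q => [|q c IH]; first by rewrite !rmorph0 horner0.
by rewrite !rmorphD !rmorphM /= !map_polyX !map_polyC !hornerE /= IH.
Qed.

Definition bihom (d : int) (p : S) := forall a b, p`_b`_a != 0 -> (a + b)%:Z = d.

Lemma bihom0 d : bihom d 0.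
Proof. by move=> a b; rewrite !coef0 eqxx. Qed.

Lemma bihomD d p q : bihom d p -> bihom d q -> bihom d (p + q).
Proof.
move=> hp hq a b; rewrite !coefD; have [p0|/hp//] := eqVneq p`_b`_a 0.
by rewrite p0 add0r => /hq.
Qed.

Lemma bihomN d p : bihom d p -> bihom d (- p).
Proof. by move=> hp a b; rewrite !coefN oppr_eq0 => /hp. Qed.

Lemma bihomB d p q : bihom d p -> bihom d q -> bihom d (p - q).
Proof. by move=> hp hq; apply: bihomD (hp) (bihomN hq). Qed.

Lemma bihomM d d' p q : bihom d p -> bihom d' q -> bihom (d + d') (p * q).
Proof.
move=> hp hq a b; apply: contraNeq => dab; rewrite coefM coef_sum big1 // => i _.
rewrite coefM big1 // => j _; apply/eqP; rewrite mulf_eq0; apply: contraNT dab.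
rewrite negb_or => /andP[/hp <- /hq <-]; have := ltn_ord i; have := ltn_ord j; lia.
Qed.

Lemma bihom_eq0 d p : bihom d p -> (d < 0)%R -> p = 0.
Proof.
move=> hp d0; apply/polyP => b; apply/polyP => a; rewrite !coef0; apply/eqP.
by apply: contraLR d0 => /hp <-.
Qed.

Definition hpart (d : nat) (p : S) : S :=
  \poly_(b < d.+1) (p`_b`_(d - b) *: 'X^(d - b)).

Lemma coef_hpart d p a b : (hpart d p)`_b`_a = if (a + b)%N == d then p`_b`_a else 0.
Proof.
rewrite coef_poly; case: ltnP => bd; last by rewrite coef0; case: eqP => // abd; lia.
rewrite coefZ coefXn; have [->|ad] := eqVneq a (d - b)%N.
  by rewrite subnK // eqxx mulr1.
by rewrite mulr0; case: eqP => // abd; case/eqP: ad; lia.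
Qed.

Lemma bihom_hpart (d : nat) p : bihom d (hpart d p).
Proof. by move=> a b; rewrite coef_hpart; case: (_ =P d) => [->//|]; rewrite eqxx. Qed.

Lemma hpart_id (d : nat) p : bihom d p -> hpart d p = p.
Proof.
move=> hp; apply/polyP => b; apply/polyP => a; rewrite coef_hpart.
by case: eqP => // abd; apply/esym/eqP; apply: contra_notT abd => /hp [].
Qed.

Lemma hpart_homog_neq (d d' : nat) p : bihom d p -> d != d' -> hpart d' p = 0.
Proof.
move=> hp dd'; apply/polyP => b; apply/polyP => a; rewrite coef_hpart !coef0.
by case: eqP => // abd'; apply/eqP; apply: contraNT dd' => /hp [<-]; rewrite abd'.
Qed.

Lemma hpartD d p q : hpart d (p + q) = hpart d p + hpart d q.
Proof.
apply/polyP => b; apply/polyP => a; rewrite !coefD !coef_hpart !coefD.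
by case: eqP; rewrite ?addr0.
Qed.

Lemma hpartN d p : hpart d (- p) = - hpart d p.
Proof.
apply/polyP => b; apply/polyP => a; rewrite !coefN !coef_hpart !coefN.
by case: eqP; rewrite ?oppr0.
Qed.

Lemma hpart_swap d p : hpart d (swapXY p) = swapXY (hpart d p).
Proof.
by apply/polyP => b; apply/polyP => a; rewrite coef_swapXY !coef_hpart coef_swapXY addnC.
Qed.

Lemma hpartM_homog (d d' : nat) p q : bihom d' p ->
  hpart (d' + d) (p * q) = p * hpart d q.
Proof.
move=> hp; apply/polyP => b; apply/polyP => a; rewrite coef_hpart !coefM !coef_sum.
transitivity (\sum_(i < b.+1) if (a + b)%N == (d' + d)%N then (p`_i * q`_(b - i))`_a else 0).
  by case: eqP => // _; rewrite big1.
apply: eq_bigr => i _; rewrite !coefM.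
transitivity (\sum_(j < a.+1) if (a + b)%N == (d' + d)%N then p`_i`_j * q`_(b - i)`_(a - j) else 0).
  by case: eqP => // _; rewrite big1.
apply: eq_bigr => j _; rewrite coef_hpart; have [->|/hp [jid]] := eqVneq p`_i`_j 0.
  by rewrite !mul0r if_same.
have := ltn_ord i; have := ltn_ord j => ja ib.
have -> : (a - j + (b - i) == d)%N = (a + b == d' + d)%N by apply/eqP/eqP; lia.
by case: eqP; rewrite ?mulr0.
Qed.

Lemma hpartMr_homog (d d' : nat) p q : bihom d' q ->
  hpart (d + d') (p * q) = hpart d p * q.
Proof. by move=> hq; rewrite addnC mulrC hpartM_homog // mulrC. Qed.

Lemma hpart_sum (p : S) : exists N : nat, (forall d : nat, (N <= d)%N -> hpart d p = 0) /\
  p = \sum_(d < N) hpart d p.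
Proof.
have [N NP] : exists N, forall a b, p`_b`_a != 0 -> (a + b < N)%N.
  exists (size p + \max_(b < size p) size (p`_b)%R)%N => a b ab.
  have bp : (b < size p)%N.
    by rewrite ltnNge; apply: contra ab => bp; rewrite (nth_default _ bp) coef0.
  have : (a < size (p`_b)%R)%N.
    by rewrite ltnNge; apply: contra ab => bp'; rewrite (nth_default _ bp').
  move=> /leq_trans/(_ (leq_bigmax (F := fun b : 'I_(size p) => size (p`_b)%R) (Ordinal bp))) ap.
  by have := leq_add bp (ltnW ap); rewrite addSn addnC.
exists N; split=> [d Nd|]; apply/polyP => b; apply/polyP => a.
  rewrite coef_hpart !coef0; case: eqP => // abd; apply/eqP.
  by apply: contraLR Nd => /NP; rewrite abd -ltnNge.
rewrite !coef_sum; have [p0|/NP abN] := eqVneq p`_b`_a 0.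
  by rewrite p0 big1 // => d _; rewrite coef_hpart p0 if_same.
rewrite (bigD1 (Ordinal abN)) //= coef_hpart eqxx big1 ?addr0 // => d dab.
by rewrite coef_hpart; case: eqP => // abd; case/eqP: dab; apply: val_inj.
Qed.

End Bivariate.

(** * The ring k[Delta] as the ring of compatible families of polynomials on the edges *)

Section StanleyReisnerRing.
Variables (k : fieldType) (n : nat) (e : rel 'I_n).
Local Notation R := (SRring k e).
Local Notation S := {poly {poly k}}.
Local Notation X := ('X%:P : S).
Local Notation Y := ('X : S).

(** With the value 0 at non-edges, the evaluation kills the Stanley--Reisner ideal for every pair
    (i, j), so that [rho i j] is always a ring map. *)
Definition edge_var (i j l : 'I_n) : S :=
  if ~~ e i j then 0 else if l == i then X else if l == j then Y else 0.

Definition edge_eval (i j : 'I_n) (p : {mpoly k[n]}) : S :=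
  mmap (polyC \o polyC) (edge_var i j) p.
Fact edge_eval_zmod_morphism i j : zmod_morphism (edge_eval i j).
Proof. exact: rmorphB. Qed.
HB.instance Definition _ i j := GRing.isZmodMorphism.Build {mpoly k[n]} S
  (edge_eval i j) (edge_eval_zmod_morphism i j).
Fact edge_eval_monoid_morphism i j : monoid_morphism (edge_eval i j).
Proof. by split; [exact: rmorph1|exact: rmorphM]. Qed.
HB.instance Definition _ i j := GRing.isMonoidMorphism.Build {mpoly k[n]} S
  (edge_eval i j) (edge_eval_monoid_morphism i j).

Lemma face_subset i j (F : {set 'I_n}) : e i j -> F \subset [set i; j]%SET -> face e F.
Proof.
move=> ij /fintype.subsetP Fij; rewrite /face.
have Fx l : l \in F -> (l == i) || (l == j) by move/Fij; rewrite !inE.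
have [iF|iF] := boolP (i \in F); have [jF|jF] := boolP (j \in F).
- apply/orP; right; apply/orP; right; apply/existsP; exists i; apply/existsP; exists j.
  rewrite ij; apply/eqP/setP => l; rewrite !inE; apply/idP/idP => [/Fx//|].
  by case/orP=> /eqP->.
- apply/orP; right; apply/orP; left; apply/existsP; exists i.
  apply/eqP/setP => l; rewrite !inE; apply/idP/eqP => [lF|->//].
  by have /orP[/eqP//|/eqP lj] := Fx l lF; rewrite lj (negPf jF) in lF.
- apply/orP; right; apply/orP; left; apply/existsP; exists j.
  apply/eqP/setP => l; rewrite !inE; apply/idP/eqP => [lF|->//].
  by have /orP[/eqP li|/eqP//] := Fx l lF; rewrite li (negPf iF) in lF.
- apply/orP; left; apply/eqP/setP => l; rewrite !inE; apply/negP => lF.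
  by have /orP[/eqP li|/eqP lj] := Fx l lF; [rewrite li (negPf iF) in lF|rewrite lj (negPf jF) in lF].
Qed.

Lemma edge_eval_var i j l : edge_eval i j 'X_l = edge_var i j l.
Proof. by rewrite /edge_eval mmapX mmap1U. Qed.

Lemma edge_eval_nonface i j F : ~~ face e F -> edge_eval i j (\prod_(l in F) 'X_l) = 0.
Proof.
move=> nF; rewrite rmorph_prod.
have [l lF l0] : exists2 l, l \in F & edge_var i j l = 0.
  have [ij|nij] := boolP (e i j); last first.
    have [F0|[l lF]] := set_0Vmem F; first by rewrite /face F0 eqxx in nF.
    by exists l; rewrite // /edge_var nij.
  have /fintype.subsetPn[l lF] : ~~ (F \subset [set i; j]%SET).
    by apply: contra nF => /(face_subset ij).
  rewrite !inE negb_or => /andP[/negPf li /negPf lj].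
  by exists l; rewrite // /edge_var ij li lj.
by rewrite (bigD1 l) //= edge_eval_var l0 mul0r.
Qed.

Lemma edge_eval_SRideal i j p : p \in @SRideal k n e -> edge_eval i j p = 0.
Proof.
move=> /asboolP[s [sN ->]]; rewrite rmorph_sum big_seq big1 //= => q /sN[F /= nF <-].
by rewrite -[q.1 *: _]/(q.1 * _) rmorphM /= edge_eval_nonface ?mulr0.
Qed.

(* The projection of k[Delta] onto the coordinate ring of the edge ij, with
   x_i in the inner variable and x_j in the outer one; it is the augmentation
   if ij is not an edge. *)
Definition rho (i j : 'I_n) (r : R) : S := edge_eval i j (repr (r : SR k e)).

Lemma rhoE i j p : rho i j (SRpi e p) = edge_eval i j p.
Proof.
rewrite /rho; apply/eqP; rewrite -subr_eq0 -rmorphB /= edge_eval_SRideal //.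
by rewrite -SRpi_eq; apply/eqP; exact: SRpi_reprK.
Qed.

Lemma SRpiP (r : R) : exists p, r = SRpi e p.
Proof. by exists (repr (r : SR k e)); rewrite SRpi_reprK. Qed.

Lemma SRpi1 : SRpi e 1 = 1 :> R.
Proof. exact: (rmorph1 (@SRpi k n e)). Qed.
Lemma SRpiM p q : SRpi e (p * q) = (SRpi e p : R) * SRpi e q.
Proof. exact: (rmorphM (@SRpi k n e)). Qed.
Lemma SRpiB p q : SRpi e (p - q) = (SRpi e p : R) - SRpi e q.
Proof. exact: (rmorphB (@SRpi k n e)). Qed.
Lemma SRpiD p q : SRpi e (p + q) = (SRpi e p : R) + SRpi e q.
Proof. exact: (rmorphD (@SRpi k n e)). Qed.
Lemma SRpi0 : SRpi e 0 = 0 :> R.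
Proof. exact: (rmorph0 (@SRpi k n e)). Qed.

Fact rho_zmod_morphism i j : zmod_morphism (rho i j).
Proof.
move=> r s; have [[p ->] [q ->]] := conj (SRpiP r) (SRpiP s).
by rewrite -SRpiB !rhoE rmorphB.
Qed.
HB.instance Definition _ i j := GRing.isZmodMorphism.Build R S (rho i j)
  (rho_zmod_morphism i j).
Fact rho_monoid_morphism i j : monoid_morphism (rho i j).
Proof.
split=> [|r s]; first by rewrite -SRpi1 rhoE rmorph1.
have [[p ->] [q ->]] := conj (SRpiP r) (SRpiP s).
by rewrite -SRpiM !rhoE rmorphM.
Qed.
HB.instance Definition _ i j := GRing.isMonoidMorphism.Build R S (rho i j)
  (rho_monoid_morphism i j).

Lemma SR_scalarE (c : k) : c%:A = SRpi e c%:MP :> R.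
Proof. exact: mulr1. Qed.

Lemma rho_alg i j (c : k) : rho i j c%:A = c%:P%:P.
Proof. by rewrite SR_scalarE rhoE /edge_eval mmapC. Qed.

Lemma rho_var i j l : rho i j (SRvar k e l) = edge_var i j l.
Proof. by rewrite rhoE edge_eval_var. Qed.

Lemma SR_ind (P : R -> Prop) : (forall c : k, P c%:A) -> (forall l, P (SRvar k e l)) ->
  (forall r s, P r -> P s -> P (r + s)) -> (forall r s, P r -> P s -> P (r * s)) ->
  forall r, P r.
Proof.
move=> Pc Px PD PM r; have [p ->] := SRpiP r; elim/mpolyind: p => [|c m p _ _ Pp].
  by have := Pc 0; rewrite scale0r SRpi0.
have P1 : P 1 by have := Pc 1; rewrite scale1r.
rewrite SRpiD; apply: PD => //; rewrite -mul_mpolyC SRpiM; apply: (PM).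
  by rewrite -SR_scalarE.
rewrite mpolyXE_id; apply: (big_ind (fun q => P (SRpi e q))).
- by rewrite SRpi1.
- by move=> p' q' Pp' Pq'; rewrite SRpiM; exact: (PM).
- move=> l _; elim: (m l) => [|d IH]; first by rewrite expr0 SRpi1.
  by rewrite exprS SRpiM; exact: PM (Px l) IH.
Qed.

(** Restriction to an edge keeps exactly the monomials in x_i and x_j, with unchanged
    coefficients. *)
Lemma coef_edge_eval i j p a b : e i j -> i != j ->
  (edge_eval i j p)`_b`_a = p@_(U_(i) *+ a + U_(j) *+ b)%MM.
Proof.
move=> ij inj; rewrite [p]mpolyE rmorph_sum (raddf_sum (mcoeff _)) !coef_sum.
apply: eq_bigr => m _; rewrite /= mcoeffZ mcoeffX -mul_mpolyC rmorphM /=.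
rewrite /edge_eval mmapC /= !coefCM; congr (_ * _).
rewrite mmapX /mmap1.
have mE : m == (U_(i) *+ a + U_(j) *+ b)%MM =
    [&& m i == a, m j == b & [forall l, (l == i) || (l == j) || (m l == 0)%N]].
  apply/eqP/and3P => [->|[/eqP ma /eqP mb /forallP m0]].
    split; rewrite ?mnmDE ?mulmnE ?mnm1E.
    - by rewrite eqxx (eq_sym j) (negPf inj) mul1n mul0n addn0.
    - by rewrite eqxx (negPf inj) mul1n mul0n add0n.
    apply/forallP => l; rewrite mnmDE !mulmnE !mnm1E (eq_sym i) (eq_sym j).
    by do !case: eqP => //.
  apply/mnmP => l; rewrite mnmDE !mulmnE !mnm1E (eq_sym i) (eq_sym j).
  have := m0 l; have [->|li] := eqVneq l i.
    by rewrite (negPf inj) mul1n mul0n addn0 ma.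
  have [->|lj] := eqVneq l j; first by rewrite mul0n mul1n add0n mb.
  by rewrite !mul0n => /eqP.
rewrite mE; have [mij|] := boolP [forall l, (l == i) || (l == j) || (m l == 0)%N]; last first.
  rewrite negb_forall => /existsP[l]; rewrite !negb_or => /andP[/andP[li lj] ml].
  rewrite (bigD1 l) //= /edge_var ij (negPf li) (negPf lj) expr0n (negPf ml) mul0r.
  by rewrite !coef0 !andbF.
rewrite (bigD1 i) //= (bigD1 j) 1?eq_sym //= big1 => [|l /andP[li lj]]; last first.
  by have := forallP mij l; rewrite (negPf li) (negPf lj) /= => /eqP->.
rewrite mulr1 /edge_var ij eqxx (eq_sym j) (negPf inj) eqxx -rmorphXn /= coefCM.
by rewrite andbT (eq_sym _ b) coefXn mulr_natr coefMn coefXn -mulnb natrM mulr_natr.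
Qed.

Lemma face_support (m : 'X_{1..n}) : ~~ face e [set l | m l != 0%N] -> SRpi e ('X_[m] : {mpoly k[n]}) = 0.
Proof.
set F := finset _ => nF; apply/eqP; rewrite -SRpi0 SRpi_eq subr0; apply/asboolP.
exists [:: ('X_[(m - \sum_(l in F) U_(l))%MM], \prod_(l in F) 'X_l)].
split; first by move=> p; rewrite inE => /eqP-> /=; exists F.
rewrite big_seq1 -[_ *: _]/(_ * _) /= -(big_morph _ (@mpolyXD n k) (mpolyX0 n k)) -mpolyXD.
congr 'X_[_]; apply/mnmP => l; rewrite mnmDE mnmBE mnm_sumE; under eq_bigr do rewrite mnm1E.
rewrite subnK //; have [lF|lF] := boolP (l \in F).
  rewrite (bigD1 l) //= eqxx big1 ?addn0 ?lt0n => [|i /andP[_ /negPf->] //].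
  by move: lF; rewrite inE.
by rewrite big1 // => i iF; apply/eqP; rewrite eqb0; apply: contraNneq lF => <-.
Qed.

Hypotheses (e_sym : ssrbool.symmetric e) (e_irr : irreflexive e) (e_conn : connected e).
Hypothesis n_ge3 : (3 <= n)%N.

Lemma edge_neq i j : e i j -> i != j.
Proof. by apply: contraTneq => ->; rewrite e_irr. Qed.

(** A monomial that is nonzero in k[Delta] is supported on a face. Every face lies in an edge, as
    there are no isolated vertices, and on that edge the coefficient can be read off. *)
Lemma rho_inj (r : R) : (forall i j, e i j -> rho i j r = 0) -> r = 0.
Proof.
have [p ->] := SRpiP r => h; rewrite [p]mpolyE.
rewrite -SRpi0; apply/eqP; rewrite SRpi_eq subr0.
apply: rpred_sum => m _; have [mF|nF] := boolP (face e [set l | m l != 0%N]); last first.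
  have := face_support nF; rewrite -SRpi0 => /eqP; rewrite SRpi_eq subr0 => Xm.
  by rewrite -mul_mpolyC; apply: idealMr.
have [i [j [ij mij]]] : exists i j, e i j /\ forall l, l != i -> l != j -> m l = 0%N.
  have mF0 l F : [set l | m l != 0%N] = F -> l \notin F -> m l = 0%N.
    by move=> <-; rewrite inE negbK => /eqP.
  case/or3P: mF => [/eqP mF|/existsP[i /eqP mF]|/existsP[i /existsP[j /andP[ij /eqP mF]]]].
  - have i : 'I_n by apply: (Ordinal (n := n) (m := 0)); apply: leq_trans n_ge3.
    have [j ij] := exists_neighbour e_conn n_ge3 i; exists i, j; split=> // l _ _.
    by apply: mF0 mF _; rewrite inE.
  - have [j ij] := exists_neighbour e_conn n_ge3 i; exists i, j; split=> // l li _.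
    by apply: mF0 mF _; rewrite inE.
  - exists i, j; split=> // l li lj.
    by apply: mF0 mF _; rewrite !inE negb_or li.
suff -> : p@_m = 0 by rewrite scale0r rpred0.
have := coef_edge_eval p (m i) (m j) ij (edge_neq ij).
rewrite -rhoE h // !coef0 => ->; congr (_@_ _); apply/mnmP => l.
rewrite mnmDE !mulmnE !mnm1E (eq_sym i) (eq_sym j).
have [->|li] := eqVneq l i; first by rewrite (negPf (edge_neq ij)) mul1n mul0n addn0.
have [->|lj] := eqVneq l j; first by rewrite mul0n mul1n.
by rewrite !mul0n mij.
Qed.

Lemma rho_eq (r s : R) : (forall i j, e i j -> rho i j r = rho i j s) -> r = s.
Proof.
move=> h; apply/eqP; rewrite -subr_eq0; apply/eqP/rho_inj => i j ij.
by rewrite rmorphB /= h // subrr.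
Qed.

Lemma rho_swap i j r : swapXY (rho i j r) = rho j i r.
Proof.
move: r; apply: SR_ind => [c|l|r s rr ss|r s rr ss].
- by rewrite !rho_alg swapXY_polyC map_polyC.
- rewrite !rho_var /edge_var e_sym; case: ifP => /= ij; first by rewrite rmorph0.
  have [->|li] := eqVneq l i; last by case: eqP => _; rewrite ?swapXY_X ?rmorph0.
  by rewrite swapXY_Y; case: eqP => // ijE; rewrite ijE e_irr in ij.
- by rewrite !rmorphD /= rr ss.
- by rewrite !rmorphM /= rr ss.
Qed.

(** Outer index 0 means x_j = 0: both sides are the restriction of r to the x_i-axis. *)
Lemma rho_axis i j j' r : e i j -> e i j' -> (rho i j r)`_0 = (rho i j' r)`_0.
Proof.
move=> ij ij'; move: r; apply: SR_ind => [c|l|r s rr ss|r s rr ss].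
- by rewrite !rho_alg.
- rewrite !rho_var /edge_var ij ij' /=; case: eqP => [//|_].
  by case: eqP => _; case: eqP => _; rewrite ?coefX ?coef0.
- by rewrite !rmorphD /= !coefD rr ss.
- by rewrite !rmorphM /= !coef0M rr ss.
Qed.

Definition edge_lift (i j : 'I_n) (p : S) : R :=
  (map_poly (horner_alg (SRvar k e i)) p).[SRvar k e j].

Lemma rho_horner_alg a b i (q : {poly k}) :
  rho a b (horner_alg (SRvar k e i) q) = (map_poly (polyC \o polyC) q).[edge_var a b i].
Proof.
elim/poly_ind: q => [|q c IH]; first by rewrite !rmorph0 horner0.
rewrite !rmorphD !rmorphM /= horner_algX horner_algC map_polyX map_polyC /=.
by rewrite !hornerE -IH rho_var rho_alg.
Qed.

Lemma rho_edge_liftK i j p : e i j -> rho i j (edge_lift i j p) = p.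
Proof.
move=> ij; rewrite /edge_lift; elim/poly_ind: p => [|p c IH]; first by rewrite !rmorph0 horner0 rmorph0.
rewrite !rmorphD !rmorphM /= map_polyX map_polyC /= !hornerE rmorphD rmorphM /= IH.
rewrite rho_var rho_horner_alg /edge_var ij eqxx (eq_sym j) (negPf (edge_neq ij)) eqxx.
congr (_ + _); elim/poly_ind: c {IH} => [|q c IH]; first by rewrite !rmorph0 horner0.
by rewrite !rmorphD !rmorphM /= map_polyX map_polyC !hornerE /= IH.
Qed.

Lemma rho_edge_var2 a b i j : e a b -> e i j -> (i, j) != (a, b) -> (i, j) != (b, a) ->
  rho a b (SRvar k e i * SRvar k e j) = 0.
Proof.
move=> ab ij; rewrite !xpair_eqE rmorphM /= !rho_var /edge_var ab /=.
have [ia|ia] := eqVneq i a; have [ja|ja] := eqVneq j a; rewrite ?mul0r ?mulr0 //=.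
- by rewrite ia ja e_irr in ij.
- by move=> /negPf-> _; rewrite mulr0.
- by rewrite andbT => _ /negPf->; rewrite mul0r.
- have [ib|ib] := eqVneq i b; have [jb|jb] := eqVneq j b; rewrite ?mul0r ?mulr0 //=.
  by rewrite ib jb e_irr in ij.
Qed.

(** Agreement on the axes is the only constraint on families coming from k[Delta]. The constant
    terms then agree by connectedness. *)
Lemma rho_compat (q : 'I_n -> 'I_n -> S) :
  (forall i j, e i j -> swapXY (q i j) = q j i) ->
  (forall i j j', e i j -> e i j' -> (q i j)`_0 = (q i j')`_0) ->
  exists r : R, forall i j, e i j -> rho i j r = q i j.
Proof.
move=> q_swap q_axis; have [nb nbP] := choice (exists_neighbour e_conn n_ge3).
have x0 : 'I_n by apply: (Ordinal (n := n) (m := 0)); apply: leq_trans n_ge3.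
pose c := (q x0 (nb x0))`_0`_0.
have qc i j : e i j -> (q i j)`_0`_0 = c.
  move=> ij; rewrite (q_axis _ _ _ ij (nbP i)); apply/eqP.
  pose T : {pred 'I_n} := [pred i | (q i (nb i))`_0`_0 == c].
  have Tcl a b : a \in T -> e a b -> b \in T.
    move=> /eqP ac ab; have ba : e b a by rewrite e_sym.
    by rewrite inE -(q_axis _ _ _ ba (nbP b)) -(q_swap a b ab) coef_swapXY (q_axis _ _ _ ab (nbP a)) ac.
  have xT : x0 \in T by rewrite inE.
  have := connected_mem e_conn i xT Tcl.
  by [].
pose g i := drop_poly 1 (q i (nb i))`_0.
pose h i j := drop_poly 1 (map_poly (drop_poly 1) (q i j)).
(* The pieces of [poly2_split] are glued; each edge is used in one orientation only, and x_i x_j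
   confines its piece to that edge. *)
pose r : R := c%:A + \sum_i SRvar k e i * horner_alg (SRvar k e i) (g i)
  + \sum_i \sum_(j | e i j && (i < j)%N) SRvar k e i * SRvar k e j * edge_lift i j (h i j).
suff rE a b : e a b -> (a < b)%N -> rho a b r = q a b.
  exists r => a b ab; have [ltab|ltba|/val_inj abE] := ltngtP a b; first exact: rE.
    by rewrite -rho_swap rE ?q_swap // e_sym.
  by rewrite abE e_irr in ab.
move=> ab ltab; have anb := edge_neq ab; have ba : e b a by rewrite e_sym.
rewrite /r !rmorphD !rmorph_sum /= rho_alg.
rewrite (bigD1 a) //= (bigD1 b) 1?eq_sym //= [X in _ + (_ + (_ + X)) + _]big1 ?addr0; last first.
  by move=> i /andP[ia ib]; rewrite rmorphM /= rho_var /edge_var ab (negPf ia) (negPf ib) mul0r.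
rewrite addrA (bigD1 a) //= [X in _ + (_ + X)](@big1 _ _ _ 'I_n) ?addr0; last first.
  move=> i ia; rewrite rmorph_sum big1 //= => j /andP[ij ltij]; rewrite rmorphM /=.
  rewrite rho_edge_var2 ?mul0r // ?xpair_eqE ?(negPf ia) //.
  by apply: contraTN ltij => /andP[/eqP-> /eqP->]; rewrite -leqNgt ltnW.
rewrite rmorph_sum (bigD1 b) /= ?ab // big1 ?addr0; last first.
  move=> j /andP[/andP[aj ltaj] jb]; rewrite rmorphM /=.
  by rewrite rho_edge_var2 ?mul0r // ?xpair_eqE ?(negPf jb) ?andbF ?(negPf anb).
rewrite !rmorphM /= !rho_horner_alg rho_edge_liftK // !rho_var /edge_var ab eqxx.
rewrite (eq_sym b) (negPf anb) eqxx /= map_polyCC_X map_polyCC_Y.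
have ga : g a = drop_poly 1 (q a b)`_0 by rewrite /g (q_axis _ _ _ ab (nbP a)).
have gb : g b = drop_poly 1 (swapXY (q a b))`_0 by rewrite q_swap // /g (q_axis _ _ _ ba (nbP b)).
by rewrite ga gb -(qc a b ab) /h -poly2_split.
Qed.

Lemma bihom_rho i j d r : e i j -> apart R d r -> bihom d (rho i j r).
Proof.
move=> ij; case: d => d /=; last by move=> ->; rewrite rmorph0; exact: bihom0.
move=> [p /dhomogP ph <-] a b; rewrite rhoE coef_edge_eval ?edge_neq // -mcoeff_msupp.
by move=> /ph /= <-; rewrite mdegD !mdegMn !mdeg1 !mul1n.
Qed.

Lemma apart_hpart d (r : R) : exists2 rd, apart R d%:Z rd &
  forall i j, e i j -> rho i j rd = hpart d (rho i j r).
Proof.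
have [p ->] := SRpiP r; exists (SRpi e (pihomog mdeg d p)).
  by exists (pihomog mdeg d p) => //=; exact: pihomogP.
move=> i j ij; apply/polyP => b; apply/polyP => a; rewrite coef_hpart !rhoE.
rewrite !coef_edge_eval ?edge_neq //; set m := (_ + _)%MM.
have -> : (a + b)%N = mdeg m by rewrite mdegD !mdegMn !mdeg1 !mul1n.
rewrite pihomogE raddf_sum /= [p in RHS]mpolyE raddf_sum /=.
rewrite [in LHS]big_mkcond /=; case: ifP => md; last rewrite big1 //; last first.
  move=> m' _; case: ifP => // m'd; rewrite mcoeffZ mcoeffX.
  by case: (m' =P m) => [mm'|_]; rewrite ?mulr0 //; rewrite -mm' m'd in md.
apply: eq_bigr => m' _; case: ifP => // m'd; rewrite mcoeffZ mcoeffX.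
by case: (m' =P m) => [mm'|_]; rewrite ?mulr0 //; rewrite mm' md in m'd.
Qed.

Lemma apart_SRvar l : apart R 1 (SRvar k e l).
Proof. by exists 'X_l => //=; rewrite dhomogX /= mdeg1. Qed.

Lemma apart_linear_form (c : 'I_n -> k) : apart R 1 (\sum_l (c l)%:A * SRvar k e l).
Proof.
exists (\sum_l (c l)%:MP * 'X_l).
  by apply: rpred_sum => l _; rewrite mul_mpolyC rpredZ // dhomogX /= mdeg1.
rewrite -[RHS]/(_ : SR k e) rmorph_sum; apply: eq_bigr => l _.
by rewrite SR_scalarE rmorphM.
Qed.

End StanleyReisnerRing.

Local Open Scope classical_set_scope.
Local Open Scope ring_scope.

(** * Generalities on spans, gradings, summands, Krull dimension and multiplicity *)

Section Span.
Variables (A : comNzRingType) (M : lmodType A).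

Lemma span_submodule (N : set M) : N 0 -> (forall a u v, N u -> N v -> N (a *: u + v)) ->
  span N = N.
Proof.
move=> N0 NP; apply/seteqP; split; last exact: span_sub.
move=> _ [s [sN ->]]; elim: s sN => [|p s IH] sN; first by rewrite big_nil.
rewrite big_cons; apply: NP; first exact: sN (mem_head _ _).
by apply: IH => q qs; apply: sN; rewrite inE qs orbT.
Qed.

Lemma span_min (N N' : set M) : N' 0 -> (forall a u v, N' u -> N' v -> N' (a *: u + v)) ->
  N `<=` N' -> span N `<=` N'.
Proof.
move=> N0 NP NN' _ [s [sN ->]]; elim: s sN => [|p s IH] sN; first by rewrite big_nil.
rewrite big_cons; apply: NP; first exact/NN'/(sN _ (mem_head _ _)).
by apply: IH => q qs; apply: sN; rewrite inE qs orbT.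
Qed.

Lemma span0 (N : set M) : span N 0.
Proof. by exists [::]; rewrite big_nil. Qed.

Lemma spanP (N : set M) a u v : span N u -> span N v -> span N (a *: u + v).
Proof.
by move=> su sv; apply/asboolP; apply: (in_span_submod_closed N).2; apply/asboolP.
Qed.

Lemma quotmod_eq (N : set M) u v : quotmod_pi N u = quotmod_pi N v <-> span N (u - v).
Proof.
by split=> [/eqP|h]; [rewrite quotmod_pi_eq => /asboolP|apply/eqP; rewrite quotmod_pi_eq; apply/asboolP].
Qed.

Lemma quotmod_eq0 (N : set M) u : quotmod_pi N u = 0 <-> span N u.
Proof. by rewrite -(raddf0 (quotmod_pi N)) quotmod_eq subr0. Qed.

Lemma submod_valB (N : set M) (u v : submod N) : val (u - v) = val u - val v.
Proof. by []. Qed.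
Lemma submod_valD (N : set M) (u v : submod N) : val (u + v) = val u + val v.
Proof. by []. Qed.
Lemma submod_val_sum (N : set M) (I : Type) (r : seq I) (F : I -> submod N) :
  val (\sum_(i <- r) F i) = \sum_(i <- r) val (F i).
Proof. by apply: big_morph => //; exact: submod_valD. Qed.
Lemma submod_valP (N : set M) a (u v : submod N) : val (a *: u + v) = a *: val u + val v.
Proof. by []. Qed.

End Span.

Section LinearOf.
Variables (A : comNzRingType) (U V : lmodType A) (f : U -> V).
Definition linear_of (_ : linear f) := f.
Hypothesis fl : linear f.
HB.instance Definition _ := GRing.isLinear.Build A U V _ (linear_of fl) fl.
Lemma linear_fun : exists g : {linear U -> V}, forall u, g u = f u.
Proof. by exists (linear_of fl). Qed.
End LinearOf.

Section Graded.
Variables (k : fieldType) (A : gralg k).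
Implicit Types M C : gmod A.

(** A grading in degrees at least 0, given by its projections. Projections that preserve a submodule
    pass to it and to the quotient, which is awkward to see from unique decompositions. *)
Record graded_by M (pr : nat -> M -> M) : Prop := GradedBy {
  gr_sub : forall j, part M j 0 /\ (forall u v, part M j u -> part M j v -> part M j (u - v));
  gr_scale : forall i j (a : A) (u : M), apart A i a -> part M j u -> part M (i + j) (a *: u);
  gr_morph : forall d u v, pr d (u - v) = pr d u - pr d v;
  gr_part : forall (d : nat) u, part M d%:Z (pr d u);
  gr_id : forall (d : nat) u, part M d%:Z u -> pr d u = u;
  gr_other : forall (d d' : nat) u, part M d%:Z u -> d != d' -> pr d' u = 0;
  gr_neg : forall j u, (j < 0)%R -> part M j u -> u = 0;
  gr_sum : forall u, exists N : nat, (forall d : nat, (N <= d)%N -> pr d u = 0) /\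
    u = \sum_(d < N) pr d u }.

Lemma gr_pr0 M pr (h : @graded_by M pr) d : pr d 0 = 0.
Proof. by rewrite -[X in pr d X](subrr 0) (gr_morph h) subrr. Qed.

Lemma gr_prN M pr (h : @graded_by M pr) d u : pr d (- u) = - pr d u.
Proof. by rewrite -[X in pr d X]sub0r (gr_morph h) gr_pr0 // sub0r. Qed.

Lemma gr_prD M pr (h : @graded_by M pr) d u v : pr d (u + v) = pr d u + pr d v.
Proof. by rewrite -{1}[v]opprK (gr_morph h) gr_prN // opprK. Qed.

Lemma gr_pr_sum M pr (h : @graded_by M pr) d (I : Type) (r : seq I) (F : I -> M) :
  pr d (\sum_(i <- r) F i) = \sum_(i <- r) pr d (F i).
Proof. by apply: big_morph => [u v|]; [exact: gr_prD|exact: gr_pr0]. Qed.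

Lemma fsbig_nat (V : nmodType) (c : int -> V) (N : nat) :
  (forall j, (j < 0)%R -> c j = 0) -> (forall d : nat, (N <= d)%N -> c d%:Z = 0) ->
  \sum_(j \in [set: int]) c j = \sum_(d < N) c d%:Z.
Proof.
move=> cneg cN; rewrite (@fsbigE _ _ _ _ _ [seq Posz d | d <- iota 0 N] c).
- by rewrite big_map big_mkcond /= -[N in iota _ N]subn0 big_mkord; apply: eq_bigr => d _; rewrite in_setT.
- by rewrite map_inj_uniq ?iota_uniq // => i j [].
- by [].
- move=> [d|d] _ dN; last exact: cneg.
  apply: cN; rewrite leqNgt; apply: contra dN => dN; apply/mapP; exists d => //.
  by rewrite mem_iota.
Qed.

Lemma finite_support_bound (V : nmodType) (c : int -> V) : finite_set [set j | c j <> 0] ->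
  exists N : nat, forall d : nat, (N <= d)%N -> c d%:Z = 0.
Proof.
move=> /finite_seqP[s sE]; exists (\sum_(x <- s) `|x|).+1%N => d dN.
apply: contrapT => cd; have : [set j | c j <> 0] d%:Z by [].
rewrite sE /= => ds; move: dN; rewrite (big_rem _ ds) /=; lia.
Qed.

Lemma graded_by_graded M pr : @graded_by M pr -> graded M.
Proof.
move=> h; split; [exact: gr_sub h|exact: gr_scale h|move=> m].
have [N [Nm mE]] := gr_sum h m.
exists (fun j => if j is Posz d then pr d m else 0); split; first split.
- by case=> d; [exact: gr_part h _ _|have [] := gr_sub h (Negz d)].
- apply: (@sub_finite_set _ _ [set` [seq Posz d | d <- iota 0 N]]); last exact: finite_seq.
  move=> [d|d] //= dm; apply/mapP; exists d => //; rewrite mem_iota /= add0n.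
  by rewrite ltnNge; apply: contra_notN dm => /Nm.
- by rewrite (@fsbig_nat _ _ N) //; case.
move=> c [cp cf cE]; apply/funext => -[d|d]; last by rewrite (gr_neg h (j := Negz d) (u := c _)).
have [N' N'c] := finite_support_bound cf.
have {1}-> : m = \sum_(d < maxn N' d.+1) c d%:Z.
  rewrite cE; apply: fsbig_nat => [j j0|d' dN]; first exact: gr_neg h _ _ j0 (cp j).
  by apply: N'c; rewrite (leq_trans _ dN) // leq_maxl.
have dN : (d < maxn N' d.+1)%N by rewrite leq_maxr.
rewrite (gr_pr_sum h) (bigD1 (Ordinal dN)) //= (gr_id h) // big1 ?addr0 // => i id.
by rewrite (gr_other h (cp _)) //; apply: contra id => /eqP ie; apply/eqP/val_inj.
Qed.

(* Uniqueness of homogeneous components in the target lifts homogeneous elements. *)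
Lemma graded_lift M C pr (psi : {linear M -> C}) (d : int) (c : C) :
  @graded_by M pr -> graded C -> gmorph psi -> range psi = [set: C] -> part C d c ->
  exists2 u, part M d u & psi u = c.
Proof.
move=> h [Csub _ Cuniq] psi_gr psi_surj cd.
move: (psi_surj) => /seteqP[_ /(_ c I)[u _ uc]].
have [f [fP f_uniq]] := Cuniq c.
have [N [Nu uE]] := gr_sum h u.
pose c1 (j : int) := if j is Posz d then psi (pr d u) else 0.
pose c2 (j : int) := if j == d then c else 0.
have E1 : f = c1.
  apply: f_uniq; split.
  - by case=> d' /=; [exact/psi_gr/(gr_part h)|have [] := Csub (Negz d')].
  - apply: (@sub_finite_set _ _ [set` [seq Posz d | d <- iota 0 N]]); last exact: finite_seq.
    move=> [d'|d'] //= dm; apply/mapP; exists d' => //; rewrite mem_iota /= add0n.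
    by rewrite ltnNge; apply: contra_notN dm => /Nu ->; rewrite raddf0.
  - rewrite (@fsbig_nat _ _ N) //=; first by rewrite -uc [in LHS]uE raddf_sum.
      by case.
    by move=> d' /Nu ->; rewrite raddf0.
have E2 : f = c2.
  apply: f_uniq; split.
  - move=> j; rewrite /c2; case: eqP => [->//|_]; by have [] := Csub j.
  - apply: (@sub_finite_set _ _ [set` [:: d]]); last exact: finite_seq.
    by move=> j /=; rewrite /c2 inE; case: eqP.
  - rewrite (@fsbigE _ _ _ _ _ [:: d] c2) //; first by rewrite big_cons big_nil in_setT /c2 eqxx /= addr0.
    by move=> j _; rewrite inE /c2 => /negPf->.
have := congr1 (fun g => g d) (etrans (esym E1) E2); rewrite /c2 eqxx /c1.
case: d {E1 E2 c2 cd} => d E; first by exists (pr d u); [exact: gr_part h _ _|].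
by exists 0; rewrite ?raddf0 //; have [] := gr_sub h (Negz d).
Qed.

Definition quot_pr M (pr : nat -> M -> M) (N : set M) d (q : gquot N) : gquot N :=
  quotmod_pi N (pr d (repr (q : quotmod N))).

Lemma quot_prE M pr (N : set M) : @graded_by M pr ->
  (forall d u, span N u -> span N (pr d u)) ->
  forall d u, quot_pr pr d (quotmod_pi N u) = quotmod_pi N (pr d u).
Proof.
move=> h stab d u; apply/quotmod_eq; rewrite -(gr_morph h); apply: stab.
by apply/quotmod_eq; rewrite quotmod_reprK.
Qed.

Lemma graded_quot M pr (N : set M) : @graded_by M pr ->
  (forall d u, span N u -> span N (pr d u)) -> @graded_by (gquot N) (quot_pr pr (N := N)).
Proof.
move=> h stab; have prE := quot_prE h stab.
have piP (q : gquot N) : exists u, q = quotmod_pi N u.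
  by exists (repr (q : quotmod N)); rewrite quotmod_reprK.
split.
- move=> j; split=> [|_ _ [u uj <-] [v vj <-]].
    by exists 0; [exact: (gr_sub h j).1|rewrite raddf0].
  by exists (u - v); [exact: (gr_sub h j).2|rewrite raddfB].
- move=> i j a _ ai [u uj <-]; exists (a *: u); first exact: gr_scale h _ _ _ _ ai uj.
  by rewrite linearZ.
- move=> d q q'; have [[u ->] [v ->]] := conj (piP q) (piP q').
  by rewrite -raddfB !prE (gr_morph h) raddfB.
- by move=> d q; have [u ->] := piP q; rewrite prE; exists (pr d u) => //; exact: gr_part h _ _.
- by move=> d _ [u ud <-]; rewrite prE (gr_id h).
- by move=> d d' _ [u ud <-] dd'; rewrite prE (gr_other h ud dd') raddf0.
- by move=> j _ j0 [u uj <-]; rewrite (gr_neg h j0 uj) raddf0.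
- move=> q; have [u ->] := piP q; have [N' [Nu uE]] := gr_sum h u.
  exists N'; split=> [d /Nu ud|]; first by rewrite prE ud raddf0.
  by rewrite {1}uE raddf_sum; apply: eq_bigr => d _; rewrite prE.
Qed.

Definition sub_pr M (pr : nat -> M -> M) (N : set M) d (u : gsub N) : gsub N :=
  insubd (0 : submod N) (pr d (val u)).

Lemma val_sub_pr M pr (N : set M) : (forall d u, span N u -> span N (pr d u)) ->
  forall d (u : gsub N), val (sub_pr pr d u) = pr d (val u).
Proof.
move=> stab d u; rewrite val_insubd ifT //; apply/asboolP/stab/asboolP; exact: valP u.
Qed.

Lemma graded_gsub M pr (N : set M) : @graded_by M pr ->
  (forall d u, span N u -> span N (pr d u)) -> @graded_by (gsub N) (sub_pr pr (N := N)).
Proof.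
move=> h stab; have prE := val_sub_pr stab; split.
- move=> j; split=> [|u v uj vj] /=; first exact: (gr_sub h j).1.
  exact: (gr_sub h j).2.
- by move=> i j a u ai uj; exact: gr_scale h _ _ _ _ ai uj.
- by move=> d u v; apply: val_inj; rewrite submod_valB !prE submod_valB (gr_morph h).
- by move=> d u; rewrite /= prE; exact: gr_part h _ _.
- by move=> d u ud; apply: val_inj; rewrite prE (gr_id h).
- by move=> d d' u ud dd'; apply: val_inj; rewrite prE (gr_other h ud dd').
- by move=> j u j0 uj; apply: val_inj; rewrite (gr_neg h j0 uj).
- move=> u; have [N' [Nu uE]] := gr_sum h (val u).
  exists N'; split=> [d /Nu ud|]; first by apply: val_inj; rewrite prE ud.
  by apply: val_inj; rewrite uE submod_val_sum; apply: eq_bigr => d _; rewrite prE.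
Qed.

Section KSummand.
Variable eps : {rmorphism A -> k}.
Hypotheses (eps_alg : forall c, eps c%:A = c)
  (eps_part : forall d a, d != 0 -> apart A d a -> eps a = 0)
  (eps_ker : forall a, span (@posdeg k A) (a - (eps a)%:A))
  (apart_alg : forall c : k, apart A 0 c%:A) (apart0 : forall d, apart A d 0).

Lemma eps_span a : span (@posdeg k A) a -> eps a = 0.
Proof.
have := @span_min _ (gself A) (@posdeg k A) [set a | eps a = 0]; apply.
- exact: rmorph0.
- by move=> b u v /= ub vb; rewrite -[b *: u]/(b * _) rmorphD rmorphM /= ub vb mulr0 addr0.
- by move=> b [i i0 bi] /=; apply: eps_part bi; rewrite gt_eqF.
Qed.

Lemma gresidue_eq0 a : quotmod_pi (@posdeg k A) a = 0 <-> eps a = 0.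
Proof.
rewrite quotmod_eq0; split; first exact: eps_span.
by move=> a0; have := eps_ker a; rewrite a0 scale0r subr0.
Qed.

(** M is the direct sum of A u, which is a copy of k because the maximal ideal kills u, and the
    kernel of T: T is linear through the augmentation, so its kernel is a submodule, and the
    projection to A u is v |-> T(v) u. *)
Lemma has_k_summand_functional M pr (j : nat) (u : M) (T : M -> k) :
  @graded_by M pr -> part M j%:Z u ->
  (forall a v w, T (a *: v + w) = eps a * T v + T w) ->
  (forall (i : int) v, part M i v -> i != j -> T v = 0) -> T u = 1 ->
  (forall a, eps a = 0 -> a *: u = 0) -> has_k_summand M.
Proof.
move=> h uj Tlin Tpart Tu u_ann.
have T0 : T 0 = 0.
  have := Tlin 1 0 0; rewrite scaler0 addr0 rmorph1 mul1r => /eqP.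
  by rewrite -[X in X == _]addr0 (inj_eq (addrI _)) eq_sym => /eqP.
pose N : set M := [set v | T v = 0].
have spanN : span N = N.
  by apply: span_submodule => // a v w; rewrite /N /= => Nv Nw; rewrite Tlin Nv Nw mulr0 addr0.
have epsE a : a *: u = (eps a)%:A *: u.
  apply/eqP; rewrite -subr_eq0 -scalerBl u_ann // rmorphB /= eps_alg subrr.
  by [].
(* T sees only degree j, so it vanishes on every component of v other than the j-th, and T(v) = 0
   settles that one. *)
have stab d v : span N v -> span N (pr d v).
  rewrite spanN /N /= => Tv; have [jd|jd] := eqVneq j d; last first.
    by apply: Tpart (gr_part h d v) _; rewrite eqz_nat eq_sym.
  have [N' [Nv vE]] := gr_sum h v; case: (ltnP j N') => jN; last by rewrite -jd Nv.
  have TD v' w : T (v' + w) = T v' + T w by have := Tlin 1 v' w; rewrite scale1r rmorph1 mul1r.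
  have Tsum (I : Type) (r : seq I) (F : I -> M) : T (\sum_(i <- r) F i) = \sum_(i <- r) T (F i).
    by apply: big_morph.
  move: Tv; rewrite {1}vE Tsum (bigD1 (Ordinal jN)) //= big1 ?addr0 -?jd // => i ij.
  by apply: Tpart (gr_part h i v) _; rewrite eqz_nat; apply: contra ij => /eqP ie; apply/eqP/val_inj.
pose f (x : gprod (shift (gresidue A) (- j%:Z)) (gsub N)) : M :=
  (eps (repr (x.1 : quotmod (@posdeg k A))))%:A *: u + val (x.2 : submod N).
pose E (q : gresidue A) := eps (repr (q : quotmod (@posdeg k A))).
have EE a : E (quotmod_pi (@posdeg k A) a) = eps a.
  apply/eqP; rewrite /E -subr_eq0 -rmorphB; apply/eqP/eps_span/quotmod_eq.
  by rewrite quotmod_reprK.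
have piP (q : gresidue A) : exists a, q = quotmod_pi (@posdeg k A) a.
  by exists (repr (q : quotmod (@posdeg k A))); rewrite quotmod_reprK.
have Elin a q q' : E (a *: q + q') = eps a * E q + E q'.
  have [[b ->] [b' ->]] := conj (piP q) (piP q').
  by rewrite -linearP !EE -[a *: b]/(a * b) rmorphD rmorphM.
have fl : linear f.
  move=> a [q v] [q' v'].
  rewrite -[LHS]/((E (a *: q + q'))%:A *: u + (a *: val v + val v')).
  rewrite -[f (q, v)]/((E q)%:A *: u + val v) -[f (q', v')]/((E q')%:A *: u + val v').
  rewrite Elin scalerDl scalerDl addrACA scalerDr; congr (_ + _ + _).
  by rewrite scalerA (epsE (a * _)) rmorphM /= eps_alg.
have [g gE] := linear_fun fl.
have Tval (v : submod N) : T (val v) = 0.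
  by have /asboolP := valP v; rewrite spanN.
have Tf x : T (f x) = E x.1 by rewrite /f Tlin eps_alg Tu mulr1 Tval addr0.
have TD v w : T (v - w) = T v - T w.
  by have := Tlin (-1) w v; rewrite scaleN1r rmorphN1 mulN1r addrC [- T w + _]addrC.
have in_N v : in_span N (v - (T v)%:A *: u).
  apply/asboolP/span_sub; rewrite /N /= TD; have := Tlin (T v)%:A u 0.
  by rewrite !addr0 T0 addr0 eps_alg Tu mulr1 => ->; rewrite subrr.
pose finv v : gprod (shift (gresidue A) (- j%:Z)) (gsub N) :=
  (quotmod_pi (@posdeg k A) (T v)%:A, Sub (v - (T v)%:A *: u) (in_N v) : submod N).
exists j%:Z, (gsub N); split; first exact: graded_by_graded (graded_gsub h stab).
exists g; split.
  exists finv => [x|v].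
    rewrite gE; case: x => q v; rewrite /finv; congr (_, _).
      have [a ->] := piP q; rewrite Tf EE; apply/quotmod_eq.
      by have := eps_ker a => /(spanP (-1))/(_ (span0 _)); rewrite addr0 scaleN1r opprB.
    by apply: val_inj; rewrite SubK Tf addrC addKr.
  by rewrite gE /f /= -[eps _]/(E _) EE eps_alg addrC subrK.
move=> i [q v]; rewrite gE; split.
  move=> [/= [a ai aq] vi]; rewrite /f /= -[eps _]/(E q).
  have iE : E q != 0 -> i = j.
    rewrite -aq EE; apply: contraNeq => ij; apply/eqP; apply: eps_part ai.
    by rewrite subr_eq0.
  have [E0|/iE ij] := eqVneq (E q) 0; first by rewrite E0 scale0r scale0r add0r.
  move: vi; rewrite ij => vi; rewrite -[val v]opprK; apply: (gr_sub h j).2.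
    by rewrite -[j%:Z]add0r; apply: gr_scale h _ _ _ _ (apart_alg _) uj.
  by rewrite -sub0r; apply: (gr_sub h j).2 (gr_sub h j).1 vi.
move=> fi; have [ij|ij] := eqVneq i j%:Z; last first.
  have := Tpart _ _ fi ij; rewrite Tf /= => Eq.
  have q0 : q = 0 by have [a aq] := piP q; rewrite aq in Eq *; apply/gresidue_eq0; rewrite -EE.
  split; last by move: fi; rewrite /f /= -[eps _]/(E q) Eq scale0r scale0r add0r.
  by exists 0; [exact: apart0|rewrite q0 raddf0].
split; last first.
  have -> : part (gsub N) i v = part M i (f (q, v) - (E q)%:A *: u).
    by rewrite /f /= addrC addKr.
  apply: (gr_sub h i).2 => //; rewrite ij -[j%:Z]add0r.
  exact: gr_scale h _ _ _ _ (apart_alg _) uj.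
rewrite /= ij subrr; exists (E q)%:A => //.
have [a ->] := piP q; rewrite EE; apply/quotmod_eq.
by have := eps_ker a => /(spanP (-1))/(_ (span0 _)); rewrite addr0 scaleN1r opprB.
Qed.

(** [u] is the generator of the summand and [T] the projection onto it. *)
Lemma k_summand_generator M : has_k_summand M -> exists j (u : M) (T : {linear M -> gresidue A}),
  [/\ part M j u, forall a, eps a = 0 -> a *: u = 0, u <> 0, T u <> 0
    & forall i v, part M i v -> i != j -> T v = 0].
Proof.
move=> [j [L [Lgr [f [fbij fpart]]]]].
have one0 : quotmod_pi (@posdeg k A) 1 <> 0.
  by rewrite gresidue_eq0 rmorph1; apply/eqP; exact: oner_neq0.
have L0 : part L j 0 by have [/(_ j)[]] := Lgr.
have [g fg gf] := fbij.
have gl : linear (fun v => (g v).1 : gresidue A).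
  by move=> a v w; rewrite -[v in LHS]gf -[w in LHS]gf -linearP fg.
have [T TE] := linear_fun gl.
exists j, (f (quotmod_pi (@posdeg k A) 1, 0)), T; split.
- apply/fpart; split=> //=; exists 1; rewrite ?subrr //.
  by have := apart_alg 1; rewrite scale1r.
- move=> a a0; rewrite -linearZ -(raddf0 f); congr (f _); congr (_, _); last exact: scaler0.
  rewrite -[LHS]/(a *: quotmod_pi (@posdeg k A) 1) -linearZ; apply/gresidue_eq0.
  by rewrite -[a *: _]/(a * 1) mulr1.
- by rewrite -(raddf0 f) => /(bij_inj fbij) [/one0].
- by rewrite TE fg.
move=> i v; rewrite -{1}[v]gf => /fpart[[a ai av] _] ij; rewrite TE -av.
by apply/gresidue_eq0; apply: eps_part ai; rewrite subr_eq0.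
Qed.

End KSummand.

Lemma max_chain_eq (T : Type) (P : set T -> Prop) l :
  chain P l -> ~ chain P l.+1 -> max_chain P = l.
Proof.
move=> Pl nPl; apply: xget_unique => // m [Pm nPm].
have down a b : (a <= b)%N -> chain P b -> chain P a.
  move=> ab [c [cP cc]]; exists c; split=> i ia; [apply: cP|apply: cc]; exact: leq_trans ia ab.
apply/eqP; rewrite eqn_leq; apply/andP; split; rewrite leqNgt; apply/negP.
  by move=> lm; apply: nPl; apply: down Pm.
by move=> ml; apply: nPm; apply: down Pl.
Qed.

Lemma krull_dim_trivial M : (forall m : M, m = 0) -> krull_dim M = 0%N.
Proof.
(* The annihilator is the whole ring, so there is no chain of primes at all and the value is the
   default 0. *)
move=> M0; apply: xgetPN => l [[c [cP _]] _]; have [[_ _ _ n1 _] annP] := cP 0%N (leq0n l).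
by apply: n1; apply: annP => m; rewrite (M0 (1 *: m)).
Qed.

Lemma length_trivial M : (forall m : M, m = 0) -> length M = 0%N.
Proof.
move=> M0; apply: max_chain_eq; first by exists (fun _ => setT); split.
move=> [c [cP /(_ 0%N isT)[_ nc]]]; apply: nc => m _; rewrite (M0 m).
by have [] := cP 0%N isT.
Qed.

Lemma multiplicity_trivial M : (forall m : M, m = 0) -> multiplicity M = 0.
Proof. by move=> M0; rewrite /multiplicity krull_dim_trivial // eqxx length_trivial. Qed.

(* Primes over ann M pull back to primes of the principal ideal domain k[t]. *)
Lemma krull_dim1 M :
  (forall P, prime_ideal P -> ann M `<=` P ->
     exists ev : {rmorphism A -> {poly k}},
       (forall q, exists a, ev a = q) /\ forall a, ev a = 0 -> P a) ->
  (exists ev : {rmorphism A -> {poly k}},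
     (forall q, exists a, ev a = q) /\ forall a, ann M a -> ev a = 0) ->
  krull_dim M = 1%N.
Proof.
move=> up [ev [ev_surj ev_ann]]; apply: max_chain_eq.
  (* A chain of length 1: the kernel of [ev], and the preimage of the ideal (t). *)
  pose c i := if i == 0%N then [set a | ev a = 0] else [set a | (ev a).[0] = 0].
  exists c; split=> [[|i] _|i].
  - split=> [|a /ev_ann//]; rewrite /c /=; split=> /=; rewrite ?rmorph0 //.
    + by move=> a b a0 b0; rewrite rmorphD /= a0 b0 addr0.
    + by move=> a b b0; rewrite rmorphM /= b0 mulr0.
    + by rewrite rmorph1; apply/eqP; rewrite oner_eq0.
    + by move=> a b; rewrite rmorphM /= => /eqP; rewrite mulf_eq0 => /orP[]/eqP; [left|right].
  - split=> [|a /ev_ann a0]; last by rewrite /c /= a0 horner0.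
    split; rewrite /c /=; rewrite ?rmorph0 ?horner0 //.
    + by move=> a b a0 b0; rewrite rmorphD /= hornerD a0 b0 addr0.
    + by move=> a b b0; rewrite rmorphM /= hornerM b0 mulr0.
    + by rewrite rmorph1 hornerC; apply/eqP; rewrite oner_eq0.
    + by move=> a b; rewrite rmorphM /= hornerM => /eqP; rewrite mulf_eq0 => /orP[]/eqP; [left|right].
  rewrite ltnS leqn0 => /eqP->; rewrite /c /=; split=> [a /= ->|]; first by rewrite horner0.
  have [a aX] := ev_surj 'X => /(_ a) /=; rewrite aX hornerX => /(_ erefl)/eqP.
  by rewrite polyX_eq0.
move=> [c [cP cc]].
have [[P00 P0D P0M P01 P0p] annP0] := cP 0%N isT.
have [[P10 P1D P1M P11 P1p] _] := cP 1%N isT.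
have [[P20 P2D P2M P21 P2p] _] := cP 2%N isT.
have [f [f_surj f_ker]] := up _ (cP 0%N isT).1 annP0.
have [s01 /nonsubset[r1 [r1P nr1]]] := cc 0%N isT.
have [s12 /nonsubset[r2 [r2P nr2]]] := cc 1%N isT.
have fP i a b : (i <= 2)%N -> c i a -> f a = f b -> c i b.
  move=> i2 ca fab; have c0 : c 0%N (b - a) by apply: f_ker; rewrite rmorphB /= fab subrr.
  have ci : c i (b - a) by case: i i2 {ca} => [|[|[|//]]] _ //; [exact: s01|exact/s12/s01].
  by rewrite -(subrK a b); have [[_ PD _ _ _] _] := cP i i2; exact: PD.
have f1 : f r1 != 0 by apply/eqP => /f_ker.
(* Three primes in a chain are refuted as in a principal ideal domain: [f p] has least size among
   the nonzero images of elements of the middle prime. *)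
have [m [[p pP [p0 pm]] m_min]] : exists m, (exists2 p, c 1%N p & f p != 0 /\ size (f p) = m) /\
    forall p, c 1%N p -> f p != 0 -> (m <= size (f p))%N.
  pose Q m := `[< exists2 p, c 1%N p & f p != 0 /\ size (f p) = m >].
  have exQ : exists m, Q m by exists (size (f r1)); apply/asboolP; exists r1.
  case: (ex_minnP exQ) => m /asboolP mQ m_min; exists m; split=> // q q1 q0.
  by apply: m_min; apply/asboolP; exists q.
(* The gcd g of [f p] and [f r2] has no lift in the middle prime, else r2 would lie there; so the
   cofactor h does, and minimality makes g constant. The Bezout relation then puts 1 into the
   largest prime. *)
have [[u v] /= guv] := Bezoutp (f p) (f r2).
move: guv; set g := gcdp _ _ => guv.
have [h fh] : exists h, f p = h * g by have /dvdpP := dvdp_gcdl (f p) (f r2).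
have [h' fh'] : exists h, f r2 = h * g by have /dvdpP := dvdp_gcdr (f p) (f r2).
have [[G fG] [H fH]] := conj (f_surj g) (f_surj h).
have [H' fH'] := f_surj h'.
have hg : c 1%N (H * G) by apply: fP (pP) _; rewrite ?rmorphM //= fH fG.
have [cH|cG] := P1p _ _ hg; last first.
  by apply: nr2; apply: (fP _ (H' * G)) => //; [exact: P1M|rewrite rmorphM /= fH' fG].
have h0 : h != 0 by apply: contraNneq p0 => h0; rewrite fh h0 mul0r.
have g0 : g != 0 by apply: contraNneq p0 => g0; rewrite fh g0 mulr0.
have := m_min _ cH; rewrite fH => /(_ h0); rewrite -pm fh size_mul // => hs.
have /size_poly1P[x x0 gx] : size g == 1%N.
  have gp : (0 < size g)%N by rewrite size_poly_gt0.
  have hp : (0 < size h)%N by rewrite size_poly_gt0.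
  move: hs gp hp; case: (size g) => [//|[//|a]]; case: (size h) => [//|b].
  by rewrite addnS /= -[X in (_ <= X)%N -> _]addn0 leq_add2l.
have [[U fU] [V fV]] := conj (f_surj u) (f_surj v).
have c2 : c 2%N (U * p + V * r2) by apply: P2D; apply: P2M => //; exact: s12.
move: guv => /eqpP[[y z] /= /andP[y0 z0] yz].
have [W fW] := f_surj (z^-1 * x^-1 * y)%:P.
apply: P21; apply: (fP _ (W * (U * p + V * r2))) => //; first exact: P2M.
rewrite !(rmorphM, rmorphD) /= fW fU fV rmorph1 polyCM -mulrA.
rewrite (mul_polyC y) yz gx -mul_polyC -!polyCM mulrACA !mulVf // mulr1 polyC1 //.
Qed.

(** The difference from the constant would have more roots among the integers from [i0] on than its
    degree allows. *)
Lemma lead_coef_const_nat (p : {poly rat}) (d : nat) (i0 : nat) :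
  (forall i : nat, (i0 <= i)%N -> p.[i%:R] = d%:R) -> p = d%:R%:P.
Proof.
move=> h; apply/eqP; rewrite -subr_eq0; apply: contraT => p0.
have := max_poly_roots p0 (rs := [seq i%:R | i <- iota i0 (size (p - d%:R%:P))]).
rewrite size_map size_iota ltnn => -> //; first last.
  rewrite map_inj_in_uniq ?iota_uniq // => i j _ _ /eqP.
  by rewrite eqr_nat => /eqP.
apply/allP => x /mapP[i]; rewrite mem_iota => /andP[ii0 _] ->.
by rewrite rootE !hornerE h // subrr.
Qed.

Lemma multiplicity_dim1 M (d i0 : nat) : krull_dim M = 1%N ->
  (forall i : nat, (i0 <= i)%N -> dimk (part M i%:Z) = d) -> multiplicity M = d%:R.
Proof.
move=> kd dimE; rewrite /multiplicity kd /=; apply: xget_unique.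
  exists d%:R%:P; rewrite lead_coefC; split=> //; exists i0 => i /dimE ->.
  by rewrite hornerC mul1n.
move=> _ [p [-> [i1 pP]]]; rewrite (@lead_coef_const_nat p d (maxn i0 i1)) ?lead_coefC // => i.
by rewrite geq_max => /andP[/dimE iE /pP ->]; rewrite iE mul1n.
Qed.

(** The matrices expressing each family in terms of the other multiply to the identity of size d,
    whence the inequality of sizes. *)
Lemma dimk_unique M (V : set M) d d' (b : 'I_d -> M) (b' : 'I_d' -> M) :
  (forall t, V (b t)) -> (forall t, V (b' t)) ->
  (forall m, V m -> exists! c : 'rV[k]_d, m = \sum_t (c 0 t)%:A *: b t) ->
  (forall m, V m -> exists! c : 'rV[k]_d', m = \sum_t (c 0 t)%:A *: b' t) -> (d <= d')%N.
Proof.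
move=> Vb Vb' bP bP'.
have [P PE] := choice (fun t => bP' _ (Vb t)).
have [Q QE] := choice (fun t => bP _ (Vb' t)).
pose Pm := \matrix_(i, j) P i 0 j; pose Qm := \matrix_(i, j) Q i 0 j.
suff PQ : Pm *m Qm = 1%:M.
  by have := mulmx1_min PQ.
apply/row_matrixP => i; have [c [_ c_uniq]] := bP _ (Vb i).
have c1 : c = row i 1%:M.
  apply: c_uniq; rewrite (bigD1 i) //= big1 => [|t ti].
    by rewrite !mxE eqxx scale1r scale1r addr0.
  by rewrite !mxE eq_sym (negPf ti) scale0r scale0r.
rewrite -c1; apply/esym/c_uniq; rewrite {1}(PE i).1.
under eq_bigr => t _ do rewrite {1}(QE t).1 scaler_sumr.
rewrite exchange_big /=; apply: eq_bigr => t _.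
rewrite !mxE scaler_suml scaler_suml; apply: eq_bigr => l _.
by rewrite !mxE scalerA -scalerAl mul1r scalerA.
Qed.

Lemma dimk_eq M (V : set M) d (b : 'I_d -> M) : (forall t, V (b t)) ->
  (forall m, V m -> exists! c : 'rV[k]_d, m = \sum_t (c 0 t)%:A *: b t) -> dimk V = d.
Proof.
move=> Vb bP; apply: xget_unique; first by exists b.
move=> d' [b' [Vb' bP']]; apply/eqP; rewrite eqn_leq.
by rewrite (dimk_unique Vb' Vb bP' bP) (dimk_unique Vb Vb' bP bP').
Qed.

(** The field acts on M only through [c%:A], so graded parts of M are measured by maps h from
    genuine vector spaces. The basis is the image of a basis of a complement of K in U. *)
Lemma quotient_basis M (V : vectType k) (U K : {vspace V}) (h : V -> M) :
  (forall c u v, h (c *: u + v) = c%:A *: h u + h v) -> (K <= U)%VS ->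
  (forall u, u \in U -> h u = 0 <-> u \in K) ->
  exists b : 'I_(\dim U - \dim K) -> V, (forall t, b t \in U) /\
    forall u, u \in U -> exists! c : 'rV[k]_(\dim U - \dim K), h u = \sum_t (c 0 t)%:A *: h (b t).
Proof.
move=> hl KU hK; pose D := (U :\: K)%VS.
have h0 : h 0 = 0 by have := hl (-1) 0 0; rewrite scaler0 addr0 scaleN1r scaleN1r addNr.
have hD u v : h (u + v) = h u + h v by have := hl 1 u v; rewrite !scale1r.
have hZ c u : h (c *: u) = c%:A *: h u by have := hl c u 0; rewrite !addr0 h0 addr0.
have hsum (I : Type) (r : seq I) (F : I -> V) : h (\sum_(i <- r) F i) = \sum_(i <- r) h (F i).
  exact: big_morph.
have dimD : (\dim U - \dim K = \dim D)%N.
  by rewrite -(dimv_cap_compl U K) (capv_idPr KU) addKn.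
rewrite dimD; exists (tnth (vbasis D)); split=> [t|u uU].
  by apply: (subvP (diffvSl U K)); rewrite vbasis_mem // mem_tnth.
have UE : (K + D = U)%VS.
  by rewrite addvC -{1}(capv_idPr KU) addv_diff_cap.
have /memv_addP[a aK [b bD ub]] : u \in (K + D)%VS by rewrite UE.
have hb : h u = h b by rewrite ub hD (hK a _).2 ?add0r // (subvP KU).
pose c := \row_t coord (vbasis D) t b.
exists c; split.
  rewrite hb {1}(coord_vbasis bD) hsum; apply: eq_bigr => t _.
  by rewrite hZ mxE -tnth_nth.
move=> c'; rewrite hb => hE; apply/rowP => t; rewrite mxE.
pose b' := \sum_t c' 0 t *: tnth (vbasis D) t.
have b'D : b' \in D by apply: memv_suml => i _; rewrite memvZ // vbasis_mem // mem_tnth.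
have DU : (D <= U)%VS by exact: diffvSl.
have : b - b' \in (D :&: K)%VS.
  rewrite memv_cap memvB //= -hK; last by rewrite (subvP DU) // memvB.
  rewrite -scaleN1r addrC hl hE hsum scaleN1r.
  by rewrite (eq_bigr (fun t => (c' 0 t)%:A *: h (tnth (vbasis D) t))) ?scaleN1r ?addNr.
rewrite (_ : (D :&: K)%VS = 0%VS) ?memv0; last first.
  by apply/eqP; rewrite -subv0 -(capv_diff U K).
rewrite subr_eq0 => /eqP ->; rewrite /b'.
under eq_bigr do rewrite (tnth_nth 0).
by rewrite coord_sum_free // (basis_free (vbasisP D)).
Qed.

Lemma dimk_quotient M (V : vectType k) (U K : {vspace V}) (h : V -> M) (S : set M) :
  (forall c u v, h (c *: u + v) = c%:A *: h u + h v) -> (K <= U)%VS ->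
  (forall u, u \in U -> h u = 0 <-> u \in K) ->
  (forall u, u \in U -> S (h u)) -> (forall m, S m -> exists2 u, u \in U & h u = m) ->
  dimk S = (\dim U - \dim K)%N.
Proof.
move=> hl KU hK US SU; have [b [bU bP]] := quotient_basis hl KU hK.
apply: (@dimk_eq _ _ _ (h \o b)) => [t|m /SU[u uU <-]]; first exact: US.
exact: bP.
Qed.

Lemma min_gens_le M m : generated_by M m -> (min_gens M <= m)%N.
Proof.
move=> gm; rewrite /min_gens; case: xgetP => [_ _ [_ /(_ _ gm)]|] //.
Qed.

(** Finite generation makes [min_gens] an attained minimum instead of a default value. *)
Lemma generated_min_gens M m : generated_by M m -> generated_by M (min_gens M).
Proof.
move=> gm; have exm : exists m, `[< generated_by M m >] by exists m; apply/asboolP.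
case: (ex_minnP exm) => m' /asboolP gm' m'_min.
suff -> : min_gens M = m' by [].
apply: xget_unique; first by split=> // l gl; apply: m'_min; apply/asboolP.
move=> l [gl l_min]; apply/eqP; rewrite eqn_leq l_min //=.
by apply: m'_min; apply/asboolP.
Qed.

End Graded.

(** * The graded dual of a subquotient *)

Section DualFunctional.
Variables (k : fieldType) (A : gralg k) (M : gmod A).

Definition dual_fun (w : gdual M) : M -> k := val (val w : homk M).

End DualFunctional.

(* Graded functionals on a subquotient Z / B of a graded module, seen as
   functionals on Z which vanish on B. *)
Section SubquotientDual.
Variables (k : fieldType) (A : gralg k) (Ch : gmod A) (Z B : set Ch).
Hypothesis spanZ : span Z = Z.
Let BZ : set (gsub Z) := [set z | B (val z)].
Local Notation H := (gquot BZ).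
Local Notation O := (gdual H).

Definition cls (c : Ch) : H := quotmod_pi BZ (insubd (0 : submod Z) c).

Let Z_insub c : Z c -> in_span Z c. Proof. by move=> Zc; apply/asboolP; rewrite spanZ. Qed.

Let val_insub c : Z c -> val (insubd (0 : submod Z) c) = c.
Proof. by move=> /Z_insub Zc; rewrite val_insubd Zc. Qed.

Lemma subquot_lin a u v : Z u -> Z v -> Z (a *: u + v).
Proof. by move=> Zu Zv; rewrite -spanZ; apply: spanP; rewrite spanZ. Qed.

Lemma cls_lin a u v : Z u -> Z v -> cls (a *: u + v) = a *: cls u + cls v.
Proof.
move=> Zu Zv; rewrite /cls -linearP; congr quotmod_pi; apply: val_inj.
by rewrite submod_valP !val_insub //; exact: subquot_lin.
Qed.

Lemma clsZ a u : Z u -> cls (a *: u) = a *: cls u.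
Proof.
move=> Zu; have Z0 : Z 0 by rewrite -spanZ; exact: span0.
have cls0 : cls 0 = 0 by have := cls_lin (-1) Z0 Z0; rewrite scaler0 addr0 scaleN1r addNr.
by have := cls_lin a Zu Z0; rewrite cls0 !addr0.
Qed.

Lemma cls_boundary b : Z b -> B b -> cls b = 0.
Proof. by move=> Zb Bb; apply/quotmod_eq0/span_sub; rewrite /BZ /= val_insub. Qed.

Lemma clsP (q : H) : exists2 c, Z c & q = cls c.
Proof.
exists (val (repr (q : quotmod BZ))).
  by rewrite -{1}spanZ; apply/asboolP; exact: (valP (repr (q : quotmod BZ))).
by rewrite /cls valKd quotmod_reprK.
Qed.

Lemma part_clsP i (q : H) : part H i q -> exists c, [/\ Z c, part Ch i c & q = cls c].
Proof.
move=> [z zi <-]; exists (val z); split=> //; last by rewrite /cls valKd.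
by rewrite -{1}spanZ; apply/asboolP; exact: (valP z).
Qed.

Lemma part_cls i c : Z c -> part Ch i c -> part H i (cls c).
Proof. by move=> Zc ci; exists (insubd (0 : submod Z) c) => //=; rewrite val_insub. Qed.

(** F is defined on the ambient module but constrained only on Z. The second clause involves all
    scalars a because B is just a set and the quotient is by its span. *)
Definition admissible (F : Ch -> k) :=
  (forall c u v, Z u -> Z v -> F (c%:A *: u + v) = c * F u + F v) /\
  (forall a u, Z u -> B u -> F (a *: u) = 0).

Definition functional_degree (j : int) (F : Ch -> k) :=
  forall i c, i != - j -> Z c -> part Ch i c -> F c = 0.

Definition homk_res (phi : homk H) (c : Ch) : k := val phi (cls c).
Definition dual_res (w : O) (c : Ch) : k := dual_fun w (cls c).

Lemma homk_linE (phi : homk H) (c : k) u v : val phi (c%:A *: u + v) = c * val phi u + val phi v.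
Proof. by have /asboolP := valP phi; exact. Qed.

Lemma homk_valZ (phi : homk H) a q : val (a *: phi) q = val phi (a *: q).
Proof. by []. Qed.

Lemma homk_res_lin phi (c : k) u v : Z u -> Z v ->
  homk_res phi (c%:A *: u + v) = c * homk_res phi u + homk_res phi v.
Proof. by move=> Zu Zv; rewrite /homk_res cls_lin // homk_linE. Qed.

Lemma homk_res_admissible phi : admissible (homk_res phi).
Proof.
split=> [c u v|a u Zu Bu]; first exact: homk_res_lin.
rewrite /homk_res clsZ // cls_boundary // scaler0.
by have := homk_linE phi (-1) 0 0; rewrite scaler0 addr0 mulN1r addNr.
Qed.

Lemma admissible_homk F : admissible F -> exists phi : homk H, forall c, Z c -> homk_res phi c = F c.
Proof.
move=> [Flin FB].
have Z0 : Z 0 by rewrite -spanZ; exact: span0.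
have F0 : F 0 = 0 by have := Flin (-1) 0 0 Z0 Z0; rewrite scaler0 addr0 mulN1r addNr.
have ZZ (z : gsub Z) : Z (val z) by rewrite -{1}spanZ; apply/asboolP; exact: (valP z).
have FBZ (z : gsub Z) : span BZ z -> F (val z) = 0.
  have := @span_min _ _ BZ [set z : gsub Z | forall a, F (a *: val z) = 0].
  move=> h /h; rewrite -[in F (val z)](scale1r (val z)); apply.
  - by move=> a; rewrite scaler0.
  - move=> a u v /= Fu Fv b; rewrite scalerDr scalerA.
    have Zs c (w : gsub Z) : Z (c *: val w) by have := subquot_lin c (ZZ w) Z0; rewrite addr0.
    have := Flin 1 (b * a *: val u) (b *: val v) (Zs _ _) (Zs _ _).
    by rewrite scale1r scale1r mul1r Fu Fv addr0.
  - by move=> u Bu a; exact: FB.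
pose f (q : H) := F (val (repr (q : quotmod BZ))).
have fE z : f (quotmod_pi BZ z) = F (val z).
  apply/eqP; rewrite -subr_eq0; apply/eqP.
  have : span BZ (repr (quotmod_pi BZ z : quotmod BZ) - z).
    by apply/quotmod_eq; rewrite quotmod_reprK.
  move=> /FBZ; rewrite submod_valB -scaleN1r addrC.
  have := Flin (-1) (val z) (val (repr (quotmod_pi BZ z : quotmod BZ))) (ZZ _) (ZZ _).
  have -> : (-1)%:A = -1 :> A by rewrite scaleN1r.
  by move=> ->; rewrite mulN1r /f addrC.
have fl : f \in @klinear k A H.
  apply/asboolP => c u v; have [[z ->] [z' ->]] : (exists z, u = quotmod_pi BZ z) /\ (exists z, v = quotmod_pi BZ z).
    by split; [exists (repr (u : quotmod BZ))|exists (repr (v : quotmod BZ))]; rewrite quotmod_reprK.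
  by rewrite -linearP !fE submod_valP Flin.
exists (Sub f fl) => c Zc; rewrite /homk_res SubK /cls fE val_insub //.
Qed.

Lemma homk_res_inj phi phi' : (forall c, Z c -> homk_res phi c = homk_res phi' c) -> phi = phi'.
Proof.
by move=> h; apply/val_inj/funext => q; have [c Zc ->] := clsP q; exact: h.
Qed.

Lemma homk_part_res j phi : homk_part j phi <-> functional_degree j (homk_res phi).
Proof.
split=> [h i c ij Zc ci|h i q ij /part_clsP[c [Zc ci ->]]]; last exact: h ij Zc ci.
exact: h ij (part_cls Zc ci).
Qed.

Lemma dual_res_inj w w' : (forall c, Z c -> dual_res w c = dual_res w' c) -> w = w'.
Proof. by move=> h; apply/val_inj/homk_res_inj. Qed.

Lemma dual_resP a w w' c : Z c -> dual_res (a *: w + w') c = dual_res w (a *: c) + dual_res w' c.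
Proof. by move=> Zc; rewrite /dual_res (clsZ a Zc). Qed.

Lemma dual_res_admissible w : admissible (dual_res w).
Proof. exact: homk_res_admissible. Qed.

Lemma dual_part_res j w : part O j w <-> functional_degree j (dual_res w).
Proof. exact: homk_part_res. Qed.

(** The graded dual is spanned by homogeneous functionals, so an element is prescribed as a finite
    sum of such. *)
Lemma dual_of_functionals (N : nat) (j : 'I_N -> int) (F : 'I_N -> Ch -> k) :
  (forall t, admissible (F t)) -> (forall t, functional_degree (j t) (F t)) ->
  exists w : O, forall c, Z c -> dual_res w c = \sum_t F t c.
Proof.
move=> Fadm Fdeg; have [phi phiE] := choice (fun t => admissible_homk (Fadm t)).
have hphi : in_span (\bigcup_j homk_part j : set (homk H)) (\sum_t phi t).
  apply: rpred_sum => t _; apply/asboolP/span_sub; exists (j t) => //.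
  by apply/homk_part_res => i c ij Zc ci; rewrite phiE //; exact: Fdeg ij Zc ci.
exists (Sub (\sum_t phi t) hphi) => c Zc.
rewrite /dual_res /dual_fun SubK; under [RHS]eq_bigr => t _ do rewrite -(phiE t c Zc).
have vs (I : Type) (r : seq I) (G : I -> homk H) q : val (\sum_(i <- r) G i) q = \sum_(i <- r) val (G i) q.
  by elim: r => [|i r IH]; rewrite ?big_nil // !big_cons -IH.
exact: vs.
Qed.

Lemma dual_ind (Q : (Ch -> k) -> Prop) (w : O) :
  (forall F F', (forall c, Z c -> F c = F' c) -> Q F -> Q F') -> Q (fun=> 0) ->
  (forall a F F', Q F -> Q F' -> Q (fun c => F (a *: c) + F' c)) ->
  (forall j F, admissible F -> functional_degree j F -> Q F) -> Q (dual_res w).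
Proof.
move=> Qext Q0 QD Qh; have /asboolP := valP w.
have := @span_min _ _ (\bigcup_j homk_part j) [set phi : homk H | Q (homk_res phi)].
move=> h /h; apply.
- by apply: Qext Q0.
- move=> a phi psi /= Qphi Qpsi; apply: Qext (QD a _ _ Qphi Qpsi) => c Zc.
  rewrite /homk_res (clsZ a Zc); exact: (congr1 (fun t => t + _) (esym (homk_valZ phi a (cls c)))).
- move=> phi [j _ /homk_part_res phij]; apply: (Qh j) => //; exact: homk_res_admissible.
Qed.

End SubquotientDual.

Section Localization.
Variables (A : comNzRingType) (f : A).

Lemma frac_eq0 r s t : f ^+ t * r = 0 -> frac f r s = 0.
Proof. by move=> h; apply/frac_eq; exists t; rewrite addn0 h mulr0. Qed.

Lemma fracD r r' s : frac f r s + frac f r' s = frac f (r + r') s.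
Proof.
rewrite [LHS]loc_addE; apply/frac_eq; exists 0%N.
by rewrite !add0n -mulrDr mulrA -exprD.
Qed.

Lemma fracZ a r s : a *: frac f r s = frac f (a * r) s.
Proof. exact: loc_scaleE. Qed.

Lemma locmap_frac (g h : A) r s : h = f * g -> locmap g h (frac f r s) = frac h (r * g ^+ s) s.
Proof. by move=> ->; exact: locmapE. Qed.

Lemma locmap0 (g h : A) : h = f * g -> locmap g h (0 : loc f) = 0.
Proof. by move=> ->; have := locmapE f g 0 0; rewrite mul0r. Qed.

End Localization.

(** * The residue pairing between the model and second local cohomology *)

Section Omega.
Variables (k : fieldType) (n : nat) (e : rel 'I_n).
Hypotheses (e_sym : symmetric e) (e_irr : irreflexive e) (e_conn : connected e).
Hypothesis n_ge3 : (3 <= n)%N.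
Local Notation R := (SRring k e).
Local Notation S := {poly {poly k}}.
Local Notation X := ('X%:P : S).
Local Notation Y := ('X : S).
Local Notation x := (SRvar k e).
Local Notation xF := (@xprod k R n x).
Local Notation cochain := (@cochain k R n x).

(* The concrete model of the canonical module: families of polynomials
   g_ij in k[x_i, x_j], alternating in the edge ij, whose restrictions to each
   axis add up to zero. *)
Definition omega_model (g : 'I_n -> 'I_n -> S) := [/\ forall i j, ~~ e i j -> g i j = 0,
  forall i j, swapXY (g i j) = - g j i & forall i, \sum_j (g i j)`_0 = 0].

Lemma omega_modelD g h : omega_model g -> omega_model h ->
  omega_model (fun i j => g i j + h i j).
Proof.
move=> [g1 g2 g3] [h1 h2 h3]; split=> [i j ij|i j|i].
- by rewrite g1 // h1 // addr0.
- by rewrite rmorphD /= g2 h2 opprD.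
- by under eq_bigr do rewrite coefD; rewrite big_split /= g3 h3 addr0.
Qed.

(** The condition at a vertex survives because the restriction of r to the axis does not depend on
    the edge and factors out of the sum. *)
Lemma omega_modelM (r : R) g : omega_model g -> omega_model (fun i j => rho i j r * g i j).
Proof.
move=> [g1 g2 g3]; split=> [i j ij|i j|i].
- by rewrite g1 // mulr0.
- by rewrite rmorphM /= rho_swap // g2 mulrN.
have [l il] := exists_neighbour e_conn n_ge3 i.
rewrite (eq_bigr (fun j => (rho i l r)`_0 * (g i j)`_0)) => [|j _].
  by rewrite -mulr_sumr g3 mulr0.
rewrite coef0M; have [ij|nij] := boolP (e i j); last by rewrite g1 // coef0 !mulr0.
by rewrite (rho_axis r ij il).
Qed.

Lemma omega_model_hpart d g : omega_model g -> omega_model (fun i j => hpart d (g i j)).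
Proof.
move=> [g1 g2 g3]; split=> [i j ij|i j|i].
- by rewrite g1 //; apply/polyP => b; apply/polyP => a; rewrite coef_hpart !coef0 if_same.
- by rewrite -hpart_swap g2 hpartN.
- apply/polyP => a; rewrite coef_sum; have [<-|ad] := eqVneq a d.
    have := congr1 (fun q : {poly k} => q`_a) (g3 i); rewrite coef_sum => <-.
    by apply: eq_bigr => j _; rewrite coef_hpart addn0 eqxx.
  by rewrite coef0 big1 // => j _; rewrite coef_hpart addn0 (negPf ad).
Qed.

Lemma xprod_nonface F : ~~ face e F -> xF F = 0.
Proof.
move=> nF; rewrite /xprod.
transitivity (SRpi e (\prod_(i in F) 'X_i : {mpoly k[n]})); first by rewrite rmorph_prod.
apply/eqP; rewrite -(SRpi0 k e) SRpi_eq subr0; apply/asboolP/span_sub; by exists F.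
Qed.

Lemma loc_nonface F (u : loc (xF F)) : ~~ face e F -> u = 0.
Proof.
by move=> nF; have [r [s ->]] := fracP u; apply: (@frac_eq0 _ _ _ _ 1%N); rewrite xprod_nonface // expr1 mul0r.
Qed.

Lemma card_face F : face e F -> (#|F| <= 2)%N.
Proof.
case/or3P=> [/eqP->|/existsP[i /eqP->]|/existsP[i /existsP[j /andP[_ /eqP->]]]].
- by rewrite cards0.
- by rewrite cards1.
- by rewrite cards2; case: (_ != _).
Qed.

Lemma xprod1 i : xF [set i]%SET = x i.
Proof. by rewrite /xprod big_set1. Qed.

Lemma xprod2 i j : i != j -> xF [set i; j]%SET = x i * x j.
Proof. by move=> ij; rewrite /xprod big_setU1 ?inE //= big_set1. Qed.

Lemma rho_xprod2 i j : e i j -> rho i j (xF [set i; j]%SET) = X * Y.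
Proof.
move=> ij; have inj := edge_neq e_irr ij.
by rewrite xprod2 // rmorphM /= !rho_var /edge_var ij eqxx eq_sym (negPf inj) eqxx.
Qed.

Lemma rhoN1 i j : rho i j (-1 : R) = -1.
Proof. exact: rmorphN1. Qed.

Lemma coef_mulXY (q : S) m a b : ((X * Y) ^+ m * q)`_(m + b)`_(m + a) = q`_b`_a.
Proof.
elim: m => [|m IH]; first by rewrite expr0 mul1r.
by rewrite exprS !addSn -mulrA -mulrA coef_mulX coef_mulY IH.
Qed.

Lemma coef_mulXn (q : S) m a b : (X ^+ m * q)`_b`_a = if (m <= a)%N then q`_b`_(a - m) else 0.
Proof.
elim: m a => [|m IH] a; first by rewrite expr0 mul1r subn0.
by rewrite exprS -mulrA coef_mulX; case: a => // a; rewrite IH.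
Qed.

Lemma coef_mulYn (q : S) m a b : (Y ^+ m * q)`_b`_a = if (m <= b)%N then q`_(b - m)`_a else 0.
Proof.
elim: m b => [|m IH] b; first by rewrite expr0 mul1r subn0.
by rewrite exprS -mulrA coef_mulY; case: b => // b; rewrite IH.
Qed.

(* The residue pairing: r / (x_i x_j)^s is paired with g_ij by the coefficient
   of x_i^s x_j^s in r g_ij. *)
Definition edge_pairing i j (p : S) F (u : loc (xF F)) : k :=
  (rho i j (repr u).1 * p)`_(repr u).2`_(repr u).2.

(** Independence of the representative: multiplication by (x_i x_j)^m shifts both coefficient
    indices by m. *)
Lemma edge_pairing_frac i j p r s : e i j ->
  edge_pairing i j p (frac (xF [set i; j]%SET) r s) = (rho i j r * p)`_s`_s.
Proof.
move=> ij; rewrite /edge_pairing; set u := frac _ r s.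
case: (repr u) (fracK u) => r' s' /= /frac_eq[t /(congr1 (rho i j))].
rewrite !rmorphM !rmorphXn /= rho_xprod2 // => /(congr1 (fun q => q * p)).
rewrite -!mulrA => /(congr1 (fun q : S => q`_(t + s + s')`_(t + s + s'))).
by rewrite coef_mulXY (addnAC t s s') coef_mulXY.
Qed.

Definition pairing (g : 'I_n -> 'I_n -> S) (c : cochain) : k :=
  \sum_i \sum_(j | e i j && (i < j)%N) edge_pairing i j (g i j) (c [set i; j]%SET).

Lemma edge_pairingP i j p (a : R) (u v : loc (xF [set i; j]%SET)) : e i j ->
  edge_pairing i j p (a *: u + v) = edge_pairing i j (rho i j a * p) u + edge_pairing i j p v.
Proof.
move=> ij; have [[r [s ->]] [r' [s' ->]]] := conj (fracP u) (fracP v).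
rewrite fracZ [frac _ _ _ + _]loc_addE !edge_pairing_frac // !(rmorphD, rmorphM) /= !rmorphXn /= rho_xprod2 //.
rewrite mulrDl !coefD -!mulrA; congr (_ + _); last by rewrite coef_mulXY.
by rewrite (addnC s s') coef_mulXY mulrCA.
Qed.

Lemma pairingP g (a : R) (c c' : cochain) :
  pairing g (a *: c + c') = pairing (fun i j => rho i j a * g i j) c + pairing g c'.
Proof.
rewrite /pairing -big_split; apply: eq_bigr => i _; rewrite -big_split.
by apply: eq_bigr => j /andP[ij _] /=; rewrite -edge_pairingP.
Qed.

Lemma pairingD g h c : pairing (fun i j => g i j + h i j) c = pairing g c + pairing h c.
Proof.
rewrite /pairing -big_split; apply: eq_bigr => i _; rewrite -big_split.
by apply: eq_bigr => j _; rewrite /edge_pairing mulrDr !coefD.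
Qed.

Lemma pairing_scalar g (c : k) z : pairing (fun i j => c%:P%:P * g i j) z = c * pairing g z.
Proof.
rewrite /pairing mulr_sumr; apply: eq_bigr => i _; rewrite mulr_sumr.
by apply: eq_bigr => j _; rewrite /edge_pairing mulrCA !coefCM.
Qed.

Lemma sum_edges (t : 'I_n -> 'I_n -> k) : (forall i j, ~~ e i j -> t i j = 0) ->
  \sum_i \sum_(j < n | e i j && (i < j)%N) (t i j + t j i) = \sum_i \sum_j t i j.
Proof.
move=> t0; under eq_bigr do rewrite big_split; rewrite big_split /=.
rewrite [X in _ + X](exchange_big_dep xpredT) //= -big_split; apply: eq_bigr => i _ /=.
rewrite [RHS](bigID (fun j : 'I_n => (i < j)%N)) /=; congr (_ + _).
  rewrite [RHS](bigID (e i)) /= [X in _ = _ + X]big1 ?addr0 => [|j /andP[_ /t0]//].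
  by apply: eq_bigl => j; rewrite andbC.
rewrite [RHS](bigID (e i)) /= [X in _ = _ + X]big1 ?addr0 => [|j /andP[_ /t0]//].
apply: eq_bigl => j; rewrite e_sym andbC -leqNgt ltn_neqAle.
have [->|ij] := eqVneq j i; first by rewrite e_irr !andbF.
by rewrite -val_eqE /= in ij; rewrite ij.
Qed.

Lemma setU1K2 (i j : 'I_n) : i != j -> ([set i; j] :\ i = [set j])%SET.
Proof.
move=> ij; apply/setP => l; rewrite !inE; have [->|//] := eqVneq l i.
by rewrite (negPf ij).
Qed.

Lemma cech_d_edge (c : cochain) (i j : 'I_n) r s r' s' : (i < j)%N ->
  c [set i]%SET = frac (xF [set i]%SET) r s -> c [set j]%SET = frac (xF [set j]%SET) r' s' ->
  cech_d c [set i; j]%SET = frac (xF [set i; j]%SET) (r' * x i ^+ s') s'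
    - frac (xF [set i; j]%SET) (r * x j ^+ s) s.
Proof.
move=> ij ci cj; have inj : i != j by rewrite -val_eqE /= neq_ltn ij.
rewrite /cech_d big_setU1 ?inE //= big_set1; congr (_ + _).
  have -> : #|[set l in [set i; j]%SET | (l < i)%N]%SET| = 0%N.
    apply/eqP; rewrite cards_eq0; apply/eqP/setP => l; rewrite !inE.
    by apply/negP => /andP[/orP[]/eqP->]; rewrite ?ltnn // ltnNge ltnW.
  rewrite expr0 scale1r setU1K2 // cj locmap_frac //.
  by rewrite xprod2 // xprod1 mulrC.
have -> : #|[set l in [set i; j]%SET | (l < j)%N]%SET| = 1%N.
  rewrite (_ : [set l in _ | _]%SET = [set i]%SET) ?cards1 //; apply/setP => l; rewrite !inE.
  have [->|li] := eqVneq l i; first by rewrite ij.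
  by case: eqP => [->|]; rewrite ?ltnn.
have -> : ([set i; j] :\ j = [set i])%SET by rewrite finset.setUC setU1K2 // eq_sym.
rewrite ci locmap_frac ?expr1 ?scaleN1r //.
by rewrite xprod2 // xprod1.
Qed.

(** Paired with g_ij, the image of r / x_i^s at the edge ij gives, up to a common sign, the
    coefficient of x_i^s of r g_ij on the x_i-axis. Summed over j this vanishes by the vertex
    condition. *)
Lemma pairing_coboundary g b : omega_model g -> @coboundary k R n x 2 b -> pairing g b = 0.
Proof.
move=> [g0 g_swap g_row] [c [c1 <-]].
pose rs i := repr (c [set i]%SET).
have cE i : c [set i]%SET = frac (xF [set i]%SET) (rs i).1 (rs i).2 by rewrite fracK.
pose t i j := (rho i j (rs i).1 * g i j)`_0`_(rs i).2.
apply/eqP; rewrite -oppr_eq0 -sumrN; apply/eqP; transitivity (\sum_i \sum_j t i j).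
  rewrite -sum_edges => [|i j /g0 gij]; last by rewrite /t gij mulr0 !coef0.
  apply: eq_bigr => i _; rewrite -sumrN; apply: eq_bigr => j /andP[ij ltij].
  have inj := edge_neq e_irr ij.
  rewrite (cech_d_edge ltij (cE i) (cE j)) -scaleN1r addrC edge_pairingP //.
  rewrite !edge_pairing_frac // !rmorphM !rmorphXn /= !rho_var /edge_var ij.
  rewrite !eqxx (eq_sym j) (negPf inj) rhoN1 mulN1r mulrN !coefN opprD opprK; congr (_ + _).
    by rewrite mulrAC mulrC coef_mulYn leqnn subnn.
  rewrite mulrAC mulrC coef_mulXn leqnn subnn /t -(rho_swap e_sym e_irr i j) -[g j i]opprK.
  by rewrite -g_swap mulrN -rmorphM !coefN /= coef_swapXY.
rewrite big1 // => i _; have [l il] := exists_neighbour e_conn n_ge3 i.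
rewrite -coef_sum (eq_bigr (fun j => (rho i l (rs i).1)`_0 * (g i j)`_0)) => [|j _].
  by rewrite -mulr_sumr g_row mulr0 coef0.
rewrite coef0M; have [ij|nij] := boolP (e i j); last by rewrite g0 // coef0 !mulr0.
by rewrite (rho_axis _ ij il).
Qed.

Lemma xprod_del (F : {set 'I_n}) i : i \in F -> xF F = xF (F :\ i)%SET * x i.
Proof. by move=> iF; rewrite /xprod (big_setD1 i) //= mulrC. Qed.

(** Localizations at sets of three vertices vanish, since such sets are not faces. *)
Lemma cocycle2 (c : cochain) : @cech_deg k R n x 2 c -> @cocycle k R n x 2 c.
Proof.
move=> c2; split=> //; apply: functional_extensionality_dep => F.
have [F3|F3] := boolP (#|F| == 3%N).
  by apply: loc_nonface; apply: contraL F3 => /card_face; case: eqP => // ->.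
rewrite /cech_d big1 // => i iF; rewrite c2 ?locmap0 ?scaler0 //; first exact: xprod_del.
by apply: contra F3 => /eqP Fi; rewrite (cardsD1 i) iF Fi.
Qed.

Local Notation Z := (@cocycle k R n x 2).
Local Notation B := (@coboundary k R n x 2).
Local Notation res := (@dual_res k R (cech x) Z B).

Lemma cocycle_lin (a : R) u v : Z u -> Z v -> Z (a *: u + v).
Proof. exact: (subquot_lin (span_cocycle x 2)). Qed.

Lemma pairing_admissible g : omega_model g -> admissible Z B (pairing g).
Proof.
move=> og; split=> [c u v _ _|a u _ Bu].
  rewrite pairingP; congr (_ + _); rewrite -pairing_scalar; congr pairing.
  by apply/funext => i; apply/funext => j; rewrite rho_alg.
rewrite -[a *: u]addr0 pairingP (pairing_coboundary _ Bu) ?add0r; last exact: omega_modelM.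
rewrite /pairing big1 // => i _; rewrite big1 // => j /andP[ij _].
have := @edge_pairing_frac i j (g i j) 0 0 ij.
by rewrite rmorph0 mul0r !coef0 => <-.
Qed.

Lemma pairing_degree g d : (forall i j, bihom d (g i j)) -> functional_degree Z d (pairing g).
Proof.
move=> gd i c id _ ci; rewrite /pairing big1 // => a _; rewrite big1 // => b /andP[ab _].
have [s [r [rd ->]]] := ci [set a; b]%SET; rewrite edge_pairing_frac //.
apply/eqP; apply: contraNT id => /(bihomM (bihom_rho e_irr ab rd) (gd a b)).
by rewrite cards2 (edge_neq e_irr ab); lia.
Qed.

(** The graded dual contains only finite sums of homogeneous functionals, so g is first cut into its
    homogeneous parts; [M] bounds all degrees. *)
Lemma exists_omega_of_model g : omega_model g -> exists w : omega k e, forall c, Z c -> res w c = pairing g c.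
Proof.
move=> og.
have [N NP] := choice (fun p : 'I_n * 'I_n => hpart_sum (g p.1 p.2)).
pose M := \max_p N p.
have gE i j : g i j = \sum_(d < M) hpart d (g i j).
  have [N0 {1}->] := NP (i, j); rewrite /=.
  have NM : (N (i, j) <= M)%N by exact: leq_bigmax.
  rewrite (big_ord_widen_cond _ xpredT (fun d => hpart d (g i j)) NM) /= [RHS](bigID (fun d : 'I_M => (d < N (i, j))%N)) /=.
  by rewrite [X in _ = _ + X]big1 ?addr0 // => d; rewrite -leqNgt => /N0.
have [w wE] := @dual_of_functionals k R (cech x) Z B (span_cocycle x 2) M (fun d => d%:Z)
  (fun d => pairing (fun i j => hpart d (g i j)))
  (fun d => pairing_admissible (omega_model_hpart d og))
  (fun d => @pairing_degree _ d%:Z (fun i j => @bihom_hpart k d (g i j))).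
exists w => c Zc; rewrite wE // /pairing exchange_big; apply: eq_bigr => i _ /=.
rewrite exchange_big; apply: eq_bigr => j _ /=.
rewrite /edge_pairing [in RHS]gE mulr_sumr !coef_sum.
by apply: eq_bigr => d _.
Qed.

Definition dart_cochain i j (r : R) s : cochain :=
  fun F => if F == [set i; j]%SET then frac (xF F) r s else 0.

Lemma dart_cocycle i j r s : i != j -> Z (dart_cochain i j r s).
Proof.
move=> ij; apply: cocycle2 => F; rewrite /dart_cochain.
by case: (F =P _) => [->|//]; rewrite cards2 ij.
Qed.

Lemma dart_cochainD i j r r' s :
  dart_cochain i j (r + r') s = dart_cochain i j r s + dart_cochain i j r' s.
Proof.
apply: functional_extensionality_dep => F.
rewrite -[RHS]/(dart_cochain i j r s F + dart_cochain i j r' s F) /dart_cochain.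
by case: ifP => _; rewrite ?fracD ?addr0.
Qed.

Lemma dart_cochainZ i j (a : R) r s : dart_cochain i j (a * r) s = a *: dart_cochain i j r s.
Proof.
apply: functional_extensionality_dep => F.
rewrite -[RHS]/(a *: dart_cochain i j r s F) /dart_cochain.
by case: ifP => _; [exact/esym/fracZ|exact/esym/scaler0].
Qed.

Lemma dart_cochain_eq i j r s r' s' t : i != j ->
  (x i * x j) ^+ (t + s') * r = (x i * x j) ^+ (t + s) * r' ->
  dart_cochain i j r s = dart_cochain i j r' s'.
Proof.
move=> ij h; apply: functional_extensionality_dep => F; rewrite /dart_cochain.
by case: eqP => // ->; apply/frac_eq; exists t; rewrite xprod2.
Qed.

Lemma dart_cochainC i j r s : dart_cochain i j r s = dart_cochain j i r s.
Proof. by apply: functional_extensionality_dep => F; rewrite /dart_cochain finset.setUC. Qed.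

Lemma dart_part i j r s d : i != j -> apart R (d + (s * 2)%:Z) r -> part (cech x) d (dart_cochain i j r s).
Proof.
move=> ij rd F; rewrite /dart_cochain; case: eqP => [->|_].
  by exists s, r; rewrite cards2 ij.
exists 0%N, 0; split=> //; rewrite mul0n addr0.
by case: d {rd} => d //=; exists 0; rewrite ?rmorph0 //; exact: rpred0.
Qed.

Definition vertex_cochain i (r : R) s : cochain :=
  fun F => if F == [set i]%SET then frac (xF F) r s else 0.

Lemma cochain_sumE (I : Type) (q : seq I) (P : pred I) (G : I -> cochain) F :
  (\sum_(l <- q | P l) G l) F = \sum_(l <- q | P l) G l F.
Proof. by elim: q => [|l q IH]; rewrite ?big_nil // !big_cons; case: (P l) => //; rewrite -IH. Qed.

(** The sign at the edge ij is -1 for i < j: there j is the removed vertex and i precedes it. *)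
Lemma cech_d_vertex i r s : cech_d (vertex_cochain i r s) =
  \sum_(j | e i j) ((if (i < j)%N then -1 else 1 : k)%:A : R) *: dart_cochain i j (r * x j ^+ s) s.
Proof.
apply: functional_extensionality_dep => F.
rewrite cochain_sumE.
have [fF|nF] := boolP (face e F); last by rewrite [LHS]loc_nonface // [RHS]loc_nonface.
have [/existsP[a /existsP[b /andP[ab /eqP FE]]]|F2] :=
  boolP [exists a, exists b, e a b && (F == [set a; b]%SET)]; last first.
  rewrite big1 => [|j ij]; last first.
    rewrite -[LHS]/(_ *: dart_cochain i j _ _ F) /dart_cochain; case: eqP => [FE|]; last by rewrite scaler0.
    by case/negP: F2; apply/existsP; exists i; apply/existsP; exists j; rewrite ij FE eqxx.
  rewrite /cech_d big1 // => j jF; rewrite /vertex_cochain; case: eqP => [Fj|_].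
    case/or3P: fF => [/eqP F0|/existsP[l /eqP Fl]|F3]; last by rewrite F3 in F2.
      by rewrite F0 inE in jF.
    exfalso; move: Fj; rewrite Fl; move: jF; rewrite Fl inE => /eqP-> /setP/(_ i).
    by rewrite !inE eqxx andNb.
  by rewrite locmap0 ?scaler0 //; exact: xprod_del.
wlog : a b ab FE / (a < b)%N => [wl|ltab].
  have [|ltba|/val_inj abE] := ltngtP a b; first exact: wl ab FE.
    have FE' : F = [set b; a]%SET by rewrite FE finset.setUC.
    have ba : e b a by rewrite e_sym.
    exact: wl ba FE' ltba.
  by rewrite abE e_irr in ab.
have anb := edge_neq e_irr ab.
have vE l : vertex_cochain i r s [set l]%SET = frac (xF [set l]%SET) (if l == i then r else 0) s.
  rewrite /vertex_cochain (inj_eq (@finset.set1_inj _)); case: eqP => // _.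
  by apply/esym; apply: (@frac_eq0 _ _ _ _ 0%N); rewrite mulr0.
rewrite FE (cech_d_edge ltab (vE a) (vE b)).
have [ia|ia] := eqVneq a i.
  subst i; rewrite (bigD1 b) //= big1 => [|j /andP[aj jb]]; last first.
    rewrite -[LHS]/(_ *: dart_cochain a j _ _ [set a; b]%SET) /dart_cochain.
    case: eqP => [/setP/(_ j)|]; last by rewrite scaler0.
    by rewrite !inE eqxx orbT (negPf jb) eq_sym (negPf (edge_neq e_irr aj)).
  rewrite addr0 ltab eq_sym (negPf anb) mul0r.
  rewrite (_ : frac _ 0 s = 0) ?sub0r; last by apply: (@frac_eq0 _ _ _ _ 0%N); rewrite mulr0.
  by rewrite -[RHS]/(_ *: dart_cochain a b _ _ _) /dart_cochain eqxx scaleN1r scaleN1r.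
have [ib|ib] := eqVneq b i.
  subst i; rewrite (bigD1 a) 1?e_sym //= big1 => [|j /andP[bj ja]]; last first.
    rewrite -[LHS]/(_ *: dart_cochain b j _ _ [set a; b]%SET) /dart_cochain.
    case: eqP => [/setP/(_ j)|]; last by rewrite scaler0.
    by rewrite !inE eqxx orbT (negPf ja) eq_sym (negPf (edge_neq e_irr bj)).
  rewrite addr0 ltnNge ltnW //= mul0r.
  rewrite [X in _ - X](_ : frac _ 0 s = 0) ?subr0; last by apply: (@frac_eq0 _ _ _ _ 0%N); rewrite mulr0.
  rewrite -[RHS]/(_ *: dart_cochain b a _ _ _) /dart_cochain finset.setUC eqxx scale1r.
  by rewrite scale1r.
rewrite !mul0r (_ : frac _ 0 s = 0) ?subrr; last by apply: (@frac_eq0 _ _ _ _ 0%N); rewrite mulr0.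
rewrite big1 // => j ij.
rewrite -[LHS]/(_ *: dart_cochain i j _ _ [set a; b]%SET) /dart_cochain.
case: eqP => [/setP/(_ i)|]; last by rewrite scaler0.
by rewrite !inE eqxx eq_sym (negPf ia) eq_sym (negPf ib).
Qed.

Lemma vertex_boundary i r s : B (cech_d (vertex_cochain i r s)).
Proof.
exists (vertex_cochain i r s); split=> // F; rewrite /vertex_cochain.
by case: (F =P _) => [->|//]; rewrite cards1.
Qed.

Lemma cocycle_sum (I : Type) (q : seq I) (P : pred I) (G : I -> cochain) :
  (forall l, P l -> Z (G l)) -> Z (\sum_(l <- q | P l) G l).
Proof.
move=> ZG; have Z0 : Z 0 by rewrite -(span_cocycle x 2); exact: span0.
elim: q => [|l q IH]; rewrite ?big_nil ?big_cons //; case Pl: (P l) => //.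
by rewrite -[G l]scale1r; apply: cocycle_lin; first exact: ZG.
Qed.

Lemma cocycleZ (a : R) u : Z u -> Z (a *: u).
Proof.
have Z0 : Z 0 by rewrite -(span_cocycle x 2); exact: span0.
by move=> Zu; rewrite -[a *: u]addr0; exact: cocycle_lin.
Qed.

Lemma SRvar3 i j l : i != j -> i != l -> j != l -> x i * x j * x l = 0.
Proof.
move=> ij il jl; apply: (@rho_inj k n e e_irr e_conn n_ge3) => a b ab.
rewrite !rmorphM /= !rho_var /edge_var ab /=.
have /or3P[] : [|| (i != a) && (i != b), (j != a) && (j != b) | (l != a) && (l != b)].
- apply: contraT; rewrite !negb_or !negb_and !negbK => /and3P[ia ja la].
  move: ij il jl; case/orP: ia => /eqP->; case/orP: ja => /eqP->; case/orP: la => /eqP->;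
  by rewrite ?eqxx.
- by move=> /andP[/negPf-> /negPf->]; rewrite !mul0r.
- by move=> /andP[/negPf-> /negPf->]; rewrite mulr0 mul0r.
- by move=> /andP[/negPf-> /negPf->]; rewrite mulr0.
Qed.

Lemma rhoB i j (r r' : R) : rho i j (r - r') = rho i j r - rho i j r'.
Proof. exact: rmorphB. Qed.

Lemma rhoM i j (r r' : R) : rho i j (r * r') = rho i j r * rho i j r'.
Proof. exact: rmorphM. Qed.

(** x_i x_j vanishes on all other edges. Hence a fraction over (x_i x_j)^s depends only on the
    restriction of its numerator to ij. *)
Lemma edge_rho_eq i j (r q : R) : e i j -> rho i j q = rho i j r -> x i * x j * (r - q) = 0.
Proof.
move=> ij rq.
have q1 : rho i j (r - q) = 0 by rewrite rhoB rq subrr.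
have q2 : rho j i (r - q) = 0 by rewrite -(rho_swap e_sym e_irr) q1 rmorph0.
move: (r - q) q1 q2 => r' q1 q2 {rq}.
apply: (@rho_inj k n e e_irr e_conn n_ge3) => a b ab; rewrite rhoM [RHS]rmorph0.
have [[<- <-]|ab1] := eqVneq (i, j) (a, b); first by rewrite q1 mulr0.
have [[<- <-]|ab2] := eqVneq (i, j) (b, a); first by rewrite q2 mulr0.
by rewrite (rho_edge_var2 k e_irr ab ij ab1 ab2) mul0r.
Qed.

Section Coefficients.
Variables (F : cochain -> k) (d : int).
Hypotheses (Fadm : admissible Z B F) (Fdeg : functional_degree Z d F).

Lemma admissible0 : F 0 = 0.
Proof.
have Z0 : Z 0 by rewrite -(span_cocycle x 2); exact: span0.
by have := Fadm.1 (-1) 0 0 Z0 Z0; rewrite scaler0 addr0 mulN1r addNr.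
Qed.

Lemma admissibleD u v : Z u -> Z v -> F (u + v) = F u + F v.
Proof. by move=> Zu Zv; have := Fadm.1 1 u v Zu Zv; rewrite scale1r scale1r mul1r. Qed.

Lemma admissibleZ (c : k) u : Z u -> F (c%:A *: u) = c * F u.
Proof.
have Z0 : Z 0 by rewrite -(span_cocycle x 2); exact: span0.
by move=> Zu; have := Fadm.1 c u 0 Zu Z0; rewrite addr0 admissible0 addr0.
Qed.

Lemma admissible_sum (I : Type) (q : seq I) (P : pred I) (G : I -> cochain) :
  (forall l, P l -> Z (G l)) -> F (\sum_(l <- q | P l) G l) = \sum_(l <- q | P l) F (G l).
Proof.
move=> ZG; have Z0 : Z 0 by rewrite -(span_cocycle x 2); exact: span0.
elim: q => [|l q IH]; rewrite ?big_nil ?big_cons; first exact: admissible0.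
case Pl: (P l) => //; rewrite admissibleD ?IH //; first exact: ZG.
exact: cocycle_sum.
Qed.

Lemma dart_killed i j (r : R) s : i != j -> x i * x j * r = 0 -> F (dart_cochain i j r s) = 0.
Proof.
move=> ij r0; rewrite (@dart_cochain_eq i j r s 0 0 1 ij).
  by rewrite -[X in dart_cochain i j X](mul0r 1) dart_cochainZ scale0r admissible0.
by rewrite !mulr0 add1n expr1.
Qed.

(** After cancellation this is the fraction x_j r / x_i^s, up to sign the coboundary of a vertex
    cochain; its components at other edges ih vanish because x_i x_h x_j = 0. *)
Lemma dart_boundary i j (r : R) s : e i j -> F (dart_cochain i j (r * x j ^+ s.+1) s) = 0.
Proof.
move=> ij; have inj := edge_neq e_irr ij.
pose l : k := if (i < j)%N then -1 else 1.
have l2 : l * l = 1 by rewrite /l; case: ifP; rewrite ?mulrNN mulr1.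
have dE : cech_d (vertex_cochain i (x j * r) s) =
    (l%:A : R) *: dart_cochain i j (r * x j ^+ s.+1) s.
  rewrite cech_d_vertex (bigD1 j) //= big1 ?addr0 => [|h /andP[ih hj]].
    by congr (_ *: dart_cochain i j _ s); rewrite exprS mulrA (mulrC r).
  rewrite (@dart_cochain_eq i h _ s 0 0 1 (edge_neq e_irr ih)); last first.
    rewrite !mulr0 add1n expr1 mulrA mulrA.
    by rewrite (SRvar3 (edge_neq e_irr ih) inj) ?mul0r.
  by rewrite -[X in dart_cochain i h X](mul0r 1) dart_cochainZ scale0r scaler0.
have := Fadm.2 l%:A (cech_d (vertex_cochain i (x j * r) s)).
rewrite dE scalerA -scalerAl mul1r scalerA l2 scale1r scale1r -dE; apply; last exact: vertex_boundary.
by rewrite dE; apply/cocycleZ/dart_cocycle.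
Qed.

(** F kills the coboundary of 1 / x_i^s; this is the origin of the vertex condition of the model. *)
Lemma dart_vertex_sum i s : \sum_(j | e i j) (if (i < j)%N then 1 else -1) * F (dart_cochain i j (x j ^+ s) s) = 0.
Proof.
have ZD j : e i j -> Z (((if (i < j)%N then -1 else 1 : k)%:A : R) *: dart_cochain i j (1 * x j ^+ s) s).
  by move=> ij; apply/cocycleZ/dart_cocycle/(edge_neq e_irr).
have := Fadm.2 1 (cech_d (vertex_cochain i 1 s)).
rewrite scale1r {1 3}cech_d_vertex => /(_ (cocycle_sum _ ZD) (vertex_boundary _ _ _)).
rewrite admissible_sum // => F0; apply/eqP; rewrite -oppr_eq0 -sumrN; apply/eqP; rewrite -[RHS]F0.
apply: eq_bigr => j ij; rewrite admissibleZ ?mul1r; last exact/dart_cocycle/(edge_neq e_irr).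
by rewrite -mulNr; case: ifP => _; rewrite ?opprK.
Qed.

Lemma apart_monomial i j a b : apart R (a + b)%:Z (x i ^+ a * x j ^+ b).
Proof.
exists ('X_i ^+ a * 'X_j ^+ b); last by rewrite -[RHS]/(_ : SR k e) rmorphM !rmorphXn.
by rewrite /= !mpolyXn -mpolyXD dhomogX /= mdegD !mdegMn !mdeg1 !mul1n.
Qed.

(** The coefficient of x_i^a x_j^b in the family attached to F is its value on 1 / (x_i^a x_j^b),
    written over the common power (x_i x_j)^(a + b). The sign records the orientation of the
    edge. *)
Definition dart_coef (i j : 'I_n) a b : k :=
  (if (i < j)%N then 1 else -1) * F (dart_cochain i j (x i ^+ b * x j ^+ a) (a + b)).

Lemma dart_coef_deg i j a b : e i j -> (a + b)%:Z != d -> dart_coef i j a b = 0.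
Proof.
move=> ij abd; rewrite /dart_coef; have inj := edge_neq e_irr ij.
rewrite (@Fdeg (- (a + b)%:Z)) ?mulr0 //; first by rewrite eqr_opp.
  exact: dart_cocycle.
apply: dart_part => //; have := apart_monomial i j b a.
by congr (apart R _ _); lia.
Qed.

Definition dart_model (i j : 'I_n) : S := if e i j then
  (if d is Posz m then \poly_(b < m.+1) (dart_coef i j (m - b) b *: 'X^(m - b)) else 0) else 0.

Lemma coef_dart_model i j a b : (dart_model i j)`_b`_a = if e i j then dart_coef i j a b else 0.
Proof.
rewrite /dart_model; case: ifP => ij; last by rewrite !coef0.
have dcd := dart_coef_deg ij; case: d dcd => m dcd; last by rewrite !coef0 dcd.
rewrite coef_poly; case: ltnP => bm; last by rewrite coef0 dcd // eqz_nat; lia.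
rewrite coefZ coefXn; have [->|am] := eqVneq a (m - b)%N; first by rewrite mulr1.
by rewrite mulr0 dcd // eqz_nat; lia.
Qed.

Lemma dart_model_omega : omega_model dart_model.
Proof.
split=> [i j /negPf ij|i j|i]; first by rewrite /dart_model ij.
  apply/polyP => b; apply/polyP => a; rewrite coef_swapXY !coefN !coef_dart_model e_sym.
  case: ifP => ij; last by rewrite oppr0.
  rewrite /dart_coef dart_cochainC addnC mulrC [x i ^+ _ * _]mulrC mulrC -mulNr; congr (_ * _).
  case: ltngtP => [_|_|/val_inj ije]; rewrite ?opprK //.
  by rewrite ije e_irr in ij.
apply/polyP => a; rewrite coef_sum coef0 -[RHS](dart_vertex_sum i a) [RHS]big_mkcond.
apply: eq_bigr => j _; rewrite coef_dart_model; case: ifP => // ij.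
by rewrite /dart_coef expr0 mul1r addn0.
Qed.

Lemma edge_liftD (i j : 'I_n) (p q : S) : edge_lift e i j (p + q) = edge_lift e i j p + edge_lift e i j q.
Proof. by rewrite /edge_lift rmorphD hornerD. Qed.

Lemma edge_lift_monomial i j (c : k) a b :
  edge_lift e i j (c%:P%:P * (X ^+ a * Y ^+ b)) = c%:A * (x i ^+ a * x j ^+ b).
Proof.
rewrite /edge_lift !rmorphM !rmorphXn /= !map_polyC map_polyX /= horner_algC horner_algX.
by rewrite hornerM hornerC hornerM horner_exp hornerC hornerXn.
Qed.

(** Reduced to monomials x_i^a x_j^b. If a or b exceeds s, the fraction is a boundary; otherwise it
    is the fraction that defines [dart_coef] at exponents s - a and s - b. *)
Lemma dart_model_sig i j p s : e i j -> (i < j)%N ->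
  F (dart_cochain i j (edge_lift e i j p) s) = (p * dart_model i j)`_s`_s.
Proof.
move=> ij ltij; have inj := edge_neq e_irr ij.
have pE : p = \sum_(b < size p) \sum_(a < size p`_b) (p`_b`_a)%:P%:P * (X ^+ a * Y ^+ b).
  rewrite -{1}[p]coefK poly_def; apply: eq_bigr => b _; rewrite -mul_polyC.
  rewrite -{1}[p`_b]coefK poly_def rmorph_sum mulr_suml; apply: eq_bigr => a _.
  by rewrite -mul_polyC rmorphM rmorphXn mulrA.
have LD q q' : F (dart_cochain i j (edge_lift e i j (q + q')) s) =
    F (dart_cochain i j (edge_lift e i j q) s) + F (dart_cochain i j (edge_lift e i j q') s).
  by rewrite edge_liftD dart_cochainD admissibleD //; exact: dart_cocycle.
have L0 : F (dart_cochain i j (edge_lift e i j 0) s) = 0.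
  by apply: (addrI (F (dart_cochain i j (edge_lift e i j 0) s))); rewrite -LD !addr0.
rewrite {1}pE (big_morph _ LD L0) [in RHS]pE mulr_suml !coef_sum; apply: eq_bigr => b _.
rewrite (big_morph _ LD L0) mulr_suml !coef_sum; apply: eq_bigr => a _.
rewrite edge_lift_monomial dart_cochainZ admissibleZ; last exact: dart_cocycle.
rewrite -!mulrA !coefCM; congr (_ * _); rewrite coef_mulXn coef_mulYn.
case: leqP => [sa|sa]; last first.
  rewrite dart_cochainC mulrC -[nat_of_ord a](subnK sa) exprD mulrA.
  by rewrite dart_boundary // e_sym.
case: leqP => [sb|sb]; last first.
  by rewrite -[X in x j ^+ X](subnK sb) exprD mulrA dart_boundary.
rewrite coef_dart_model ij /dart_coef ltij mul1r; congr F; apply: (@dart_cochain_eq _ _ _ _ _ _ 0) => //.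
rewrite !add0n !exprMn mulrACA -!exprD [RHS]mulrACA -!exprD.
by congr (_ ^+ _ * _ ^+ _); lia.
Qed.

(** A 2-cochain is the sum of its components on edges, and each numerator may be replaced by the
    lift of its restriction to the edge. *)
Lemma functional_pairing c : Z c -> F c = pairing dart_model c.
Proof.
move=> [c2 _]; pose rs i j := repr (c [set i; j]%SET).
have cE : c = \sum_i \sum_(j < n | e i j && (i < j)%N) dart_cochain i j (rs i j).1 (rs i j).2.
  apply: functional_extensionality_dep => G; rewrite cochain_sumE.
  under eq_bigr do rewrite cochain_sumE.
  have [fG|nG] := boolP (face e G); last by rewrite [LHS]loc_nonface // [RHS]loc_nonface.
  have [/existsP[a /existsP[b /andP[ab /eqP GE]]]|G2] :=
    boolP [exists a, exists b, e a b && (G == [set a; b]%SET)]; last first.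
    rewrite big1 => [|i _]; last first.
      rewrite big1 // => j /andP[ij _]; rewrite /dart_cochain; case: (G =P _) => // GE.
      by case/negP: G2; apply/existsP; exists i; apply/existsP; exists j; rewrite ij GE eqxx.
    apply: c2; apply: contra G2 => /eqP G2; move: fG; rewrite /face.
    case/or3P=> // [/eqP G0|/existsP[l /eqP Gl]]; first by rewrite G0 cards0 in G2.
    by rewrite Gl cards1 in G2.
  wlog ltab : a b ab GE / (a < b)%N => [wl|].
    have [|ltba|/val_inj abE] := ltngtP a b; first exact: wl ab GE.
      have GE' : G = [set b; a]%SET by rewrite GE finset.setUC.
      have ba : e b a by rewrite e_sym.
      exact: wl ba GE' ltba.
    by rewrite abE e_irr in ab.
  have set2 (i j : 'I_n) : (i < j)%N -> [set a; b]%SET = [set i; j]%SET -> i = a /\ j = b.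
    move=> ltij /setP S2; have := S2 a; have := S2 b; rewrite !inE !eqxx orbT /=.
    move=> /esym/orP[]/eqP bE /esym/orP[]/eqP aE; rewrite ?aE ?bE //.
    - by move: ltab; rewrite aE bE ltnn.
    - by move: ltab; rewrite aE bE ltnNge ltnW.
    - by move: ltab; rewrite aE bE ltnn.
  rewrite GE (bigD1 a) //= (bigD1 b) ?ab //= {1}/dart_cochain eqxx fracK.
  rewrite big1 => [|j /andP[/andP[aj ltaj] jb]]; last first.
    by rewrite /dart_cochain; case: eqP => // /(set2 _ _ ltaj)[_ jE]; rewrite jE eqxx in jb.
  rewrite addr0 big1 ?addr0 // => i ia; rewrite big1 // => j /andP[ij ltij].
  by rewrite /dart_cochain; case: eqP => // /(set2 _ _ ltij)[iE _]; rewrite iE eqxx in ia.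
have ZD i j : e i j && (i < j)%N -> Z (dart_cochain i j (rs i j).1 (rs i j).2).
  by move=> /andP[ij _]; exact/dart_cocycle/(edge_neq e_irr).
rewrite {1}cE admissible_sum => [|i _]; last by apply: cocycle_sum => j; exact: ZD.
apply: eq_bigr => i _; rewrite admissible_sum => [|j]; last exact: ZD.
apply: eq_bigr => j /andP[ij ltij]; rewrite /edge_pairing -/(rs i j) -dart_model_sig //.
have inj := edge_neq e_irr ij.
have xr := edge_rho_eq ij (rho_edge_liftK e_irr (rho i j (rs i j).1) ij).
set q := edge_lift _ _ _ _ in xr *.
rewrite -[(rs i j).1](subrK q) dart_cochainD admissibleD; try exact: dart_cocycle.
by rewrite (@dart_killed i j _ _ inj xr) add0r.
Qed.

End Coefficients.

End Omega.

Section OmegaDarts.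
Variables (k : fieldType) (n : nat) (e : rel 'I_n).
Hypotheses (e_sym : symmetric e) (e_irr : irreflexive e) (e_conn : connected e).
Hypothesis n_ge3 : (3 <= n)%N.
Local Notation R := (SRring k e).
Local Notation S := {poly {poly k}}.
Local Notation x := (SRvar k e).
Local Notation cochain := (@cochain k R n x).
Local Notation Z := (@cocycle k R n x 2).
Local Notation B := (@coboundary k R n x 2).
Local Notation res := (@dual_res k R (cech x) Z B).
Local Notation omega_model := (@omega_model k n e).
Local Notation pairing := (@pairing k n e).
Local Notation dart_cochain := (@dart_cochain k n e).

Lemma pairing0 g : pairing g (0 : cochain) = 0.
Proof.
rewrite /pairing big1 // => i _; rewrite big1 // => j /andP[ij _].
have := @edge_pairing_frac k n e e_irr i j (g i j) 0 0 ij.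
by rewrite rmorph0 mul0r !coef0 => <-.
Qed.

Lemma pairingZ g (a : R) (c : cochain) : pairing g (a *: c) = pairing (fun i j => rho i j a * g i j) c.
Proof. by rewrite -[a *: c]addr0 pairingP // pairing0 addr0. Qed.

Lemma dart_cochain_id i j r s : dart_cochain i j r s [set i; j]%SET = frac (xprod x [set i; j]%SET) r s.
Proof. by rewrite /dart_cochain eqxx. Qed.

Lemma dart_cochain_other i j r s F : F != [set i; j]%SET -> dart_cochain i j r s F = 0.
Proof. by rewrite /dart_cochain => /negPf->. Qed.

Lemma edge_pairing0 i j p : e i j -> edge_pairing i j p (0 : loc (xprod x [set i; j]%SET)) = 0.
Proof.
move=> ij; have := @edge_pairing_frac k n e e_irr i j p 0 0 ij.
by rewrite rmorph0 mul0r !coef0 => <-.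
Qed.

Lemma sum_pair1 (P : rel 'I_n) (t : 'I_n -> 'I_n -> k) i j : P i j ->
  (forall a b, P a b -> (a, b) != (i, j) -> t a b = 0) -> \sum_a \sum_(b | P a b) t a b = t i j.
Proof.
move=> Pij t0; rewrite (bigD1 i) //= [X in _ + X = _]big1 ?addr0 => [|a ai]; last first.
  by rewrite big1 // => b ab; apply: t0 => //; rewrite xpair_eqE (negPf ai).
rewrite (bigD1 j) //= big1 ?addr0 // => b /andP[ib bj].
by apply: t0 => //; rewrite xpair_eqE eqxx.
Qed.

Lemma pairing_dart g i j r s : e i j -> (i < j)%N ->
  pairing g (dart_cochain i j r s) = (rho i j r * g i j)`_s`_s.
Proof.
move=> ij ltij; have inj := edge_neq e_irr ij.
have zero a b : e a b -> ([set a; b]%SET != [set i; j]%SET) ->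
    edge_pairing a b (g a b) (dart_cochain i j r s [set a; b]%SET) = 0.
  by move=> ab abij; rewrite (dart_cochain_other _ _ abij) (edge_pairing0 _ ab).
have := @sum_pair1 (fun a b => e a b && (a < b)%N)
  (fun a b => edge_pairing a b (g a b) (dart_cochain i j r s [set a; b]%SET)) i j.
rewrite dart_cochain_id (edge_pairing_frac e_irr (g i j) r s ij); apply; first by rewrite ij.
move=> a b /andP[ab ltab] abij; apply: zero => //; apply: contra abij => /eqP/setP S2.
have := S2 a; have := S2 b; rewrite !inE !eqxx orbT /= => /esym/orP[]/eqP bE /esym/orP[]/eqP aE.
- by move: ltab; rewrite aE bE ltnn.
- by move: ltab; rewrite aE bE ltnNge ltnW.
- by rewrite aE bE.
- by move: ltab; rewrite aE bE ltnn.
Qed.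

(** The fractions 1 / (x_i^a x_j^b) recover all coefficients. *)
Lemma pairing_inj g h : omega_model g -> omega_model h ->
  (forall c, Z c -> pairing g c = pairing h c) -> g = h.
Proof.
move=> [g1 g2 g3] [h1 h2 h3] gh.
have gE i j : e i j -> (i < j)%N -> g i j = h i j.
  move=> ij ltij; have inj := edge_neq e_irr ij.
  apply/polyP => b; apply/polyP => a.
  have := gh _ (@dart_cocycle k n e i j (x i ^+ b * x j ^+ a) (a + b) inj).
  rewrite !pairing_dart // !rhoM.
  have rX l m : rho i j (x l ^+ m) = (rho i j (x l)) ^+ m by exact: rmorphXn.
  rewrite !rX !rho_var /edge_var ij !eqxx (eq_sym j) (negPf inj) -!mulrA !coef_mulXn !coef_mulYn.
  by rewrite leq_addl leq_addr addnK addKn.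
apply/funext => i; apply/funext => j.
have [ij|nij] := boolP (e i j); last by rewrite g1 // h1.
case: (ltngtP i j) => [ltij|ltji|/val_inj ijE]; first exact: gE.
  by apply: oppr_inj; rewrite -g2 -h2 gE // e_sym.
by rewrite ijE e_irr in ij.
Qed.

Lemma exists_model (w : omega k e) : exists g, omega_model g /\ forall c, Z c -> res w c = pairing g c.
Proof.
have := @dual_ind k R (cech x) Z B (span_cocycle x 2)
  (fun F => exists g, omega_model g /\ forall c, Z c -> F c = pairing g c) w.
apply.
- move=> F F' FF' [g [og gE]]; exists g; split=> // c Zc; rewrite -FF' //; exact: gE.
- exists (fun _ _ => 0); split.
    by split=> // [i j|i]; rewrite ?rmorph0 ?oppr0 // big1 // => j _; rewrite coef0.
  move=> c _; rewrite /pairing big1 // => i _; rewrite big1 // => j _.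
  by rewrite /edge_pairing mulr0 !coef0.
- move=> a F F' [g [og gE]] [g' [og' gE']].
  exists (fun i j => rho i j a * g i j + g' i j); split.
    exact: (omega_modelD (omega_modelM e_sym e_irr e_conn n_ge3 a og) og').
  move=> c Zc; rewrite pairingD -pairingZ gE' // gE //; exact: cocycleZ.
- move=> j F Fadm Fdeg; exists (@dart_model k n e F j); split.
    exact: (dart_model_omega e_sym e_irr n_ge3 Fadm Fdeg).
  exact: (functional_pairing e_sym e_irr e_conn n_ge3 Fadm Fdeg).
Qed.

(** From here on, the canonical module enters only through these coordinates. *)
Lemma omega_darts : exists Psi : omega k e -> 'I_n -> 'I_n -> S,
  [/\ forall a u v i j, Psi (a *: u + v) i j = rho i j a * Psi u i j + Psi v i j,
      injective Psi, forall u, omega_model (Psi u),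
      forall g, omega_model g -> exists u, Psi u = g &
      forall d u, part (omega k e) d u <-> forall i j, bihom d (Psi u i j)].
Proof.
have [Psi PsiP] := choice exists_model.
have om u : omega_model (Psi u) by have [] := PsiP u.
have resE u c : Z c -> res u c = pairing (Psi u) c by have [_] := PsiP u; exact.
exists Psi; split=> //.
- move=> a u v i j.
  have := @pairing_inj (Psi (a *: u + v)) (fun i j => rho i j a * Psi u i j + Psi v i j).
  move=> h; rewrite h //; first exact: (omega_modelD (omega_modelM e_sym e_irr e_conn n_ge3 a (om u)) (om v)).
  move=> c Zc; rewrite pairingD -pairingZ.
  apply: etrans (esym (resE _ _ Zc)) _.
  apply: etrans (@dual_resP k R (cech x) Z B (span_cocycle x 2) a u v c Zc) _.
  congr (_ + _); last exact: (resE v c Zc).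
  exact: (resE u _ (cocycleZ a Zc)).
- by move=> u v uv; apply: (dual_res_inj (span_cocycle x 2)) => c Zc; rewrite !resE // uv.
- move=> g og; have [u uE] := exists_omega_of_model e_sym e_irr e_conn n_ge3 og.
  by exists u; apply: pairing_inj => // c Zc; rewrite -resE // uE.
move=> d u; split=> [|ud]; last first.
  apply/(dual_part_res (span_cocycle x 2)) => i c id Zc ci; rewrite resE //.
  exact: (@pairing_degree k n e e_irr n_ge3 (Psi u) d ud i c id Zc ci).
move=> /(dual_part_res (span_cocycle x 2)) Fdeg.
have Fadm : admissible Z B (res u) by exact: (dual_res_admissible (span_cocycle x 2)).
have -> : Psi u = @dart_model k n e (res u) d.
  apply: pairing_inj => //; first exact: (dart_model_omega e_sym e_irr n_ge3 Fadm Fdeg).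
  move=> c Zc; rewrite -resE //.
  exact: (functional_pairing e_sym e_irr e_conn n_ge3 Fadm Fdeg).
move=> i j a b; rewrite (coef_dart_model e_irr n_ge3 Fdeg); case: ifP => ij; last by rewrite eqxx.
by apply: contraNeq => abd; rewrite (dart_coef_deg e_irr n_ge3 Fdeg).
Qed.

End OmegaDarts.

(** * Homogeneous elements and generators of the model *)

Section Darts.
Variables (k : fieldType) (n : nat) (e : rel 'I_n).
Hypotheses (e_sym : symmetric e) (e_irr : irreflexive e) (e_conn : connected e).
Hypothesis n_ge3 : (3 <= n)%N.
Local Notation R := (SRring k e).
Local Notation S := {poly {poly k}}.
Local Notation X := ('X%:P : S).
Local Notation Y := ('X : S).
Local Notation x := (SRvar k e).
Local Notation darts := ('I_n -> 'I_n -> S).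
Local Notation omega_model := (@omega_model k n e).
Local Notation cyclesp := (@cyclesp k n e).
Local Notation starsp := (@starsp k n e).

Definition flat (z : 'M[k]_n) : darts := fun i j => (z i j)%:P%:P.
(** For d > 0 the restriction to the x_i-axis is v_ij x_i^d; the term in Y is what alternation
    forces at the other end. *)
Definition axis d (v : 'M[k]_n) : darts :=
  fun i j => (v i j)%:P%:P * X ^+ d - (v j i)%:P%:P * Y ^+ d.

Lemma coef_XnYn (c : k) d d' a b : (c%:P%:P * (X ^+ d * Y ^+ d'))`_b`_a =
  if (a == d) && (b == d') then c else 0.
Proof.
rewrite !coefCM coef_mulXn; case: leqP => [da|ad]; last first.
  by rewrite mulr0; case: eqP ad => // ->; rewrite ltnn.
rewrite -[Y ^+ d']mulr1 coef_mulYn; case: leqP => [db|bd]; last first.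
  by rewrite mulr0; case: (b =P d') bd => [->|]; rewrite ?ltnn ?andbF.
rewrite coef1; have [->|bd] := eqVneq b d'; last first.
  by rewrite andbF subn_eq0 leqNgt ltn_neqAle eq_sym bd db /= coef0 mulr0.
rewrite subnn andbT coef1; have [->|ad] := eqVneq a d; first by rewrite subnn mulr1.
by rewrite subn_eq0 leqNgt ltn_neqAle eq_sym ad da /= mulr0.
Qed.

Lemma coef_XnBYn (c c' : k) d a b : (c%:P%:P * X ^+ d - c'%:P%:P * Y ^+ d)`_b`_a =
  (if (a == d) && (b == 0%N) then c else 0) - (if (a == 0%N) && (b == d) then c' else 0).
Proof.
rewrite !coefB -[X ^+ d]mulr1 -[Y ^+ d]mul1r.
have := coef_XnYn c d 0 a b; rewrite expr0 => ->.
by have := coef_XnYn c' 0 d a b; rewrite expr0 => ->.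
Qed.

Lemma swapXYN (p : S) : swapXY (- p) = - swapXY p.
Proof. exact: rmorphN. Qed.

Lemma swapXY_XnBYn (c c' : k) d :
  swapXY (c%:P%:P * X ^+ d - c'%:P%:P * Y ^+ d) = - (c'%:P%:P * X ^+ d - c%:P%:P * Y ^+ d).
Proof.
apply/polyP => b; apply/polyP => a; rewrite coef_swapXY 2!coefN !coef_XnBYn opprB.
by congr (_ - _); rewrite andbC.
Qed.

Lemma coef_axis d v i j a b : (axis d v i j)`_b`_a =
  (if (a == d) && (b == 0%N) then v i j else 0) - (if (a == 0%N) && (b == d) then v j i else 0).
Proof. exact: coef_XnBYn. Qed.

Lemma coef_flat z i j a b : (flat z i j)`_b`_a = if (a == 0%N) && (b == 0%N) then z i j else 0.
Proof. by rewrite -coef_XnYn /flat !expr0 mulr1 mulr1. Qed.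

Lemma flat_bihom z i j : bihom 0 (flat z i j).
Proof. by move=> a b; rewrite coef_flat; case: ifP => [/andP[/eqP-> /eqP->]|]; rewrite ?eqxx. Qed.

Lemma axis_bihom (d : nat) v i j : bihom d (axis d v i j).
Proof.
move=> a b; rewrite coef_axis; case: ifP => [/andP[/eqP-> /eqP->] _|_]; first by rewrite addn0.
by case: ifP => [/andP[/eqP-> /eqP->] _|_]; rewrite ?subr0 ?eqxx.
Qed.

Lemma flat_model z : z \in cyclesp -> omega_model (flat z).
Proof.
move=> /mem_cyclesp[z1 z2 z3]; split=> [i j ij|i j|i]; first by rewrite /flat z1 // !polyC0.
  by rewrite /flat swapXY_polyC map_polyC /= (z2 i) !polyCN.
apply/polyP => a; rewrite coef_sum coef0; under eq_bigr do rewrite coef_flat eqxx andbT.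
by case: eqP => _; [exact: z3|rewrite big1].
Qed.

Lemma axis_model d v : v \in starsp -> omega_model (axis d.+1 v).
Proof.
move=> /mem_starsp[v1 v2]; split=> [i j ij|i j|i].
- by rewrite /axis !v1 // 1?e_sym // !polyC0 !mul0r subrr.
- exact: swapXY_XnBYn.
apply/polyP => a; rewrite coef_sum coef0; under eq_bigr do rewrite coef_axis eqxx andbT andbF subr0.
by case: eqP => _; [exact: v2|rewrite big1].
Qed.

Lemma model_degree0 g : omega_model g -> (forall i j, bihom 0 (g i j)) ->
  exists2 z, z \in cyclesp & g = flat z.
Proof.
move=> [g1 g2 g3] g0; pose z : 'M[k]_n := \matrix_(i, j) (g i j)`_0`_0.
exists z.
  apply/mem_cyclesp; split=> [i j ij|i j|i]; rewrite ?mxE; first by rewrite g1 // !coef0.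
    by rewrite -!coefN -g2 coef_swapXY.
  by under eq_bigr do rewrite mxE; rewrite -coef_sum g3 coef0.
apply/funext => i; apply/funext => j; apply/polyP => b; apply/polyP => a.
rewrite coef_flat mxE; case: ifP => [/andP[/eqP-> /eqP->]//|ab].
by apply/eqP; apply: contraFT ab => /g0[]; case: a => //; case: b.
Qed.

(** The vertex condition concerns the pure powers only, so h is constrained by nothing but
    alternation. *)
Lemma model_degreeS (d : nat) g : omega_model g -> (forall i j, bihom d.+1 (g i j)) ->
  exists2 v, v \in starsp & exists h : darts, [/\ forall i j, ~~ e i j -> h i j = 0,
    forall i j, swapXY (h i j) = - h j i &
    forall i j, g i j = axis d.+1 v i j + X * Y * h i j].
Proof.
move=> [g1 g2 g3] gd; pose v : 'M[k]_n := \matrix_(i, j) (g i j)`_0`_d.+1.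
exists v.
  apply/mem_starsp; split=> [i j ij|i]; rewrite ?mxE; first by rewrite g1 // !coef0.
  by under eq_bigr do rewrite mxE; rewrite -coef_sum g3 coef0.
exists (fun i j => drop_poly 1 (map_poly (drop_poly 1) (g i j))).
have cE (p : S) a b : (drop_poly 1 (map_poly (drop_poly 1) p))`_b`_a = p`_b.+1`_a.+1.
  by rewrite coef_drop_poly coef_map_id0 ?drop_poly0r // coef_drop_poly !addn1.
split=> [i j ij|i j|i j]; first by rewrite g1 // map_poly0 drop_poly0r.
  by apply/polyP => b; apply/polyP => a; rewrite coef_swapXY !coefN !cE -!coefN -g2 coef_swapXY.
apply/polyP => b; apply/polyP => a.
have gE : g j i = - swapXY (g i j) by rewrite g2 opprK.
have g0 a' b' : (a' + b' != d.+1)%N -> (g i j)`_b'`_a' = 0.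
  by move=> ab; apply/eqP; apply: contraNT ab => /gd[->].
case: a => [|a]; case: b => [|b];
  rewrite 2!coefD coef_axis !mxE -mulrA coef_mulX ?coef_mulY ?coef0 ?eqxx ?andbF ?andbT ?subr0 ?sub0r ?addr0.
- by rewrite g0.
- by case: eqP => [[->]|bd]; [rewrite gE !coefN coef_swapXY opprK|rewrite oppr0 g0 //; apply/eqP].
- by case: eqP => [[->]//|ad]; rewrite g0 // addn0; apply/eqP.
- by rewrite add0r cE.
Qed.

(** No multiple of x_i x_j fits into degree 1. *)
Lemma model_degree1 g : omega_model g -> (forall i j, bihom 1 (g i j)) ->
  exists2 v, v \in starsp & g = axis 1 v.
Proof.
move=> og gd; have [v vs [h [h1 h2 gE]]] := model_degreeS (d := 0) og gd.
exists v => //; apply/funext => i; apply/funext => j; rewrite gE.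
suff -> : h i j = 0 by rewrite mulr0 addr0.
apply/polyP => b; apply/polyP => a; rewrite coef0 coef0; apply/eqP; apply: contraT.
have := bihomB (gd i j) (@axis_bihom 1 v i j); rewrite gE addrC addKr => hd.
move=> hab; have := hd a.+1 b.+1; rewrite -mulrA coef_mulX coef_mulY => /(_ hab).
by rewrite addSn addnS.
Qed.

Definition dart_closed (P : darts -> Prop) := P (fun _ _ => 0) /\
  forall (a : R) g h, P g -> P h -> P (fun i j => rho i j a * g i j + h i j).

Lemma closed_sum P (I : Type) (r : seq I) (Q : pred I) (a : I -> R) (G : I -> darts) :
  dart_closed P -> (forall l, Q l -> P (G l)) ->
  P (fun i j => \sum_(l <- r | Q l) rho i j (a l) * G l i j).
Proof.
move=> [P0 PD] PG; elim: r => [|l r IH].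
  by rewrite (_ : (fun _ _ => _) = fun _ _ => 0) //; apply/funext => i; apply/funext => j; rewrite big_nil.
have [Ql|Ql] := boolP (Q l); last first.
  rewrite (_ : (fun _ _ => _) = fun i j => \sum_(l <- r | Q l) rho i j (a l) * G l i j) //.
  by apply/funext => i; apply/funext => j; rewrite big_cons (negPf Ql).
rewrite (_ : (fun _ _ => _) = fun i j => rho i j (a l) * G l i j + \sum_(l <- r | Q l) rho i j (a l) * G l i j).
  by apply: PD => //; exact: PG.
by apply/funext => i; apply/funext => j; rewrite big_cons Ql.
Qed.

Lemma closedD P g h : dart_closed P -> P g -> P h -> P (fun i j => g i j + h i j).
Proof.
move=> [_ PD] Pg Ph; have := PD 1 g h Pg Ph.
congr P; by apply/funext => i; apply/funext => j; rewrite rmorph1 mul1r.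
Qed.

Lemma closedM P (a : R) g : dart_closed P -> P g -> P (fun i j => rho i j a * g i j).
Proof.
move=> [P0 PD] Pg; have := PD a g _ Pg P0.
by congr P; apply/funext => i; apply/funext => j; rewrite addr0.
Qed.

Definition edge_dart i j : darts := fun a b =>
  if (a, b) == (i, j) then X * Y else if (a, b) == (j, i) then - (X * Y) else 0.

Lemma closed_edges P (h : darts) : dart_closed P ->
  (forall i j, e i j -> (i < j)%N -> P (edge_dart i j)) ->
  (forall i j, ~~ e i j -> h i j = 0) -> (forall i j, swapXY (h i j) = - h j i) ->
  P (fun i j => X * Y * h i j).
Proof.
move=> cP Pe h1 h2.
have := @closed_sum P _ (index_enum ('I_n * 'I_n)%type) (fun p => e p.1 p.2 && (p.1 < p.2)%N)
  (fun p => edge_lift e p.1 p.2 (h p.1 p.2)) (fun p => edge_dart p.1 p.2) cP.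
rewrite (_ : (fun _ _ => bigop.body _ _ _) = fun i j => X * Y * h i j).
  by apply; case=> i j /= /andP[]; exact: Pe.
apply/funext => a; apply/funext => b.
have [ab|nab] := boolP (e a b); last first.
  rewrite h1 // mulr0 big1 // => -[i j] /= /andP[ij _]; rewrite /edge_dart.
  case: eqP => [[ai bj]|_]; first by rewrite ai bj ij in nab.
  by case: eqP => [[ai bj]|_]; [rewrite ai bj e_sym ij in nab|rewrite mulr0].
case: (ltngtP a b) => [ltab|ltba|/val_inj abE]; last by rewrite abE e_irr in ab.
- rewrite (bigD1 (a, b)) /= ?ab // /edge_dart eqxx (rho_edge_liftK e_irr) //.
  rewrite big1 ?addr0 1?mulrC // => -[i j] /= /andP[/andP[ij ltij] neq].
  rewrite eq_sym (negPf neq); case: eqP => [[ai bj]|_]; last by rewrite mulr0.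
  by move: ltab; rewrite ai bj ltnNge ltnW.
have ba : e b a by rewrite e_sym.
rewrite (bigD1 (b, a)) /= ?ba // /edge_dart xpair_eqE (negPf (edge_neq e_irr ab)) /= eqxx.
rewrite -(rho_swap e_sym e_irr) (rho_edge_liftK e_irr) // h2.
rewrite big1 ?addr0 => [|[i j] /= /andP[/andP[ij ltij] neq]]; last first.
  rewrite (_ : ((a, b) == (j, i)) = false); last first.
    by apply: contraNF neq => /eqP[-> ->].
  by case: eqP => [[ai bj]|_]; [move: ltba; rewrite ai bj ltnNge ltnW|rewrite mulr0].
by rewrite mulrNN mulrC.
Qed.

Definition row_part i (v : 'M[k]_n) : 'M[k]_n := \matrix_(a, b) if a == i then v a b else 0.

Lemma row_part_starsp i v : v \in starsp -> row_part i v \in starsp.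
Proof.
move=> /mem_starsp[v1 v2]; apply/mem_starsp; split=> [a b ab|a].
  by rewrite mxE v1 // if_same.
by under eq_bigr do rewrite mxE; case: eqP => _; [exact: v2|rewrite big1].
Qed.

Lemma rho_var_l i j : e i j -> rho i j (x i) = X.
Proof. by move=> ij; rewrite rho_var /edge_var ij eqxx. Qed.

Lemma rho_var_r i j : e i j -> rho i j (x j) = Y.
Proof. by move=> ij; rewrite rho_var /edge_var ij eq_sym (negPf (edge_neq e_irr ij)) eqxx. Qed.

Lemma rho_var_other i j l : l != i -> l != j -> rho i j (x l) = 0.
Proof. by move=> li lj; rewrite rho_var /edge_var (negPf li) (negPf lj) if_same. Qed.

Lemma rhoXn i j (r : R) m : rho i j (r ^+ m) = rho i j r ^+ m.
Proof. exact: rmorphXn. Qed.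

Lemma rhoD i j (r r' : R) : rho i j (r + r') = rho i j r + rho i j r'.
Proof. exact: rmorphD. Qed.

Lemma rho_sum i j (I : Type) (s : seq I) (P : pred I) (F : I -> R) :
  rho i j (\sum_(l <- s | P l) F l) = \sum_(l <- s | P l) rho i j (F l).
Proof. exact: rmorph_sum. Qed.

Lemma row_partE i v a b : row_part i v a b = if a == i then v a b else 0.
Proof. by rewrite mxE. Qed.

(** Multiplication by a power of x_l raises the degree of the row at l, so pure powers come from
    degree 1. *)
Lemma axis_rows d v i j : e i j ->
  axis d.+1 v i j = \sum_l rho i j (x l ^+ d) * axis 1 (row_part l v) i j.
Proof.
move=> ij; have inj := edge_neq e_irr ij.
rewrite (bigD1 i) //= (bigD1 j) /= 1?eq_sym // big1 => [|l /andP[li lj]]; last first.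
  by rewrite /axis !row_partE eq_sym (negPf li) eq_sym (negPf lj) !polyC0 !mul0r subrr mulr0.
rewrite !rhoXn rho_var_l // rho_var_r // /axis !row_partE !eqxx (negPf inj) eq_sym (negPf inj).
rewrite !polyC0 !mul0r subr0 sub0r addr0 !expr1 mulrN mulrCA -exprSr; congr (_ - _).
by rewrite mulrCA -exprSr.
Qed.

Lemma axis_non_edge d v i j : v \in starsp -> ~~ e i j -> axis d v i j = 0.
Proof.
by move=> /mem_starsp[v1 _] ij; rewrite /axis !v1 // 1?e_sym // !polyC0 !mul0r subrr.
Qed.

(** The star function at i is x_i on the edge ij and -x_i on il; multiplying by x_j leaves x_i x_j
    on ij and kills il. *)
Lemma edge_dart_rows i j l : e i j -> e i l -> l != j ->
  edge_dart i j = fun a b => rho a b (x j) * axis 1 (delta_mx i j - delta_mx i l) a b.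
Proof.
move=> ij il lj; have inj := edge_neq e_irr ij; have inl := edge_neq e_irr il.
apply/funext => a; apply/funext => b; rewrite /edge_dart /axis !expr1.
have dE (c d : 'I_n) : (delta_mx i j - delta_mx i l : 'M[k]_n) c d =
    ((c == i) && (d == j))%:R - ((c == i) && (d == l))%:R by rewrite !mxE.
rewrite !dE !xpair_eqE; have [->|ai] := eqVneq a i.
  have [->|bj] := eqVneq b j.
    rewrite /= rho_var_r // (eq_sym j i) (negPf inj) (eq_sym j l) (negPf lj) /= !subr0 !polyC1 polyC0.
    by rewrite mul1r mul0r subr0 mulrC.
  rewrite (negPf inj) /= (_ : rho i b (x j) = 0) ?mul0r //.
  by rewrite rho_var_other // eq_sym.
rewrite /= !subrr !polyC0 mul0r sub0r.
have [->|aj] := eqVneq a j; last first.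
  rewrite /= andbF sub0r; have [->|bi] := eqVneq b i; last by rewrite /= oppr0 !polyC0 mul0r oppr0 mulr0.
  by rewrite (@rho_var_other a i j) ?mul0r // eq_sym.
have [->|bi] := eqVneq b i; last by rewrite /= subrr !polyC0 mul0r oppr0 mulr0.
have ji : e j i by rewrite e_sym.
by rewrite /= (eq_sym j l) (negPf lj) subr0 !polyC1 mul1r rho_var_l // mulrN.
Qed.

Lemma edge_dartC i j : i != j -> edge_dart j i = fun a b => rho a b (-1 : R) * edge_dart i j a b.
Proof.
move=> ij; apply/funext => a; apply/funext => b; rewrite rhoN1 mulN1r /edge_dart.
case: ((a, b) =P (j, i)) => [[-> ->]|_].
  by rewrite xpair_eqE eq_sym (negPf ij) opprK.
by case: eqP => _; rewrite ?oppr0.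
Qed.

Lemma closed_edge_dart P i j : dart_closed P -> (forall v, v \in starsp -> P (axis 1 v)) ->
  e i j -> P (edge_dart i j).
Proof.
move=> cP Pax ij; have inj := edge_neq e_irr ij.
have Prow a b l : e a b -> e a l -> l != b -> P (edge_dart a b).
  by move=> ab al lb; rewrite (edge_dart_rows ab al lb); apply/(closedM _ cP)/Pax/dart_starsp.
have [[l il lj]|[l jl li]] := exists_nonleaf e_conn n_ge3 ij; first exact: Prow il lj.
rewrite (edge_dartC (i := j)) 1?eq_sym //; apply: closedM => //; apply: Prow jl li.
by rewrite e_sym.
Qed.

(** That is, omega is generated in degrees 0 and 1. The mixed terms need a second edge at one end of
    each edge, which exists as n > 2. *)
Lemma model_ind P : dart_closed P -> (forall z, z \in cyclesp -> P (flat z)) ->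
  (forall v, v \in starsp -> P (axis 1 v)) -> forall g, omega_model g -> P g.
Proof.
move=> cP Pflat Pax g og.
have Pe i j : e i j -> (i < j)%N -> P (edge_dart i j) by move=> ij _; exact: closed_edge_dart.
have Phom d : P (fun i j => hpart d (g i j)).
  have oh := omega_model_hpart d og; have hd i j : bihom d%:Z (hpart d (g i j)) by exact: bihom_hpart.
  case: d oh hd => [|d] oh hd; first by have [z zc ->] := model_degree0 oh hd; exact: Pflat.
  have [v vs [h [h1 h2 gE]]] := model_degreeS oh hd.
  rewrite (_ : (fun i j => _) = fun i j => axis d.+1 v i j + X * Y * h i j); last first.
    by apply/funext => i; apply/funext => j; exact: gE.
  apply: closedD => //; last exact: closed_edges.
  rewrite (_ : axis d.+1 v = fun i j => \sum_l rho i j (x l ^+ d) * axis 1 (row_part l v) i j).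
    by apply: closed_sum => // l _; apply/Pax/row_part_starsp.
  apply/funext => i; apply/funext => j; have [ij|nij] := boolP (e i j); first exact: axis_rows.
  rewrite axis_non_edge // big1 // => l _.
  by rewrite (axis_non_edge _ (row_part_starsp l vs) nij) mulr0.
have [N NP] := choice (fun p : 'I_n * 'I_n => hpart_sum (g p.1 p.2)).
pose M := \max_p N p.
rewrite (_ : g = fun i j => \sum_(d < M) rho i j (1 : R) * hpart d (g i j)).
  by apply: closed_sum => // d _; exact: Phom.
apply/funext => i; apply/funext => j; have [N0 NE] := NP (i, j).
under eq_bigr do rewrite rmorph1 mul1r.
have NM : (N (i, j) <= M)%N by exact: leq_bigmax.
rewrite [LHS]NE /= (big_ord_widen _ (fun d => hpart d (g i j)) NM) [RHS](bigID (fun d : 'I_M => (d < N (i, j))%N)) /=.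
by rewrite [X in _ = _ + X]big1 ?addr0 // => d; rewrite -leqNgt => /N0.
Qed.

End Darts.

(** * Restriction of k[Delta] to lines, and the augmentation *)

Section Point.
Variables (k : fieldType) (n : nat) (e : rel 'I_n).
Hypotheses (e_sym : symmetric e) (e_irr : irreflexive e) (e_conn : connected e).
Hypothesis n_ge3 : (3 <= n)%N.
Local Notation R := (SRring k e).
Local Notation S := {poly {poly k}}.
Local Notation X := ('X%:P : S).
Local Notation Y := ('X : S).
Local Notation x := (SRvar k e).

(* Restriction to the line spanned by the point with coordinates a at i, b at j
   and 0 elsewhere. *)
Definition edge_line (a b : k) : S -> {poly k} :=
  fun p => (map_poly (comp_poly (a *: 'X)) p).[b *: 'X].

Lemma edge_line_zmod a b : zmod_morphism (edge_line a b).
Proof. by move=> p q; rewrite /edge_line rmorphB hornerD hornerN. Qed.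

Lemma edge_line_monoid a b : monoid_morphism (edge_line a b).
Proof.
split; first by rewrite /edge_line rmorph1 hornerC.
by move=> p q; rewrite /edge_line rmorphM hornerM.
Qed.

HB.instance Definition _ a b := GRing.isZmodMorphism.Build S {poly k} (edge_line a b) (edge_line_zmod a b).
HB.instance Definition _ a b := GRing.isMonoidMorphism.Build S {poly k} (edge_line a b) (edge_line_monoid a b).

Lemma edge_lineB a b p q : edge_line a b (p - q) = edge_line a b p - edge_line a b q.
Proof. exact: rmorphB. Qed.

Lemma edge_lineD a b p q : edge_line a b (p + q) = edge_line a b p + edge_line a b q.
Proof. exact: rmorphD. Qed.

Lemma edge_line0 a b : edge_line a b 0 = 0.
Proof. exact: rmorph0. Qed.

Lemma edge_lineM a b p q : edge_line a b (p * q) = edge_line a b p * edge_line a b q.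
Proof. exact: rmorphM. Qed.

Lemma edge_lineC a b (c : k) : edge_line a b c%:P%:P = c%:P.
Proof. by rewrite /edge_line map_polyC /= hornerC comp_polyC. Qed.

Lemma edge_lineX a b : edge_line a b X = a *: 'X.
Proof. by rewrite /edge_line map_polyC /= hornerC comp_polyX. Qed.

Lemma edge_lineY a b : edge_line a b Y = b *: 'X.
Proof. by rewrite /edge_line map_polyX hornerX. Qed.

Lemma exists_line_eval i j a b : exists ev : {rmorphism R -> {poly k}}, forall r, ev r = edge_line a b (rho i j r).
Proof.
pose f := edge_line a b \o @rho k n e i j.
have fz : zmod_morphism f by move=> r s; rewrite /f /= rhoB rmorphB.
have fm : monoid_morphism f by split=> [|r s]; rewrite /f /= ?rmorph1 // rhoM rmorphM.
pose M0 := GRing.isZmodMorphism.Build R {poly k} f fz.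
pose M1 := GRing.isMonoidMorphism.Build R {poly k} f fm.
pose g : {rmorphism R -> {poly k}} := HB.pack f M0 M1.
by exists g.
Qed.

Lemma line_eval_surj (ev : {rmorphism R -> {poly k}}) (y : R) :
  (forall c, ev c%:A = c%:P) -> ev y = 'X -> forall q, exists r, ev r = q.
Proof.
move=> evC evy; elim/poly_ind => [|q c [r rE]]; first by exists 0; exact: rmorph0.
by exists (r * y + c%:A); rewrite rmorphD rmorphM rE evC evy.
Qed.

(** Modulo P every variable is a scalar multiple of y, so r is congruent to the polynomial [ev r]
    evaluated at y. *)
Lemma line_eval_ker (ev : {rmorphism R -> {poly k}}) (P : set R) (y : R) (p : 'I_n -> k) :
  prime_ideal P -> (forall c, ev c%:A = c%:P) -> (forall l, ev (x l) = p l *: 'X) ->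
  (forall l, P (x l - p l *: y)) -> forall r, ev r = 0 -> P r.
Proof.
move=> [P0 PD PM _ _] evC evx Px r er.
have PN s : P s -> P (- s) by move=> Ps; rewrite -mulN1r; exact: PM.
have := @SR_ind k n e (fun r => P (r - horner_alg y (ev r))).
move=> h; have := h _ _ _ _ r; rewrite er rmorph0 subr0; apply=> {h r er}.
- by move=> c; rewrite evC horner_algC subrr.
- move=> l; rewrite evx; have -> : horner_alg y (p l *: 'X) = p l *: y.
    by rewrite -mul_polyC rmorphM /= horner_algC horner_algX mulr_algl.
  exact: Px.
- by move=> r s Pr Ps; rewrite !rmorphD opprD addrACA; exact: PD.
- move=> r s Pr Ps; rewrite !rmorphM.
  rewrite (_ : _ - _ = r * (s - horner_alg y (ev s)) + horner_alg y (ev s) * (r - horner_alg y (ev r))).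
    by apply: PD; apply: PM.
  by rewrite !mulrBr (mulrC (horner_alg y (ev s)) r) addrA subrK; congr (_ - _); exact: mulrC.
Qed.

Lemma rho_const i j (r : R) : e i j -> exists c, forall a b, e a b -> (rho a b r)`_0`_0 = c.
Proof.
move=> ij; exists (rho i j r)`_0`_0 => a b ab; move: r.
apply: SR_ind => [c|l|r s rr ss|r s rr ss].
- by rewrite !rho_alg !coefC.
- rewrite !rho_var /edge_var ij ab /=.
  by do 4!(case: ifP => _; rewrite ?coefC ?coefX ?coef0 //=).
- by rewrite !rhoD !coefD rr ss.
- by rewrite !rhoM !coef0M rr ss.
Qed.

Lemma exists_augmentation i j : e i j -> exists eps : {rmorphism R -> k}, 
  (forall a b r, e a b -> (rho a b r)`_0`_0 = eps r).
Proof.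
move=> ij; pose f (r : R) := (rho i j r)`_0`_0.
have fz : zmod_morphism f by move=> r s; rewrite /f rhoB !coefB.
have fm : monoid_morphism f by split=> [|r s]; rewrite /f ?rmorph1 ?coef1 ?coefC //= rhoM !coef0M.
pose M0 := GRing.isZmodMorphism.Build R k f fz.
pose M1 := GRing.isMonoidMorphism.Build R k f fm.
pose g : {rmorphism R -> k} := HB.pack f M0 M1.
exists g => a b r ab; have [c cE] := rho_const r ij.
by rewrite cE // -(cE i j).
Qed.

End Point.

Lemma horner_linear (k : fieldType) (A : comAlgType k) (a b : A) (c d : k) :
  ((horner_alg a c%:P)%:P * (horner_alg a 'X)%:P - (horner_alg a d%:P)%:P * 'X).[b] = c *: a - d *: b.
Proof. by rewrite hornerD hornerN !hornerM !hornerC hornerX !horner_algC horner_algX !mulr_algl. Qed.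

(** * The cokernel C of w in an abstract copy W of omega(-a), and its Krull dimension *)

Section Sequence.
Variables (k : fieldType) (n : nat) (e : rel 'I_n).
Hypotheses (e_sym : symmetric e) (e_irr : irreflexive e) (e_conn : connected e).
Hypothesis n_ge3 : (3 <= n)%N.
Local Notation R := (SRring k e).
Local Notation S := {poly {poly k}}.
Local Notation X := ('X%:P : S).
Local Notation x := (SRvar k e).
Local Notation darts := ('I_n -> 'I_n -> S).
Local Notation omega_model := (@omega_model k n e).
Local Notation cyclesp := (@cyclesp k n e).
Local Notation starsp := (@starsp k n e).

Variables (W : gmod R) (Psi : W -> darts) (d0 : nat).
Hypotheses (Psi_lin : forall a u v i j, Psi (a *: u + v) i j = rho i j a * Psi u i j + Psi v i j)
  (Psi_inj : injective Psi) (Psi_model : forall u, omega_model (Psi u))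
  (Psi_surj : forall g, omega_model g -> exists u, Psi u = g)
  (Psi_part : forall d u, part W d u <-> forall i j, bihom (d + d0%:Z) (Psi u i j)).

Lemma Psi0 i j : Psi 0 i j = 0.
Proof.
have := Psi_lin 1 0 0 i j; rewrite scaler0 addr0 rmorph1 mul1r.
by move=> /(congr1 (fun t => t - Psi 0 i j)); rewrite addrK subrr.
Qed.

Lemma PsiZ a u i j : Psi (a *: u) i j = rho i j a * Psi u i j.
Proof. by rewrite -[a *: u]addr0 Psi_lin Psi0 addr0. Qed.

Lemma PsiD u v i j : Psi (u + v) i j = Psi u i j + Psi v i j.
Proof. by rewrite -[u]scale1r Psi_lin rmorph1 mul1r scale1r. Qed.

Lemma PsiB u v i j : Psi (u - v) i j = Psi u i j - Psi v i j.
Proof. by rewrite addrC -scaleN1r Psi_lin rhoN1 mulN1r addrC. Qed.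

Lemma Psi_sum (I : Type) (r : seq I) (P : pred I) (F : I -> W) i j :
  Psi (\sum_(l <- r | P l) F l) i j = \sum_(l <- r | P l) Psi (F l) i j.
Proof. by apply: (big_morph (fun u => Psi u i j)) => [u v|]; [exact: PsiD|exact: Psi0]. Qed.

Lemma Psi_eq u v : (forall i j, e i j -> Psi u i j = Psi v i j) -> u = v.
Proof.
move=> uv; apply: Psi_inj; apply/funext => i; apply/funext => j.
have [ij|nij] := boolP (e i j); first exact: uv.
by have [[-> // _ _] [-> // _ _]] := conj (Psi_model u) (Psi_model v).
Qed.

Section Grading.
Hypothesis W_neg : forall (d : int) u, (d < 0)%R -> part W d u -> u = 0.

Lemma exists_grading_hpart : exists pr, @graded_by k R W pr /\
  forall d u i j, Psi (pr d u) i j = hpart (d + d0) (Psi u i j).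
Proof.
have [pr prE] := choice (fun p : nat * W => Psi_surj (omega_model_hpart (p.1 + d0) (Psi_model p.2))).
exists (fun d u => pr (d, u)); split; last by move=> d u i j; rewrite prE.
split.
- move=> j; split; first by apply/Psi_part => a b; rewrite Psi0; exact: bihom0.
  by move=> u v /Psi_part ju /Psi_part jv; apply/Psi_part => a b; rewrite PsiB; exact: bihomB.
- move=> i j a u ai /Psi_part ju; apply/Psi_part => b c; rewrite PsiZ.
  have [bc|nbc] := boolP (e b c).
    rewrite -addrA; exact: (bihomM (bihom_rho e_irr bc ai) (ju b c)).
  by have [-> // _ _] := Psi_model u; rewrite mulr0; exact: bihom0.
- move=> d u v; apply: Psi_eq => i j _; rewrite PsiB !prE /= PsiB hpartD.
  by rewrite hpartN.
- by move=> d u; apply/Psi_part => i j; rewrite prE /= -PoszD; exact: bihom_hpart.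
- move=> d u /Psi_part ud; apply: Psi_eq => i j _; rewrite prE /= hpart_id // PoszD; exact: ud.
- move=> d d' u /Psi_part ud dd'; apply: Psi_eq => i j _; rewrite prE /= Psi0.
  apply: (@hpart_homog_neq _ (d + d0)); last by rewrite eqn_add2r.
  by rewrite PoszD; exact: ud.
- exact: W_neg.
move=> u; have [N NP] := choice (fun p : 'I_n * 'I_n => hpart_sum (Psi u p.1 p.2)).
pose M := \max_p N p.
have hz i j d : (M <= d)%N -> hpart d (Psi u i j) = 0.
  by move=> Md; apply: (NP (i, j)).1; apply: leq_trans Md; exact: leq_bigmax.
exists M; split=> [d Md|].
  by apply: Psi_eq => i j _; rewrite prE /= Psi0 hz // (leq_trans Md) // leq_addr.
(* Model degrees below [d0] are negative degrees of W, hence 0; the projections of W start at model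
   degree [d0]. *)
have low c i j : (c < d0)%N -> hpart c (Psi u i j) = 0.
  move=> cd; have [v vE] := Psi_surj (omega_model_hpart c (Psi_model u)).
  have v0 : v = 0.
    apply: (W_neg (d := c%:Z - d0%:Z)); first by rewrite subr_lt0.
    by apply/Psi_part => a b; rewrite vE subrK; exact: bihom_hpart.
  by have := congr1 (fun g : darts => g i j) vE; rewrite v0 Psi0.
apply: Psi_eq => i j _; rewrite Psi_sum.
under eq_bigr do rewrite prE /=.
have [_ NE] := NP (i, j).
have NM : (N (i, j) <= M + d0)%N by apply: (leq_trans _ (leq_addr _ _)); exact: leq_bigmax.
rewrite [LHS]NE (big_ord_widen _ (fun d => hpart d (Psi u i j)) NM) /=.
rewrite (_ : \sum_(d < M) _ = \sum_(d < M + d0) hpart d (Psi u i j)).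
  rewrite [RHS](bigID (fun d : 'I_(M + d0) => (d < N (i, j))%N)) /=.
  by rewrite [X in _ = _ + X]big1 ?addr0 // => d; rewrite -leqNgt => /((NP (i, j)).1).
rewrite addnC big_split_ord /= [X in _ = X + _]big1 ?add0r => [|d _]; last exact: low.
by apply: eq_bigr => d _; rewrite addnC.
Qed.

Lemma exists_grading : exists pr, @graded_by k R W pr.
Proof. by have [pr [pr_gr _]] := exists_grading_hpart; exists pr. Qed.

End Grading.

Variables (C : gmod R) (psi : {linear W -> C}) (w : darts) (m : 'M[k]_n).
Hypotheses (psi_surj : range psi = [set: C]) (psi_morph : gmorph psi) (C_graded : graded C).
Hypothesis psi_ker : forall u, psi u = 0 <-> exists r : R, forall i j, Psi u i j = rho i j r * w i j.
Hypothesis w_shape : ((d0 = 0)%N /\ w = flat m /\ m \in cyclesp) \/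
  ((d0 = 1)%N /\ w = axis 1 m /\ m \in starsp).
Hypothesis w_neq0 : forall i j, e i j -> w i j != 0.

Lemma d0_le1 : (d0 <= 1)%N.
Proof. by case: w_shape => -[-> _]. Qed.

Lemma w_model : omega_model w.
Proof. by case: w_shape => -[_ [-> mE]]; [exact: flat_model|exact: axis_model]. Qed.

Lemma w_bihom i j : bihom d0%:Z (w i j).
Proof. by case: w_shape => -[-> [-> _]]; [exact: flat_bihom|exact: axis_bihom]. Qed.

Lemma w_coef0 i j : (w i j)`_0 = (m i j)%:P * 'X ^+ d0.
Proof.
apply/polyP => a; rewrite coefCM coefXn.
case: w_shape => -[-> [-> _]]; rewrite ?coef_flat ?coef_axis eqxx andbT.
  by case: eqP; rewrite ?mulr1 ?mulr0.
by rewrite andbF subr0; case: eqP; rewrite ?mulr1 ?mulr0.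
Qed.

Lemma psi_surjP c : exists u, psi u = c.
Proof.
have : range psi c by rewrite psi_surj.
by case=> u _ <-; exists u.
Qed.

(** On the edge ij one has w_ij u_ij = u_ij w_ij, and x_i x_j kills all other edges; so the product
    with u is a multiple of w. *)
Lemma edge_ann i j (c : C) : e i j -> (x i * x j * edge_lift e i j (w i j)) *: c = 0.
Proof.
move=> ij; have [u <-] := psi_surjP c; rewrite -linearZ; apply/psi_ker.
have [p1 p2 p3] := Psi_model u; have [w1 w2 w3] := w_model.
exists (x i * x j * edge_lift e i j (Psi u i j)) => a b; rewrite PsiZ !(rhoM _ _ (x i * x j)).
have [ab|nab] := boolP (e a b); last by rewrite (p1 _ _ nab) (w1 _ _ nab) !mulr0.
have ji : e j i by rewrite e_sym.
have [[<- <-]|ab1] := eqVneq (i, j) (a, b).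
  by rewrite !(rho_edge_liftK e_irr) // -!mulrA; congr (_ * _); rewrite mulrC.
have [[<- <-]|ab2] := eqVneq (i, j) (b, a).
  rewrite -![rho j i (edge_lift _ _ _ _)](rho_swap e_sym e_irr) !(rho_edge_liftK e_irr) //.
  by rewrite w2 p2 -!mulrA !mulNr; congr (_ * - _); rewrite mulrC.
by rewrite (rho_edge_var2 k e_irr ab ij ab1 ab2) !mul0r.
Qed.

Lemma edge_lift_scalar i j (c : k) : edge_lift e i j c%:P%:P = c%:A.
Proof. by rewrite /edge_lift map_polyC /= hornerC horner_algC. Qed.

Lemma edge_lift_axis i j : edge_lift e i j (axis 1 m i j) = m i j *: x i - m j i *: x j.
Proof.
rewrite /edge_lift /axis !expr1 rmorphB !rmorphM /= !map_polyC map_polyX /=.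
exact: horner_linear.
Qed.

(** C is supported on lines through the origin. A prime over its annihilator that misses both
    variables of an edge contains w_ij: impossible for a nonzero constant, while a linear form makes
    x_j proportional to x_i. Otherwise the prime contains all variables but at most one. *)
Lemma prime_line (P : set R) : prime_ideal P -> ann C `<=` P ->
  exists ev : {rmorphism R -> {poly k}}, (forall q, exists r, ev r = q) /\ forall r, ev r = 0 -> P r.
Proof.
move=> Pp annP; have [P0 PD PM P1 Pprime] := Pp.
have PZ c r : P r -> P (c *: r) by move=> Pr; rewrite -[c *: r]mulr_algl; exact: PM.
have PN r : P r -> P (- r) by move=> Pr; rewrite -mulN1r; exact: PM.
have line i j (a b : k) y : e i j -> (a = 1 \/ b = 1) -> (forall l, l != i -> l != j -> P (x l)) ->
    P (x i - a *: y) -> P (x j - b *: y) ->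
    exists ev : {rmorphism R -> {poly k}}, (forall q, exists r, ev r = q) /\ forall r, ev r = 0 -> P r.
  move=> ij ab Pl Pi Pj; have inj := edge_neq e_irr ij.
  have [ev evE] := @exists_line_eval k n e i j a b.
  have evC c : ev c%:A = c%:P by rewrite evE rho_alg edge_lineC.
  pose p l := if l == i then a else if l == j then b else 0.
  have evx l : ev (x l) = p l *: 'X.
    rewrite evE rho_var /edge_var ij /p /=; case: eqP => _; first exact: edge_lineX.
    by case: eqP => _; [exact: edge_lineY|rewrite rmorph0 scale0r].
  exists ev; split.
    case: ab => [a1|b1].
      by apply: (@line_eval_surj k n e ev (x i)) => //; rewrite evx /p eqxx a1 scale1r.
    by apply: (@line_eval_surj k n e ev (x j)) => //; rewrite evx /p eq_sym (negPf inj) eqxx b1 scale1r.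
  apply: (line_eval_ker (y := y) Pp evC evx) => l; rewrite /p.
  have [->//|li] := eqVneq l i; have [->//|lj] := eqVneq l j.
  by rewrite scale0r subr0; exact: Pl.
have [[i [j [ij [nPi nPj]]]]|noedge] := pselect (exists i j, e i j /\ ~ P (x i) /\ ~ P (x j)).
  have inj := edge_neq e_irr ij.
  have Pij r : P (x i * x j * r) -> P r.
    by move=> /Pprime[/Pprime[]|].
  have Pl l : l != i -> l != j -> P (x l).
    move=> li lj; apply: Pij; rewrite (SRvar3 k e_irr e_conn n_ge3 inj) 1?eq_sym // mul0r.
  have Pw : P (edge_lift e i j (w i j)) by apply/Pij/annP => c; exact: edge_ann.
  have [[_ [wE _]]|[_ [wE _]]] := w_shape.
    exfalso; have := w_neq0 ij; move: Pw; rewrite wE /flat edge_lift_scalar => Pm.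
    rewrite polyC_eq0 polyC_eq0 => m0; apply: P1.
    by rewrite -[1](scale1r (1 : R)) -(mulVf m0) -scalerA; exact: PZ.
  have wl := w_neq0 ij; move: Pw wl; rewrite wE edge_lift_axis => Pw wl.
  (* Otherwise w_ij would be a nonzero multiple of x_i, which is not in P. *)
  have mi : m j i != 0.
    apply: contra_not_neq nPi => m0; move: Pw wl; rewrite /axis m0 scale0r subr0 !polyC0 mul0r subr0 => Pw.
    rewrite mulf_eq0 negb_or !polyC_eq0 => /andP[mij _].
    by rewrite -[x i]scale1r -(mulVf mij) -scalerA; exact: PZ.
  apply: (line i j 1 (m i j / m j i) (x i) ij) => //; first by left.
    by rewrite scale1r subrr.
  rewrite (_ : _ - _ = - ((m j i)^-1 *: (m i j *: x i - m j i *: x j))).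
    exact/PN/PZ.
  by rewrite scalerBr !scalerA mulVf // scale1r opprB (mulrC (m i j)).
have [i Pi] : exists i, forall l, l != i -> P (x l).
  have [[i nPi]|allP] := pselect (exists i, ~ P (x i)); last first.
    have i0 : 'I_n by exact: (Ordinal (leq_trans (isT : (0 < 3)%N) n_ge3)).
    by exists i0 => l _; apply: contrapT => nPl; apply: allP; exists l.
  exists i => l li; apply: contrapT => nPl; have [il|nil] := boolP (e i l).
    by apply: noedge; exists i, l.
  have : P (x i * x l).
    rewrite (_ : x i * x l = 0) //; apply: (rho_inj e_irr e_conn n_ge3) => a b ab.
    rewrite rhoM !rho_var /edge_var ab /=; have [ia|ia] := eqVneq i a.
      rewrite -ia (negPf li); case: eqP => [lb|_]; last by rewrite mulr0.
      by rewrite ia lb ab in nil.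
    have [ib|ib] := eqVneq i b; last by rewrite mul0r.
    have [la|la] := eqVneq l a; last by rewrite -ib (negPf li) mulr0.
    by rewrite ib la e_sym ab in nil.
  by move=> /Pprime[].
have [j ij] := exists_neighbour e_conn n_ge3 i.
apply: (line i j 1 0 (x i) ij) => //; first by left.
- by move=> l li _; exact: Pi.
- by rewrite scale1r subrr.
- by rewrite scale0r subr0; apply: Pi; rewrite eq_sym (edge_neq e_irr ij).
Qed.

(** The x_i-axis lies in the support of C: if r kills the class of the row of v at i and does not
    vanish on the axis, a comparison of coefficients there makes this row proportional to that of
    m. *)
Lemma krull_dim_axis i (v : 'M[k]_n) : v \in starsp -> ~ (exists c, forall j, v i j = c * m i j) ->
  krull_dim C = 1%N.
Proof.
move=> vs nprop; apply: krull_dim1; first exact: prime_line.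
have [j ij] := exists_neighbour e_conn n_ge3 i.
have [ev evE] := @exists_line_eval k n e i j 1 0.
exists ev; split.
  apply: (@line_eval_surj k n e ev (x i)) => [c|]; first by rewrite evE rho_alg edge_lineC.
  by rewrite evE rho_var_l // edge_lineX scale1r.
move=> r annr; rewrite evE.
have [u uE] := Psi_surj (axis_model e_sym 0 (row_part_starsp i vs)).
have /psi_ker[s sE] : psi (r *: u) = 0 by rewrite linearZ; exact: annr.
have AB b : e i b -> (rho i j r)`_0 * ((v i b)%:P * 'X) = (rho i j s)`_0 * ((m i b)%:P * 'X ^+ d0).
  move=> ib; rewrite -w_coef0 (rho_axis r ij ib) (rho_axis s ij ib) -!coef0M -sE PsiZ uE.
  rewrite !coef0M; congr (_ * _); apply/polyP => a; rewrite coef_axis !row_partE eqxx andbT andbF subr0.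
  by rewrite coefCM coefX eqxx; case: eqP; rewrite ?mulr1 ?mulr0.
have lineE (p : S) : edge_line 1 0 p = p`_0.
  rewrite /edge_line scale0r scale1r horner_coef0 coef_map_id0 ?comp_poly0 //; exact: comp_polyXr.
rewrite lineE; apply/eqP; apply: contraT => A0; exfalso; apply: nprop.
have [p pA] : exists p, (rho i j r)`_0`_p != 0.
  by exists (size (rho i j r)`_0).-1; rewrite -/(lead_coef _) lead_coef_eq0.
(* On the axis u is v_ib x_i and w is m_ib x_i^d0, so x_i^p in r is matched by x_i^(p + 1 - d0) in
   s. *)
pose B := (rho i j s)`_0; pose q := B`_(p.+1 - d0).
have [v1 _] := elimT (mem_starsp _ _) vs.
exists (q / (rho i j r)`_0`_p) => b; have [ib|nib] := boolP (e i b); last first.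
  have -> : m i b = 0.
    by case: w_shape => [[_ [_ /mem_cyclesp[m1 _ _]]]|[_ [_ /mem_starsp[m1 _]]]]; exact: m1.
  by rewrite v1 // mulr0.
have := congr1 (fun t : {poly k} => t`_p.+1) (AB b ib).
rewrite 2!(mulrCA _ _%:P) 2!coefCM coefMX coefMXn /= ltnNge (leq_trans d0_le1) //= => E.
by apply: (mulIf pA); rewrite E mulrAC mulrC divfK.
Qed.

(** The line is the zero set of w_ij = m_ij x_i - m_ji x_j. The row of m at i is m_ij x_i there,
    which is nonzero, so every r that annihilates C vanishes on the line. *)
Lemma krull_dim_edge i j : e i j -> w = axis 1 m -> m \in starsp -> m i j != 0 -> m j i != 0 ->
  krull_dim C = 1%N.
Proof.
move=> ij wE ms mij mji; apply: krull_dim1; first exact: prime_line.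
have [ev evE] := @exists_line_eval k n e i j 1 (m i j / m j i).
exists ev; split.
  apply: (@line_eval_surj k n e ev (x i)) => [c|]; first by rewrite evE rho_alg edge_lineC.
  by rewrite evE rho_var_l // edge_lineX scale1r.
move=> r annr; rewrite evE.
have [u uE] := Psi_surj (axis_model e_sym 0 (row_part_starsp i ms)).
have /psi_ker[s sE] : psi (r *: u) = 0 by rewrite linearZ; exact: annr.
have := congr1 (edge_line 1 (m i j / m j i)) (sE i j).
have jni : (j == i) = false by rewrite eq_sym (negPf (edge_neq e_irr ij)).
rewrite PsiZ uE wE /axis !row_partE eqxx jni !expr1.
rewrite !polyC0 mul0r subr0.
rewrite !edge_lineM edge_lineB !edge_lineM !edge_lineC edge_lineX edge_lineY scale1r.
rewrite [X in _ = _ * (_ - X)](_ : _ = (m i j)%:P * 'X).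
  rewrite subrr mulr0 => /eqP; rewrite mulf_eq0 => /orP[/eqP//|].
  by rewrite mulf_eq0 polyC_eq0 (negPf mij) polyX_eq0.
by rewrite -mul_polyC mulrA -polyCM mulrCA mulfV // mulr1.
Qed.

End Sequence.

(** * A linear form regular on C, and the parts of C in positive degrees *)

Section CokernelLinearForm.
Variables (k : fieldType) (n : nat) (e : rel 'I_n).
Hypotheses (e_sym : symmetric e) (e_irr : irreflexive e) (e_conn : connected e).
Hypothesis n_ge3 : (3 <= n)%N.
Local Notation R := (SRring k e).
Local Notation S := {poly {poly k}}.
Local Notation X := ('X%:P : S).
Local Notation Y := ('X : S).
Local Notation x := (SRvar k e).
Local Notation darts := ('I_n -> 'I_n -> S).
Local Notation omega_model := (@omega_model k n e).
Local Notation cyclesp := (@cyclesp k n e).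
Local Notation starsp := (@starsp k n e).

Local Notation dart_closed := (@dart_closed k n e).
Local Notation edge_dart := (@edge_dart k n).

Variables (W : gmod R) (Psi : W -> darts) (d0 : nat).
Hypotheses (Psi_lin : forall a u v i j, Psi (a *: u + v) i j = rho i j a * Psi u i j + Psi v i j)
  (Psi_inj : injective Psi) (Psi_model : forall u, omega_model (Psi u))
  (Psi_surj : forall g, omega_model g -> exists u, Psi u = g)
  (Psi_part : forall d u, part W d u <-> forall i j, bihom (d + d0%:Z) (Psi u i j)).
Variables (C : gmod R) (psi : {linear W -> C}) (w : darts) (m : 'M[k]_n).
Hypotheses (psi_surj : range psi = [set: C]) (psi_morph : gmorph psi) (C_graded : graded C).
Hypothesis psi_ker : forall u, psi u = 0 <-> exists r : R, forall i j, Psi u i j = rho i j r * w i j.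
Hypothesis w_shape : ((d0 = 0)%N /\ w = flat m /\ m \in cyclesp) \/
  ((d0 = 1)%N /\ w = axis 1 m /\ m \in starsp).
Hypothesis w_neq0 : forall i j, e i j -> w i j != 0.
Local Notation PsiZ := (PsiZ Psi_lin).
Local Notation PsiB := (PsiB Psi_lin).
Local Notation Psi_eq := (Psi_eq Psi_inj Psi_model).
Local Notation psi_surjP := (psi_surjP psi_surj).
Local Notation w_model := (w_model e_sym w_shape).
Local Notation w_bihom := (w_bihom w_shape).
Local Notation d0_le1 := (d0_le1 w_shape).
Hypothesis W_neg : forall (d : int) u, (d < 0)%R -> part W d u -> u = 0.
Local Notation exists_grading_W := (exists_grading e_irr Psi_lin Psi_inj Psi_model Psi_surj Psi_part W_neg).
Section LinearForm.
Variable fl : 'I_n -> k.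
Hypothesis fl_neq0 : forall l, fl l != 0.
Hypothesis fw : forall i j, e i j -> (w i j).[- (fl i / fl j) *: 'X] != 0.
Let f : R := \sum_l (fl l)%:A * x l.

Lemma rho_linear_form i j : e i j -> rho i j f = (fl i)%:P%:P * X + (fl j)%:P%:P * Y.
Proof.
move=> ij; have inj := edge_neq e_irr ij; rewrite /f rho_sum.
rewrite (bigD1 i) //= (bigD1 j) /= 1?eq_sym // big1 ?addr0 => [|l /andP[li lj]].
  by rewrite (rhoM _ _ (fl i)%:A) (rhoM _ _ (fl j)%:A) !rho_alg rho_var_l // rho_var_r.
by rewrite rhoM rho_var_other // mulr0.
Qed.

Lemma rho_f_neq0 i j : e i j -> rho i j f != 0.
Proof.
move=> ij; rewrite rho_linear_form //; apply/eqP => /(congr1 (edge_line 1 0)).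
rewrite edge_lineD edge_line0 !edge_lineM !edge_lineC edge_lineX edge_lineY scale0r mulr0 addr0 scale1r => /eqP.
by rewrite mulf_eq0 polyC_eq0 polyX_eq0 orbF (negPf (fl_neq0 i)).
Qed.

Lemma linear_form_regular : regular_on f (gself R).
Proof.
move=> r fr; apply: (rho_inj e_irr e_conn n_ge3) => i j ij.
have := congr1 (rho i j) (fr : f * r = 0); rewrite rhoM rmorph0 => /eqP.
by rewrite mulf_eq0 (negPf (rho_f_neq0 ij)) => /eqP.
Qed.

(** The linear form is prime, and the condition on p says that p does not vanish on its line of
    zeros. *)
Lemma linear_form_factor (a b : k) (h q p : S) : b != 0 -> (a%:P%:P * X + b%:P%:P * Y) * h = q * p ->
  p.[- (a / b) *: 'X] != 0 -> exists q', q = (a%:P%:P * X + b%:P%:P * Y) * q'.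
Proof.
move=> b0; set t := - (a / b) *: 'X.
have -> : a%:P%:P * X + b%:P%:P * Y = b%:P%:P * (Y - t%:P).
  rewrite mulrBr addrC; congr (_ + _); rewrite -!polyCM -polyCN; congr polyC.
  by rewrite /t -mul_polyC mulrA -polyCM mulrN (mulrC b) divfK // polyCN mulNr opprK.
move=> E pt; have : root q t.
  have := congr1 (fun s : S => s.[t]) E; rewrite !hornerM hornerXsubC subrr mulr0 mul0r => /esym/eqP.
  by rewrite mulf_eq0 (negPf pt) orbF.
move=> /factor_theorem[q' ->]; exists (b^-1%:P%:P * q').
by rewrite mulrACA -!polyCM mulfV // mul1r mulrC.
Qed.

(** If f u = r w, then f divides r on every edge, being coprime to w there. The quotients are
    compatible and glue to s with u = s w. *)
Lemma linear_form_regular_quotient : regular_on f C.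
Proof.
move=> c; have [u <-] := psi_surjP c; rewrite -linearZ => /psi_ker[r rE]; apply/psi_ker.
have qex (p : 'I_n * 'I_n) : exists q, e p.1 p.2 -> rho p.1 p.2 r = rho p.1 p.2 f * q.
  case: p => i j /=; have [ij|] := boolP (e i j); last by exists 0.
  have := rE i j; rewrite PsiZ rho_linear_form // => E.
  by have [q qE] := linear_form_factor (fl_neq0 j) E (fw ij); exists q.
have [q qE] := choice qex.
have fI i j : e i j -> injective ( *%R (rho i j f)) by move=> ij; apply/mulfI/rho_f_neq0.
have [i j ij|i j l ij il|s sE] := @rho_compat k n e e_sym e_irr e_conn n_ge3 (fun i j => q (i, j)).
- have ji : e j i by rewrite e_sym.
  apply: (fI _ _ ji); rewrite -(qE (j, i)) //= -(rho_swap e_sym e_irr i j f) -rmorphM /=.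
  by rewrite -(qE (i, j)) // (rho_swap e_sym e_irr).
- have fi : (fl i)%:P * 'X != 0 :> {poly k} by rewrite mulf_eq0 polyC_eq0 polyX_eq0 negb_or fl_neq0.
  have f0 b : e i b -> (rho i b f)`_0 = (fl i)%:P * 'X.
    by move=> ib; rewrite rho_linear_form // coefD !coefCM coefC coefX /= mulr0 addr0.
  apply: (mulfI fi); rewrite -{1}(f0 j ij) -{1}(f0 l il) -!coef0M.
  by rewrite -(qE (i, j)) // -(qE (i, l)) //; exact: rho_axis.
exists s => i j; have [ij|nij] := boolP (e i j).
  by apply: (fI _ _ ij); rewrite -PsiZ rE sE // mulrA -(qE (i, j)).
have [p1 _ _] := Psi_model u; have [w1 _ _] := w_model.
by rewrite p1 // w1 // mulr0.
Qed.

(* The preimage of f C in the model. *)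
Definition Nf (g : darts) := exists (y : darts) (r : R), omega_model y /\
  forall i j, g i j = rho i j f * y i j + rho i j r * w i j.

Lemma Nf_closed : dart_closed Nf.
Proof.
split.
  exists (fun _ _ => 0), 0; split; last by move=> i j; rewrite rmorph0 mulr0 mul0r addr0.
  by split=> // [i j|i]; rewrite ?rmorph0 ?oppr0 // big1 // => j _; rewrite coef0.
move=> a g h [y [r [oy gE]]] [z [s [oz hE]]].
exists (fun i j => rho i j a * y i j + z i j), (a * r + s); split.
  exact: omega_modelD (omega_modelM e_sym e_irr e_conn n_ge3 a oy) oz.
move=> i j; rewrite gE hE rhoD rhoM !mulrDr mulrDl !mulrA addrACA.
by rewrite (mulrC (rho i j a) (rho i j f)).
Qed.

Lemma axis_lin d (c : k) (u v : 'M[k]_n) i j :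
  axis d (c *: u + v) i j = c%:P%:P * axis d u i j + axis d v i j.
Proof.
by rewrite /axis !mxE !polyCD !polyCM !mulrDl mulrBr !mulrA opprD addrACA.
Qed.

Hypothesis edge_Nf : forall i j, e i j -> Nf (edge_dart i j).

(** Dividing the row at i by the coefficient of x_i in f gives v' such that f [axis d.+1 v'] has the
    right pure powers; what remains is divisible by x_i x_j. *)
Lemma axis_Nf d v : v \in starsp -> Nf (axis d.+2 v).
Proof.
move=> vs; have [v1 v2] := elimT (mem_starsp _ _) vs.
pose v' : 'M[k]_n := \matrix_(i, j) (v i j / fl i).
have v's : v' \in starsp.
  apply/mem_starsp; split=> [i j ij|i]; first by rewrite mxE v1 // mul0r.
  by under eq_bigr do rewrite mxE; rewrite -mulr_suml v2 mul0r.
(* Minus the mixed terms of f times [axis d.+1 v'], divided by x_i x_j. *)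
pose h : darts := fun i j => - ((fl j * v' i j)%:P%:P * X ^+ d - (fl i * v' j i)%:P%:P * Y ^+ d).
have hN : Nf (fun i j => X * Y * h i j).
  apply: (closed_edges e_sym e_irr) => //; first exact: Nf_closed.
  - by move=> i j ij _; exact: edge_Nf.
  - move=> i j ij; rewrite /h !mxE !v1 // 1?e_sym // !mul0r !mulr0 !polyC0 !mul0r subrr oppr0 //.
  - by move=> i j; rewrite /h swapXYN swapXY_XnBYn.
have yN : Nf (fun i j => rho i j f * axis d.+1 v' i j).
  exists (axis d.+1 v'), 0; split; first exact: axis_model.
  by move=> i j; rewrite rmorph0 mul0r addr0.
have := closedD Nf_closed yN hN; congr Nf; apply/funext => i; apply/funext => j.
have [ij|nij] := boolP (e i j); last first.
  rewrite (axis_non_edge e_sym d.+1 v's nij) (axis_non_edge e_sym d.+2 vs nij) mulr0 add0r /h !mxE !v1 // 1?e_sym // !mul0r !mulr0 !polyC0 !mul0r subrr oppr0 mulr0 //.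
rewrite rho_linear_form // /axis /h.
have -> : v i j = fl i * v' i j by rewrite mxE mulrC divfK.
have -> : v j i = fl j * v' j i by rewrite mxE mulrC divfK.
rewrite !polyCM !exprS; ring.
Qed.

Lemma top_Nf d g : omega_model g -> (forall i j, bihom d.+2%:Z (g i j)) -> Nf g.
Proof.
move=> og gd; have [v vs [h [h1 h2 gE]]] := model_degreeS og gd.
rewrite (_ : g = fun i j => axis d.+2 v i j + X * Y * h i j).
  apply: closedD; [exact: Nf_closed|exact: axis_Nf|].
  by apply: (closed_edges e_sym e_irr Nf_closed) => // i j ij _; exact: edge_Nf.
by apply/funext => i; apply/funext => j.
Qed.

Lemma linear_form_part : apart R 1 f.
Proof. exact: apart_linear_form. Qed.

(** Homogeneous parts are taken in the relation; the truncated difference [d.+1 - d0] is exact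
    because [d0] is at most 1. *)
Lemma Nf_homogeneous d g : Nf g -> (forall i j, bihom d.+1%:Z (g i j)) ->
  exists y (r : R), [/\ omega_model y, forall i j, bihom d%:Z (y i j) &
    forall i j, g i j = rho i j f * y i j + rho i j r * w i j].
Proof.
move=> [y [r [oy gE]]] gd.
have [s _ sE] := apart_hpart e_irr (d.+1 - d0) r.
exists (fun i j => hpart d (y i j)), s; split; first exact: omega_model_hpart.
  by move=> i j; exact: bihom_hpart.
move=> i j; rewrite -[LHS](hpart_id (gd i j)) gE hpartD.
have [y1 _ _] := oy; have [w1 _ _] := w_model.
have [ij|nij] := boolP (e i j); last first.
  have h0 c : hpart c (0 : S) = 0 by apply/polyP => b; apply/polyP => a; rewrite coef_hpart !coef0 if_same.
  by rewrite (y1 _ _ nij) (w1 _ _ nij) !mulr0 !h0 mulr0 addr0.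
congr (_ + _).
  by rewrite -add1n; apply: hpartM_homog; exact: (bihom_rho e_irr ij linear_form_part).
rewrite sE // -{1}(subnK (leq_trans d0_le1 (isT : (1 <= d.+1)%N))).
by apply: hpartMr_homog; exact: w_bihom.
Qed.

(** Descent by [top_Nf]: one factor f is split off in each degree above 1. *)
Lemma degree_top d g : omega_model g -> (forall i j, bihom d.+1%:Z (g i j)) ->
  exists2 v, v \in starsp & exists r : R,
    forall i j, g i j = rho i j (f ^+ d) * axis 1 v i j + rho i j r * w i j.
Proof.
elim: d g => [|d IH] g og gd.
  have [v vs ->] := model_degree1 og gd; exists v => //; exists 0 => i j.
  by rewrite expr0 rmorph1 mul1r rmorph0 mul0r addr0.
have [y [r [oy yd gE]]] := Nf_homogeneous (top_Nf og gd) gd.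
have [v vs [s yE]] := IH y oy yd; exists v => //; exists (f * s + r) => i j.
by rewrite gE yE exprS !rhoM rhoD rhoM mulrDr mulrDl !mulrA addrA.
Qed.

Lemma exists_axis_lift : exists A : 'M[k]_n -> W,
  (forall v, v \in starsp -> Psi (A v) = axis 1 v) /\ forall c u v, A (c *: u + v) = c%:A *: A u + A v.
Proof.
have [A AE] := choice (fun v => Psi_surj (axis_model e_sym 0 (memv_proj starsp v))).
exists A; split=> [v vs|c u v]; first by rewrite AE projv_id.
apply: Psi_eq => i j _; rewrite Psi_lin !AE rho_alg -axis_lin.
by rewrite linearP.
Qed.

(** Multiplication by a power of f maps V / K isomorphically onto the part of C: it is injective by
    regularity and surjective by [degree_top]. *)
Lemma dimk_top (K : {vspace 'M[k]_n}) (d : nat) : (K <= starsp)%VS ->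
  (forall v, v \in starsp -> v \in K <-> exists r : R, forall i j, axis 1 v i j = rho i j r * w i j) ->
  (0 < d)%N -> dimk (part C d%:Z) = (\dim starsp - \dim K)%N.
Proof.
move=> Ks KE d1; have [A [AE Alin]] := exists_axis_lift.
(* Degree d of C is model degree d + d0, and [axis 1 v] already contributes 1. *)
have [D DE] : exists D, (d + d0 = D.+1)%N by exists (d + d0).-1; rewrite prednK // addn_gt0 d1.
have fD u : psi (f ^+ D *: u) = 0 -> psi u = 0.
  elim: D {DE} u => [|D IH] u; first by rewrite expr0 scale1r.
  by rewrite exprS -scalerA linearZ => /linear_form_regular_quotient; exact: IH.
apply: (@dimk_quotient _ _ C _ starsp K (fun v => psi (f ^+ D *: A v))) => // [c u v|v vs|v vs|c cd].
- by rewrite Alin scalerDr linearD /= scalerA mulrC -scalerA linearZ.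
- split=> [/fD/psi_ker[r rE]|/KE[//|r rE]].
    by apply/KE => //; exists r => i j; rewrite -rE AE.
  have pA : psi (A v) = 0 by apply/psi_ker; exists r => i j; rewrite AE.
  by transitivity (f ^+ D *: psi (A v)); [exact: linearZ|rewrite pA; exact: scaler0].
- apply: psi_morph; apply/Psi_part => i j; rewrite PsiZ AE // -PoszD DE.
  have [ij|nij] := boolP (e i j); last by rewrite (axis_non_edge e_sym _ vs nij) mulr0; exact: bihom0.
  rewrite -addn1 PoszD; apply: bihomM; last exact: axis_bihom.
  rewrite rhoXn; elim: (D) => [|D' IH].
    rewrite expr0 => a b; rewrite coef1; case: b => [|b]; rewrite ?coef0 ?eqxx // coef1.
    by case: a => //= a; rewrite eqxx.
  rewrite exprS -add1n PoszD; apply: bihomM => //; exact: (bihom_rho e_irr ij linear_form_part).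
have [pr pr_gr] := exists_grading_W.
have [u ud <-] := graded_lift pr_gr C_graded psi_morph psi_surj cd.
have /Psi_part ud' := ud; rewrite -PoszD DE in ud'.
have [v vs [r uE]] := degree_top (Psi_model u) ud'; exists v => //.
apply/eqP; rewrite eq_sym -subr_eq0 -linearB; apply/eqP/psi_ker; exists r => i j.
by rewrite PsiB PsiZ AE // uE addrC addKr.
Qed.

End LinearForm.

End CokernelLinearForm.

(** * Dimensions and multiplicity of C for a cycle and for a tree *)

Section CokernelDimensions.
Variables (k : fieldType) (n : nat) (e : rel 'I_n).
Hypotheses (e_sym : symmetric e) (e_irr : irreflexive e) (e_conn : connected e).
Hypothesis n_ge3 : (3 <= n)%N.
Local Notation R := (SRring k e).
Local Notation S := {poly {poly k}}.
Local Notation X := ('X%:P : S).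
Local Notation Y := ('X : S).
Local Notation x := (SRvar k e).
Local Notation darts := ('I_n -> 'I_n -> S).
Local Notation omega_model := (@omega_model k n e).
Local Notation cyclesp := (@cyclesp k n e).
Local Notation starsp := (@starsp k n e).

Local Notation edge_dart := (@edge_dart k n).

Variables (W : gmod R) (Psi : W -> darts) (d0 : nat).
Hypotheses (Psi_lin : forall a u v i j, Psi (a *: u + v) i j = rho i j a * Psi u i j + Psi v i j)
  (Psi_inj : injective Psi) (Psi_model : forall u, omega_model (Psi u))
  (Psi_surj : forall g, omega_model g -> exists u, Psi u = g)
  (Psi_part : forall d u, part W d u <-> forall i j, bihom (d + d0%:Z) (Psi u i j)).
Variables (C : gmod R) (psi : {linear W -> C}) (w : darts) (m : 'M[k]_n).
Hypotheses (psi_surj : range psi = [set: C]) (psi_morph : gmorph psi) (C_graded : graded C).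
Hypothesis psi_ker : forall u, psi u = 0 <-> exists r : R, forall i j, Psi u i j = rho i j r * w i j.
Hypothesis w_shape : ((d0 = 0)%N /\ w = flat m /\ m \in cyclesp) \/
  ((d0 = 1)%N /\ w = axis 1 m /\ m \in starsp).
Hypothesis w_neq0 : forall i j, e i j -> w i j != 0.
Hypothesis W_neg : forall (d : int) u, (d < 0)%R -> part W d u -> u = 0.
Local Notation Nw := (@Nf k n e w).
Local Notation lform fl := (\sum_l (fl l : k)%:A * x l : R).

(** It is x_i x_j w / m_ij, so no multiple of f is needed. *)
Lemma edge_Nf_flat fl i j : w = flat m -> m \in cyclesp -> e i j -> Nw fl (edge_dart i j).
Proof.
move=> wE /mem_cyclesp[m1 m2 m3] ij; have mij : m i j != 0.
  by have := w_neq0 ij; rewrite wE /flat !polyC_eq0.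
exists (fun _ _ => 0), ((m i j)^-1%:A * (x i * x j)); split.
  by split=> // [a b|a]; rewrite ?rmorph0 ?oppr0 // big1 // => b _; rewrite coef0.
move=> a b; rewrite mulr0 add0r (rhoM _ _ _%:A) rho_alg wE /flat /edge_dart.
case: ((a, b) =P (i, j)) => [[-> ->]|/eqP ab1].
  by rewrite rhoM rho_var_l // rho_var_r // mulrAC -!polyCM mulVf // mul1r.
case: ((a, b) =P (j, i)) => [[-> ->]|/eqP ab2].
  have ji : e j i by rewrite e_sym.
  rewrite rhoM rho_var_l // rho_var_r // (m2 j i) !polyCN mulrN mulrAC -!polyCM mulVf // mul1r.
  by rewrite [Y * X]mulrC.
have [ab|nab] := boolP (e a b); last by rewrite (m1 a b nab) !polyC0 mulr0.
rewrite (rho_edge_var2 k e_irr ab ij) ?mulr0 ?mul0r // eq_sym //.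
by apply: contra ab2 => /eqP[-> ->].
Qed.

(** For each vertex l, f times the row of m at l minus f_l x_l w is x_a x_b [th a b] on the edges at
    l, with opposite signs at the two ends. Summed over one side of the edge ij of the tree,
    everything cancels except at ij. *)
Lemma edge_Nf_axis fl i j : (forall l, fl l != 0) ->
  (forall a b, e a b -> (w a b).[- (fl a / fl b) *: 'X] != 0) ->
  w = axis 1 m -> m \in starsp -> cyclesp = 0%VS -> e i j -> Nw fl (edge_dart i j).
Proof.
move=> fl0 fw wE ms z0 ij; have inj := edge_neq e_irr ij.
pose th a b := m b a * fl a + m a b * fl b.
(* Up to the factor f_j, [th i j] is the coefficient of w_ij on the line f = 0, where w does not
   vanish. *)
have thij : th i j != 0.
  have := fw i j ij; rewrite wE; apply: contraNneq => th0.
  have -> : (axis 1 m i j).[- (fl i / fl j) *: 'X] = (th i j / fl j)%:P * 'X.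
    rewrite /axis hornerD hornerN !hornerM !expr1 !hornerC hornerX -mul_polyC mulrA -polyCM.
    rewrite mulrN polyCN mulNr opprK -mulrDl -polyCD; congr (_%:P * _).
    by rewrite /th mulrDl mulfK // addrC mulrA.
  by rewrite th0 !mul0r.
pose G l : darts := fun a b => rho a b (lform fl) * axis 1 (row_part l m) a b - rho a b (fl l *: x l) * w a b.
have GN l : Nw fl (G l).
  exists (axis 1 (row_part l m)), (- (fl l *: x l)); split.
    exact/(axis_model e_sym)/row_part_starsp.
  by move=> a b; rewrite /G -[- (_ *: _)]sub0r rhoB rmorph0 sub0r mulNr.
(* The side of i; j is not on it, for otherwise there would be a cycle through ij. *)
pose S : {pred 'I_n} := fun l => connect (del_edge e i j) i l.
have iS : i \in S by exact: connect0.
have jS : j \notin S.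
  apply/negP => /(connect_del_edge_cycle k e_sym e_irr ij)[z]; rewrite z0 memv0 => /eqP->.
  by rewrite mxE eqxx.
have GE l a b : e a b -> G l a b = X * Y * (th a b)%:P%:P * ((a == l)%:R - (b == l)%:R).
  move=> ab; have anb := edge_neq e_irr ab; rewrite /G rho_linear_form //.
  have -> : rho a b (fl l *: x l) = (fl l)%:P%:P * rho a b (x l).
    by rewrite -mulr_algl rhoM rho_alg.
  rewrite wE /axis !row_partE rho_var /edge_var ab (eq_sym l) (eq_sym l b) !expr1 /=.
  have [al|al] := eqVneq a l.
    subst l; rewrite eq_sym in anb; rewrite (negPf anb).
    by rewrite subr0 mulr1 !polyC0 mul0r subr0 /th polyCD polyCD !polyCM; ring.
  have [->|bl] := eqVneq b l.
    rewrite [false%:R - true%:R](_ : _ = -1) ?sub0r // !polyC0 mul0r sub0r /th polyCD polyCD !polyCM.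
    by ring.
  by rewrite !polyC0 !mul0r !subrr !mulr0 mul0r subr0.
have := @closed_sum k n e (Nw fl) _ (index_enum 'I_n) (mem S) (fun=> ((th i j)^-1)%:A) G
  (Nf_closed e_sym e_irr e_conn n_ge3 w fl) (fun l _ => GN l).
congr (Nf e w fl _); apply/funext => a; apply/funext => b.
under eq_bigr do rewrite rho_alg; rewrite -mulr_sumr.
have [ab|nab] := boolP (e a b); last first.
  have nE : edge_dart i j a b = 0.
    rewrite /edge_dart; case: eqP => [[ai bj]|_]; first by rewrite ai bj ij in nab.
    by case: eqP => [[ai bj]|_] //; rewrite ai bj e_sym ij in nab.
  rewrite nE big1 ?mulr0 // => l _; rewrite /G wE.
  by rewrite !(axis_non_edge e_sym _ _ nab) ?row_part_starsp // !mulr0 subrr.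
under eq_bigr do rewrite GE //; rewrite -mulr_sumr sumrB.
have cnt c : \sum_(l in S) (c == l)%:R = (c \in S)%:R :> {poly {poly k}}.
  have [cS|cS] := boolP (c \in S).
    by rewrite (bigD1 c) //= eqxx big1 ?addr0 // => l /andP[_ lc]; rewrite eq_sym (negPf lc).
  by rewrite big1 // => l lS; case: eqP => // cl; rewrite cl lS in cS.
rewrite !cnt /edge_dart.
case: ((a, b) =P (i, j)) => [[-> ->]|/eqP ab1].
  by rewrite iS (negPf jS) subr0 mulr1 mulrCA -!polyCM mulVf // mulr1.
case: ((a, b) =P (j, i)) => [[-> ->]|/eqP ab2].
  have -> : th j i = th i j by rewrite /th addrC.
  rewrite iS (negPf jS) [false%:R - true%:R](_ : _ = -1) ?sub0r // mulrN1 mulrN mulrCA -!polyCM.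
  by rewrite mulVf // mulr1.
have -> : (a \in S) = (b \in S).
  have ab' : del_edge e i j a b by rewrite /= ab ab1 ab2.
  have SE c : (c \in S) = connect (del_edge e i j) i c by [].
  have ba' : del_edge e i j b a := etrans (del_edge_sym e_sym i j b a) ab'.
  rewrite !SE; apply/idP/idP => [aS|bS].
    exact: (@connect_trans _ (del_edge e i j) a i b aS (@connect1 _ (del_edge e i j) a b ab')).
  exact: (@connect_trans _ (del_edge e i j) b i a bS (@connect1 _ (del_edge e i j) b a ba')).
by rewrite subrr !mulr0.
Qed.

Lemma m_starsp : m \in starsp.
Proof.
case: w_shape => [[_ [_ /mem_cyclesp[m1 _ m3]]]|[_ [_ //]]].
by apply/mem_starsp.
Qed.

Lemma dimk_axis fl (d : nat) : (forall l, fl l != 0) ->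
  (forall a b, e a b -> (w a b).[- (fl a / fl b) *: 'X] != 0) ->
  w = axis 1 m -> m \in starsp -> cyclesp = 0%VS -> (0 < d)%N ->
  dimk (part C d%:Z) = (\dim starsp).-1.
Proof.
move=> fl0 fw wE ms z0 d1.
have [i0 [j0 ij0]] : exists i j, e i j.
  pose i := Ordinal (leq_trans (isT : (0 < 3)%N) n_ge3).
  by exists i; exact: (exists_neighbour e_conn n_ge3).
have m0 : m != 0.
  have := w_neq0 ij0; apply: contraNneq => m0.
  by rewrite wE /axis m0 !mxE !polyC0 !mul0r subrr.
have -> : (\dim starsp).-1 = (\dim starsp - \dim <[m]>)%N by rewrite dim_vline m0 subn1.
apply: (dimk_top e_sym e_irr e_conn n_ge3 Psi_lin Psi_inj Psi_model Psi_surj Psi_part psi_surj psi_morph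
  C_graded psi_ker w_shape W_neg fl0 fw) => //.
- by move=> i j ij; exact: edge_Nf_axis.
move=> v vs; split=> [/vlineP[c ->]|[r rE]].
  by exists c%:A => i j; rewrite rho_alg wE /axis !mxE !polyCM mulrBr !mulrA.
(* In degree 1 only the constant term of r acts on w, so v is that scalar times m. *)
have [eps epsE] := @exists_augmentation k n e i0 j0 ij0.
apply/vlineP; exists (eps r); apply/matrixP => i j; rewrite mxE.
have [v1 _] := elimT (mem_starsp _ _) vs; have [m1 _] := elimT (mem_starsp _ _) ms.
have [ij|nij] := boolP (e i j); last by rewrite v1 // m1 // mulr0.
have := congr1 (fun p : S => p`_0`_1) (rE i j).
rewrite coef_axis /= subr0 => ->; rewrite coef0M wE -(epsE i j r ij).
have -> : (axis 1 m i j)`_0 = (m i j)%:P * 'X.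
  apply/polyP => a; rewrite coef_axis coefCM coefX eqxx andbT andbF subr0.
  by case: eqP; rewrite ?mulr1 ?mulr0.
by rewrite mulrA coefMX /= coefMC.
Qed.

(** For a cycle m, the linear form with coefficients r_l sends [flat m] to [axis 1] of this matrix.
    So [rowsp] describes R_1 w, the n-dimensional space that is divided out of V. *)
Definition row_scale (r : 'rV[k]_n) : 'M[k]_n := \matrix_(i, j) (r 0 i * m i j).

Lemma row_scale_linear : linear row_scale.
Proof. by move=> c u v; apply/matrixP => i j; rewrite !mxE mulrDl mulrA. Qed.

HB.instance Definition _ := GRing.isLinear.Build k 'rV[k]_n 'M[k]_n _ row_scale row_scale_linear.

Definition rowsp : {vspace 'M[k]_n} := limg (linfun row_scale).

Lemma mem_rowsp (v : 'M[k]_n) : reflect (exists r : 'I_n -> k, forall i j, v i j = r i * m i j) (v \in rowsp).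
Proof.
apply: (iffP idP) => [/memv_imgP[r _ ->]|[r rE]].
  by exists (fun i => r 0 i) => i j; rewrite lfunE /= mxE.
apply/memv_imgP; exists (\row_i r i); first exact: memvf.
by apply/matrixP => i j; rewrite lfunE /= !mxE rE.
Qed.

Lemma dim_rowsp : (forall i j, e i j -> m i j != 0) -> \dim rowsp = n.
Proof.
move=> m0; rewrite limg_dim_eq ?dimvf /dim /= ?mul1n //.
apply/eqP; rewrite -subv0; apply/subvP => r /memv_capP[_].
rewrite memv_ker lfunE /= => /eqP/matrixP r0; rewrite memv0; apply/eqP/rowP => i.
have [j ij] := exists_neighbour e_conn n_ge3 i; rewrite mxE; apply/eqP.
by have /eqP := r0 i j; rewrite !mxE mulf_eq0 (negPf (m0 i j ij)) orbF.
Qed.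

Lemma rowsp_starsp : (rowsp <= starsp)%VS.
Proof.
apply/subvP => v /mem_rowsp[r rE]; have [m1 m2] := elimT (mem_starsp _ _) m_starsp.
apply/mem_starsp; split=> [i j ij|i]; first by rewrite rE m1 // mulr0.
by under eq_bigr do rewrite rE; rewrite -mulr_sumr m2 mulr0.
Qed.

Lemma flat_neq0 i j : w = flat m -> e i j -> m i j != 0.
Proof. by move=> wE /w_neq0; rewrite wE /flat !polyC_eq0. Qed.

Lemma axis_rowsp v : w = flat m -> m \in cyclesp -> v \in starsp ->
  v \in rowsp <-> exists r : R, forall i j, axis 1 v i j = rho i j r * w i j.
Proof.
move=> wE mz vs; have [m1 m2 m3] := elimT (mem_cyclesp _ _) mz.
have [v1 _] := elimT (mem_starsp _ _) vs.
split=> [/mem_rowsp[r rE]|[r rE]].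
  exists (lform r) => i j; have [ij|nij] := boolP (e i j); last first.
    by rewrite (axis_non_edge e_sym _ vs nij) wE /flat m1 // !polyC0 mulr0.
  rewrite rho_linear_form // wE /flat /axis !expr1 rE (rE j) (m2 j) !polyCM !polyCN; ring.
have [nb nbP] := choice (exists_neighbour e_conn n_ge3).
apply/mem_rowsp; exists (fun i => (rho i (nb i) r)`_0`_1) => i j.
have [ij|nij] := boolP (e i j); last by rewrite v1 // m1 // mulr0.
have := congr1 (fun p : S => p`_0`_1) (rE i j).
by rewrite coef_axis /= subr0 => ->; rewrite wE /flat (rho_axis r (nbP i) ij) coefMC coefMC.
Qed.

Lemma dimk_flat (d : nat) : w = flat m -> m \in cyclesp -> (0 < d)%N ->
  dimk (part C d%:Z) = (\dim starsp - n)%N.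
Proof.
move=> wE mz d1; rewrite -[X in (_ - X)%N](dim_rowsp (fun i j => flat_neq0 wE)).
apply: (dimk_top e_sym e_irr e_conn n_ge3 Psi_lin Psi_inj Psi_model Psi_surj Psi_part psi_surj psi_morph
  C_graded psi_ker w_shape W_neg (fl := fun=> 1)) => //.
- by move=> l; exact: oner_neq0.
- by move=> i j ij; rewrite wE /flat hornerC polyC_eq0; exact: flat_neq0.
- by move=> i j ij; exact: edge_Nf_flat.
- exact: rowsp_starsp.
- by move=> v; exact: axis_rowsp.
Qed.

(** Otherwise, by [krull_dim_axis], every star function would be proportional to m row by row, and V
    would have dimension at most n. *)
Lemma krull_dim_flat : w = flat m -> m \in cyclesp -> (n < \dim starsp)%N -> krull_dim C = 1%N.
Proof.
move=> wE mz ns; apply: contrapT => nk.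
have : (starsp <= rowsp)%VS.
  apply/subvP => v vs; apply/mem_rowsp.
  have : forall i, exists c, forall j, v i j = c * m i j.
    move=> i; apply: contrapT => nc; apply: nk.
    exact: (krull_dim_axis e_sym e_irr e_conn n_ge3 Psi_lin Psi_model Psi_surj psi_surj psi_ker w_shape w_neq0 vs nc).
  by move=> /choice[r rE]; exists r.
move=> /dimvS; rewrite (dim_rowsp (fun i j => flat_neq0 wE)); by rewrite leqNgt ns.
Qed.

Lemma multiplicity_flat : w = flat m -> m \in cyclesp -> (1 < \dim cyclesp)%N ->
  multiplicity C = ((\dim cyclesp).-1.*2)%:R.
Proof.
move=> wE mz z1; have := dim_starsp_cyclesp k e_sym e_irr e_conn n_ge3 => dE.
have ns : (n < \dim starsp)%N by lia.
apply: (@multiplicity_dim1 k R C _ 1 (krull_dim_flat wE mz ns)) => i i1.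
by rewrite dimk_flat //; lia.
Qed.

End CokernelDimensions.

(** * Numbers of generators of C *)

Section CokernelGenerators.
Variables (k : fieldType) (n : nat) (e : rel 'I_n).
Hypotheses (e_sym : symmetric e) (e_irr : irreflexive e) (e_conn : connected e).
Hypothesis n_ge3 : (3 <= n)%N.
Local Notation R := (SRring k e).
Local Notation S := {poly {poly k}}.
Local Notation X := ('X%:P : S).
Local Notation x := (SRvar k e).
Local Notation darts := ('I_n -> 'I_n -> S).
Local Notation omega_model := (@omega_model k n e).
Local Notation cyclesp := (@cyclesp k n e).
Local Notation starsp := (@starsp k n e).

Variables (W : gmod R) (Psi : W -> darts) (d0 : nat).
Hypotheses (Psi_lin : forall a u v i j, Psi (a *: u + v) i j = rho i j a * Psi u i j + Psi v i j)
  (Psi_inj : injective Psi) (Psi_model : forall u, omega_model (Psi u))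
  (Psi_surj : forall g, omega_model g -> exists u, Psi u = g)
  (Psi_part : forall d u, part W d u <-> forall i j, bihom (d + d0%:Z) (Psi u i j)).
Variables (C : gmod R) (psi : {linear W -> C}) (w : darts) (m : 'M[k]_n).
Hypotheses (psi_surj : range psi = [set: C]) (psi_morph : gmorph psi) (C_graded : graded C).
Hypothesis psi_ker : forall u, psi u = 0 <-> exists r : R, forall i j, Psi u i j = rho i j r * w i j.
Hypothesis w_shape : ((d0 = 0)%N /\ w = flat m /\ m \in cyclesp) \/
  ((d0 = 1)%N /\ w = axis 1 m /\ m \in starsp).
Hypothesis w_neq0 : forall i j, e i j -> w i j != 0.
Local Notation PsiZ := (PsiZ Psi_lin).
Local Notation Psi0 := (Psi0 Psi_lin).
Local Notation Psi_eq := (Psi_eq Psi_inj Psi_model).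
Local Notation psi_surjP := (psi_surjP psi_surj).
Hypothesis W_neg : forall (d : int) u, (d < 0)%R -> part W d u -> u = 0.
Lemma spanC0 (N : set C) : span N (0 : C).
Proof. exact: (@span0 _ C N). Qed.

Lemma spanCP (N : set C) (a : R) (c c' : C) : span N c -> span N c' -> span N (a *: c + c').
Proof. exact: (@spanP _ C N a c c'). Qed.

Lemma spanC_ind (N : set C) (Q : C -> Prop) : Q 0 -> (forall (a : R) c c', Q c -> Q c' -> Q (a *: c + c')) ->
  (forall c, N c -> Q c) -> forall c, span N c -> Q c.
Proof. exact: (@span_min _ C N Q). Qed.

Lemma psi0 : psi 0 = 0.
Proof. exact: linear0. Qed.

Lemma psiP (a : R) u v : psi (a *: u + v) = a *: psi u + psi v.
Proof. exact: linearP. Qed.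

Lemma psiB u v : psi (u - v) = psi u - psi v.
Proof. exact: linearB. Qed.

Lemma psiZ (a : R) u : psi (a *: u) = a *: psi u.
Proof. exact: linearZ. Qed.

Lemma generated_by_seq (s : seq C) : span [set c | c \in s] = [set: C] -> generated_by C (size s).
Proof.
move=> sT; exists (fun t : 'I_(size s) => nth 0 s t); rewrite -sT; congr span.
apply/seteqP; split=> [_ [t _ <-]|c cs] /=; first exact: mem_nth.
have ci : (index c s < size s)%N by rewrite index_mem.
by exists (Ordinal ci) => //=; exact: nth_index.
Qed.

Lemma klinear_span (V : vectType k) (U : {vspace V}) (h : V -> C) (N : set C) :
  (forall c u v, h (c *: u + v) = c%:A *: h u + h v) ->
  (forall b, b \in (vbasis U : seq V) -> span N (h b)) -> forall u, u \in U -> span N (h u).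
Proof.
move=> hl hb u uU; rewrite (coord_vbasis uU).
have h0 : h 0 = 0.
  have E := hl (-1) 0 0; rewrite scaler0 addr0 !scaleN1r addNr in E.
  exact: E.
elim: (index_enum _) => [|t r IH]; first by rewrite big_nil h0; exact: spanC0.
rewrite big_cons hl; apply: spanCP => //; apply: hb.
by rewrite mem_nth // size_tuple.
Qed.

Lemma exists_flat_lift : exists F : 'M[k]_n -> W,
  (forall z, z \in cyclesp -> Psi (F z) = flat z) /\ forall c u v, F (c *: u + v) = c%:A *: F u + F v.
Proof.
have [F FE] := choice (fun z => Psi_surj (flat_model (memv_proj cyclesp z))).
exists F; split=> [z zc|c u v]; first by rewrite FE projv_id.
apply: Psi_eq => i j _; rewrite Psi_lin !FE rho_alg linearP /flat !mxE.
by rewrite !polyCD !polyCM.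
Qed.

Lemma generate (N : set C) :
  (forall z, z \in cyclesp -> exists u, Psi u = flat z /\ span N (psi u)) ->
  (forall v, v \in starsp -> exists u, Psi u = axis 1 v /\ span N (psi u)) -> span N = [set: C].
Proof.
move=> Nz Nv; apply/seteqP; split=> // c _; have [u <-] := psi_surjP c.
have := @model_ind k n e e_sym e_irr e_conn n_ge3 (fun g => exists u, Psi u = g /\ span N (psi u)).
move=> h; have [||||v [/Psi_inj <-]] // := h _ _ _ (Psi u) => {h} //.
split.
  exists 0; split; last by rewrite psi0; exact: spanC0.
  by apply/funext => i; apply/funext => j; rewrite Psi0.
move=> a g g' [v [<- vN]] [v' [<- v'N]]; exists (a *: v + v'); split.
  by apply/funext => i; apply/funext => j; rewrite Psi_lin.
by rewrite psiP; exact: spanCP.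
Qed.

Lemma psi_klinear (F : 'M[k]_n -> W) : (forall c u v, F (c *: u + v) = c%:A *: F u + F v) ->
  forall c u v, psi (F (c *: u + v)) = c%:A *: psi (F u) + psi (F v).
Proof. by move=> Fl c u v; rewrite Fl psiP. Qed.

Lemma finitely_generated : exists l, generated_by C l.
Proof.
have [F [FE Fl]] := exists_flat_lift.
have [A [AE Al]] := exists_axis_lift e_sym Psi_lin Psi_inj Psi_model Psi_surj.
pose s := [seq psi (F z) | z <- vbasis cyclesp] ++ [seq psi (A v) | v <- vbasis starsp].
exists (size s); apply: generated_by_seq; apply: generate => z zU.
  exists (F z); split; first exact: FE.
  apply: (klinear_span (psi_klinear Fl) _ zU) => b bb; apply: span_sub.
  by rewrite /= mem_cat; apply/orP; left; apply/mapP; exists b.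
exists (A z); split; first exact: AE.
apply: (klinear_span (psi_klinear Al) _ zU) => b bb; apply: span_sub.
by rewrite /= mem_cat; apply/orP; right; apply/mapP; exists b.
Qed.

(** A star function v is the sum of x_l z_l, where z_l is a cycle with the same row at l as v. *)
Lemma generate_no_cut (N : set C) : (forall v, ~ cut_vertex e v) ->
  (forall z, z \in cyclesp -> exists u, Psi u = flat z /\ span N (psi u)) -> span N = [set: C].
Proof.
move=> nc Nz; apply: (generate (Nz)) => v vs.
have zex l : exists z, z \in cyclesp /\ forall j, z l j = v l j.
  by have [z zc zE] := not_cut_vertex_row e_sym e_irr e_conn n_ge3 (nc l) vs; exists z.
have [z zP] := choice zex.
have [u uP] := choice (fun l => Nz (z l) (zP l).1).
exists (\sum_l x l *: u l); split.
  apply/funext => i; apply/funext => j.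
  rewrite (Psi_sum Psi_lin); under eq_bigr do rewrite PsiZ (uP _).1.
  have [ij|nij] := boolP (e i j); last first.
    rewrite (axis_non_edge e_sym _ vs nij) big1 // => l _.
    by have [z1 _ _] := elimT (mem_cyclesp _ _) (zP l).1; rewrite /flat z1 // !polyC0 mulr0.
  rewrite (bigD1 i) //= (bigD1 j) /= 1?eq_sym ?(edge_neq e_irr ij) // big1 ?addr0 => [|l /andP[li lj]].
    rewrite rho_var_l // rho_var_r // /flat (zP i).2 /axis !expr1 mulrC; congr (_ + _).
    have [_ z2 _] := elimT (mem_cyclesp _ _) (zP j).1.
    by rewrite z2 (zP j).2 !polyCN mulrN mulrC.
  by rewrite rho_var_other // mul0r.
elim: (index_enum _) => [|l r IH]; first by rewrite big_nil psi0; exact: spanC0.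
by rewrite big_cons psiP; apply: spanCP => //; exact: (uP l).2.
Qed.

Lemma generated_no_cut : w = flat m -> m \in cyclesp -> m != 0 -> (forall v, ~ cut_vertex e v) ->
  generated_by C (\dim cyclesp).-1.
Proof.
move=> wE mz m0 nc; have [F [FE Fl]] := exists_flat_lift.
pose D := (cyclesp :\: <[m]>)%VS.
have mc : (cyclesp :&: <[m]>)%VS = <[m]>%VS by apply/capv_idPr; rewrite -memvE.
have dD : \dim D = (\dim cyclesp).-1.
  by rewrite -(dimv_cap_compl cyclesp <[m]>) mc dim_vline m0.
have pFm : psi (F m) = 0.
  by apply/psi_ker; exists 1 => i j; rewrite FE // rmorph1 mul1r wE.
have -> : (\dim cyclesp).-1 = size [seq psi (F b) | b <- vbasis D] by rewrite size_map size_tuple dD.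
apply: generated_by_seq; apply: generate_no_cut => // z zc.
exists (F z); split; first exact: FE.
have : z \in (D + cyclesp :&: <[m]>)%VS by rewrite addv_diff_cap.
rewrite mc => /memv_addP[d dDm [_ /vlineP[c ->] ->]].
have -> : F (d + c *: m) = c%:A *: F m + F d by rewrite addrC Fl.
rewrite psiP pFm scaler0 add0r; apply: (klinear_span (psi_klinear Fl) _ dDm) => b bb.
by apply: span_sub; apply/mapP; exists b.
Qed.

(** L is linear through the augmentation, so its image is spanned by the images of lifted generators
    of C and of the kernel of psi; the latter costs one dimension. *)
Lemma generators_lower (V : vectType k) (eps : {rmorphism R -> k}) (L : W -> V) (U : {vspace V}) (v0 : V) l :
  generated_by C l -> (forall a u v, L (a *: u + v) = eps a *: L u + L v) ->
  (forall u, psi u = 0 -> L u \in <[v0]>%VS) -> (forall v, v \in U -> exists u, L u = v) ->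
  (\dim U <= l.+1)%N.
Proof.
move=> [g gT] Ll Lk LU; have [h hE] := choice (fun t => psi_surjP (g t)).
pose X := (<<[seq L (h t) | t <- enum 'I_l]>> + <[v0]>)%VS.
have UX : (U <= X)%VS.
  apply/subvP => v /LU[u <-].
  suff key c : span (range g) c -> forall u', psi u' = c -> L u' \in X.
    by apply: (key (psi u)) => //; rewrite gT.
  move: c; apply: spanC_ind.
  - by move=> v' /Lk; apply: subvP; exact: addvSr.
  - move=> a c c' cX c'X v' v'E; have [u1 u1E] := psi_surjP c.
    have -> : v' = a *: u1 + (v' - a *: u1) by rewrite addrC subrK.
    rewrite Ll rpredD ?rpredZ //; first exact: cX.
    by apply: c'X; rewrite psiB psiZ v'E u1E addrC addKr.
  - move=> _ [t _ <-] v' v'E; have -> : v' = 1 *: h t + (v' - h t) by rewrite scale1r addrC subrK.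
    rewrite Ll rmorph1 scale1r; apply: memv_add.
      by apply: memv_span; apply/mapP; exists t; rewrite ?mem_enum.
    by apply: Lk; rewrite psiB v'E hE subrr.
apply: leq_trans (dimvS UX) _; apply: leq_trans (leq_of_leqif (dimv_add_leqif _ _)) _.
rewrite -addn1 leq_add //; last by rewrite dim_vline; case: (_ != _).
by apply: leq_trans (dim_span _) _; rewrite size_map size_enum_ord.
Qed.

Lemma trivial_generated0 : generated_by C 0 -> forall c : C, c = 0.
Proof.
move=> [g gT] c; have : span (range g) c by rewrite gT.
move: c; apply: spanC_ind => //.
- by move=> a u v -> ->; rewrite scaler0 addr0.
- by move=> c' [t _ _]; case: t.
Qed.

(** The multiplicity is 2 (dim Z - 1) and dim Z - 1 generators suffice. For dim Z = 1, C is 0 and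
    both sides vanish. *)
Lemma flat_no_cut_multiplicity : w = flat m -> m \in cyclesp -> m != 0 -> (forall v, ~ cut_vertex e v) ->
  ~ (multiplicity C < 2 * (min_gens C)%:R)%R.
Proof.
move=> wE mz m0 nc; have gen := generated_no_cut wE mz m0 nc.
have mg := min_gens_le gen; have [z1|z1] := ltnP 1 (\dim cyclesp).
  rewrite (multiplicity_flat e_sym e_irr e_conn n_ge3 Psi_lin Psi_inj Psi_model Psi_surj Psi_part
    psi_surj psi_morph C_graded psi_ker w_shape w_neq0 W_neg wE mz z1).
  by rewrite -natrM ltr_nat mul2n ltn_double ltnNge mg.
have g0 : (\dim cyclesp).-1 = 0%N by apply/eqP; rewrite -leqn0; lia.
rewrite g0 in gen mg; rewrite multiplicity_trivial; last exact: trivial_generated0.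
by move: mg; rewrite leqn0 => /eqP->; rewrite mulr0 ltxx.
Qed.

Lemma axis_dim1_trivial : w = axis 1 m -> cyclesp = 0%VS -> starsp = <[m]>%VS -> forall c : C, c = 0.
Proof.
move=> wE z0 sE c.
have : span [set (0 : C)] = [set: C].
  apply: generate => [z|v].
    rewrite z0 memv0 => /eqP->; exists 0; split; last by rewrite psi0; exact: spanC0.
    by apply/funext => i; apply/funext => j; rewrite Psi0 /flat mxE !polyC0.
  move=> vs; have [u uE] := Psi_surj (axis_model e_sym 0 vs); exists u; split=> //.
  rewrite (_ : psi u = 0); first exact: spanC0.
  apply/psi_ker; move: vs; rewrite sE => /vlineP[a vE]; exists a%:A => i j.
  by rewrite uE wE vE rho_alg /axis !mxE !polyCM mulrBr !mulrA.
move=> sT; have : span [set (0 : C)] c by rewrite sT.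
move: c {sT}; apply: spanC_ind => //.
by move=> a u v -> ->; rewrite scaler0 addr0.
Qed.

End CokernelGenerators.

Lemma gr_pr_scale1 (k : fieldType) (A : gralg k) (M : gmod A) pr (a : A) d (u : M) :
  @graded_by k A M pr -> apart A 1 a -> pr d (a *: u) = if d is d'.+1 then a *: pr d' u else 0.
Proof.
move=> h a1; have [N [N0 {1}->]] := gr_sum h u.
rewrite scaler_sumr (gr_pr_sum h).
have hc c : part M c.+1%:Z (a *: pr c u) by rewrite -add1n PoszD; apply: (gr_scale h) a1 (gr_part h c u).
case: d => [|d]; first by rewrite big1 // => c _; rewrite (gr_other h (hc c)).
have [dN|Nd] := ltnP d N; last first.
  rewrite (N0 d Nd) scaler0 big1 // => c _; apply: (gr_other h (hc c)).
  by rewrite eqSS neq_ltn (leq_trans (ltn_ord c) Nd).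
rewrite (bigD1 (Ordinal dN)) //= (gr_id h (hc d)) big1 ?addr0 // => c cd.
by apply: (gr_other h (hc c)); rewrite eqSS.
Qed.

Lemma coef01_linear (k : fieldType) (a b : k) (p : {poly {poly k}}) :
  ((a%:P%:P * 'X%:P + b%:P%:P * 'X) * p)`_0`_1 = a * p`_0`_0.
Proof.
have cE (c : k) q : (c%:P%:P * q)`_0`_1 = c * q`_0`_1 by rewrite 2!coefCM.
by rewrite mulrDl 2!coefD -!mulrA !cE coef_mulX coef_mulY mulr0 addr0.
Qed.

Lemma polyCC_divK (k : fieldType) (a b : k) (p : {poly {poly k}}) : b != 0 ->
  (a / b)%:P%:P * p * b%:P%:P = a%:P%:P * p.
Proof. by move=> b0; rewrite mulrAC -polyCM -polyCM divfK. Qed.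

Lemma coef01_constant (k : fieldType) (c : k) (p : {poly {poly k}}) : (p * c%:P%:P)`_0`_1 = p`_0`_1 * c.
Proof. by rewrite 2!coefMC. Qed.

Lemma subr_eqD (V : zmodType) (a b d : V) : a - b = d -> a = d + b.
Proof. by move=> <-; rewrite subrK. Qed.

Section QuotientMap.
Variables (A : comNzRingType) (M : lmodType A) (N : set M).

Lemma quotmod_pi0 : quotmod_pi N 0 = 0.
Proof. exact: linear0. Qed.

Lemma quotmod_piP a u v : quotmod_pi N (a *: u + v) = a *: quotmod_pi N u + quotmod_pi N v.
Proof. exact: linearP. Qed.

Lemma quotmod_piZZ a u : quotmod_pi N (a *: u) = a *: quotmod_pi N u.
Proof. exact: linearZ. Qed.

End QuotientMap.

(** * The augmentation of R and summands of C / fC *)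

Section Augmentation.
Variables (k : fieldType) (n : nat) (e : rel 'I_n).
Hypotheses (e_sym : symmetric e) (e_irr : irreflexive e) (e_conn : connected e).
Hypothesis n_ge3 : (3 <= n)%N.
Local Notation R := (SRring k e).
Local Notation x := (SRvar k e).
Local Notation lform fl := (\sum_l (fl l : k)%:A * x l : R).

Lemma exists_edge : exists i j, e i j.
Proof.
pose i := Ordinal (leq_trans (isT : (0 < 3)%N) n_ge3).
by exists i; exact: (exists_neighbour e_conn n_ge3).
Qed.

Lemma apart_alg (c : k) : apart R 0 c%:A.
Proof.
exists c%:MP; last exact/esym/SR_scalarE.
rewrite /= -[c%:MP]mulr1 mul_mpolyC; apply: rpredZ; exact: dhomog1.
Qed.

Lemma apart0 (d : int) : apart R d 0.
Proof. by case: d => d //=; exists 0; rewrite ?rmorph0 //; exact: rpred0. Qed.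

Lemma degree1_form (f : R) : apart R 1 f -> exists fl, f = lform fl.
Proof.
move=> f1; have [nb nbP] := choice (exists_neighbour e_conn n_ge3).
exists (fun i => (rho i (nb i) f)`_0`_1); apply: (rho_eq e_irr e_conn n_ge3) => i j ij.
have ji : e j i by rewrite e_sym.
rewrite rho_linear_form //; have fd := bihom_rho e_irr ij f1.
rewrite (rho_axis f (nbP i) ij) (rho_axis f (nbP j) ji) -(rho_swap e_sym e_irr i j).
rewrite coef_swapXY.
have f0 a b : (a + b != 1)%N -> (rho i j f)`_b`_a = 0.
  by move=> ab; apply/eqP; apply: contraNT ab => /fd[->].
apply/polyP => b; apply/polyP => a.
have := coef_XnBYn (rho i j f)`_0`_1 (- (rho i j f)`_1`_0) 1 a b.
rewrite !expr1 !polyCN mulNr opprK => ->.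
case: a => [|[|a]]; case: b => [|[|b]]; rewrite ?subr0 ?sub0r ?opprK //= ?f0 //; lia.
Qed.

Variable eps : {rmorphism R -> k}.
Hypothesis epsE : forall a b r, e a b -> (rho a b r)`_0`_0 = eps r.

Lemma eps_alg (c : k) : eps c%:A = c.
Proof.
have [i [j ij]] := exists_edge.
by rewrite -(epsE _ ij) rho_alg !coefC.
Qed.

Lemma eps_part (d : int) (a : R) : d != 0 -> apart R d a -> eps a = 0.
Proof.
have [i [j ij]] := exists_edge.
move=> d0 ad; rewrite -(epsE a ij); apply/eqP; apply: contraNT d0 => /(bihom_rho e_irr ij ad) <-.
by [].
Qed.

Lemma eps_var l : eps (x l) = 0.
Proof. by apply: (@eps_part 1) => //; exact: apart_SRvar. Qed.

(** An induction principle expressing that the kernel of the augmentation is generated by the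
    variables. *)
Lemma eps_ind (Q : R -> Prop) : Q 0 -> (forall a r s, Q r -> Q s -> Q (a * r + s)) ->
  (forall l, Q (x l)) -> forall r, Q (r - (eps r)%:A).
Proof.
move=> Q0 QD Qx; apply: SR_ind => [c|l|r s Qr Qs|r s Qr Qs].
- by rewrite eps_alg subrr.
- by rewrite eps_var scale0r subr0.
- rewrite rmorphD scalerDl opprD addrACA.
  by have := QD 1 _ _ Qr Qs; rewrite mul1r.
rewrite rmorphM; have := QD r _ _ Qs (QD (eps s)%:A _ _ Qr Q0); congr Q.
have -> : (eps r * eps s)%:A = (eps r)%:A * (eps s)%:A :> R.
  by rewrite -scalerAl mul1r scalerA.
by rewrite addr0 !mulrBr addrA (mulrC (eps s)%:A r) subrK mulrC [X in _ - X]mulrC.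
Qed.

Lemma eps_ker (a : R) : span (@posdeg k R) (a - (eps a)%:A).
Proof.
move: a; apply: eps_ind.
- exact: (@span0 R (gself R)).
- by move=> a r s; exact: (@spanP R (gself R) _ a r s).
by move=> l; apply: (@span_sub R (gself R)); exists 1 => //; exact: apart_SRvar.
Qed.

End Augmentation.

Section CokernelNoCutVertex.
Variables (k : fieldType) (n : nat) (e : rel 'I_n).
Hypotheses (e_sym : symmetric e) (e_irr : irreflexive e) (e_conn : connected e).
Hypothesis n_ge3 : (3 <= n)%N.
Local Notation R := (SRring k e).
Local Notation S := {poly {poly k}}.
Local Notation x := (SRvar k e).
Local Notation darts := ('I_n -> 'I_n -> S).
Local Notation omega_model := (@omega_model k n e).
Local Notation cyclesp := (@cyclesp k n e).
Local Notation starsp := (@starsp k n e).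

Variables (W : gmod R) (Psi : W -> darts) (d0 : nat).
Hypotheses (Psi_lin : forall a u v i j, Psi (a *: u + v) i j = rho i j a * Psi u i j + Psi v i j)
  (Psi_inj : injective Psi) (Psi_model : forall u, omega_model (Psi u))
  (Psi_surj : forall g, omega_model g -> exists u, Psi u = g)
  (Psi_part : forall d u, part W d u <-> forall i j, bihom (d + d0%:Z) (Psi u i j)).
Variables (C : gmod R) (psi : {linear W -> C}) (w : darts) (m : 'M[k]_n).
Hypotheses (psi_surj : range psi = [set: C]) (psi_morph : gmorph psi) (C_graded : graded C).
Hypothesis psi_ker : forall u, psi u = 0 <-> exists r : R, forall i j, Psi u i j = rho i j r * w i j.
Hypothesis w_shape : ((d0 = 0)%N /\ w = flat m /\ m \in cyclesp) \/
  ((d0 = 1)%N /\ w = axis 1 m /\ m \in starsp).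
Hypothesis w_neq0 : forall i j, e i j -> w i j != 0.
Local Notation PsiZ := (PsiZ Psi_lin).
Local Notation PsiB := (PsiB Psi_lin).
Local Notation Psi0 := (Psi0 Psi_lin).
Local Notation psi_surjP := (psi_surjP psi_surj).
Hypothesis W_neg : forall (d : int) u, (d < 0)%R -> part W d u -> u = 0.
Local Notation exists_grading_W := (exists_grading e_irr Psi_lin Psi_inj Psi_model Psi_surj Psi_part W_neg).
Local Notation Nw := (@Nf k n e w).
Local Notation lform fl := (\sum_l (fl l : k)%:A * x l : R).
Variable eps : {rmorphism R -> k}.
Hypothesis epsE : forall a b r, e a b -> (rho a b r)`_0`_0 = eps r.
Local Notation eps_alg := (eps_alg e_conn n_ge3 epsE).
Local Notation eps_part := (eps_part e_irr e_conn n_ge3 epsE).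
Local Notation eps_ker := (eps_ker e_irr e_conn n_ge3 epsE).
Local Notation psiP := (psiP psi).
Local Notation psiB := (psiB psi).
Local Notation psiZ := (psiZ psi).

Lemma spanf (f : R) (c : C) : span [set f *: c | c in [set: C]] c <-> exists c', c = f *: c'.
Proof.
split=> [|[c' ->]]; last by apply: span_sub; exists c'.
move: c; apply: spanC_ind.
- by exists 0; rewrite scaler0.
- by move=> a c c' [d ->] [d' ->]; exists (a *: d + d'); rewrite scalerDr !scalerA mulrC.
- by move=> c [c' _ <-]; exists c'.
Qed.

Definition pif (f : R) : C -> gmodf C f := quotmod_pi [set f *: c | c in [set: C]].

Lemma pifP f (a : R) c c' : pif f (a *: c + c') = a *: pif f c + pif f c'.
Proof. exact: (@quotmod_piP _ C _ a c c'). Qed.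

Lemma pifZ f (a : R) c : pif f (a *: c) = a *: pif f c.
Proof. exact: (@quotmod_piZZ _ C _ a c). Qed.

Lemma pif0 f : pif f 0 = 0.
Proof. exact: (@quotmod_pi0 _ C _). Qed.

Lemma pif_surj f q : exists c, pif f c = q.
Proof. by exists (repr (q : quotmod [set f *: c | c in [set: C]])); exact: quotmod_reprK. Qed.

Lemma pif_eq0 (f : R) (c : C) : pif f c = 0 <-> exists c', c = f *: c'.
Proof. by rewrite /pif quotmod_eq0; exact: spanf. Qed.

(** T descends to C / fC, as it kills the kernel of psi and the augmentation kills f. The last
    condition says that every variable, hence the maximal ideal, kills the class of u. *)
Lemma has_k_summandI fl (prC : nat -> C -> C) (j : nat) (u : W) (T : W -> k) :
  @graded_by k R C prC -> part W j%:Z u ->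
  (forall a v v', T (a *: v + v') = eps a * T v + T v') -> (forall v, psi v = 0 -> T v = 0) ->
  (forall (i : int) v, part W i v -> i != j%:Z -> T v = 0) -> T u = 1 ->
  (forall l, Nw fl (Psi (x l *: u))) -> has_k_summand (gmodf C (lform fl)).
Proof.
move=> hC uj Tl Tk Tp Tu xu; set f := lform fl.
have T0 : T 0 = 0 by apply: Tk; exact: psi0.
have TB v v' : T (v - v') = T v - T v'.
  by rewrite addrC -scaleN1r Tl rmorphN1 mulN1r addrC.
have [lift liftE] := choice psi_surjP.
have TL v : T (lift (psi v)) = T v.
  by apply/eqP; rewrite -subr_eq0 -TB; apply/eqP/Tk; rewrite psiB liftE subrr.
have f1 : apart R 1 f by exact: apart_linear_form.
have ef : eps f = 0 by apply: eps_part f1.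
have hq : @graded_by k R (gmodf C f) (quot_pr prC (N := _)).
  apply: graded_quot => // d c /spanf[c' ->]; apply/spanf; rewrite (gr_pr_scale1 _ _ hC f1).
  by case: d => [|d]; [exists 0; rewrite scaler0|exists (prC d c')].
pose T' (q : gmodf C f) := T (lift (repr (q : quotmod [set f *: c | c in [set: C]]))).
have T'E v : T' (pif f (psi v)) = T v.
  have : span [set f *: c | c in [set: C]]
      (repr (pif f (psi v) : quotmod [set f *: c | c in [set: C]]) - psi v).
    by apply/quotmod_eq; rewrite quotmod_reprK.
  move=> /spanf[c' cE]; have [v' v'E] := psi_surjP c'.
  rewrite /T'; move: cE; set c := repr _ => cE.
  have -> : c = psi (f *: v' + v).
    by apply: etrans (subr_eqD cE) _; rewrite -v'E; exact/esym/psiP.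
  by rewrite TL Tl ef mul0r add0r.
have piP (q : gmodf C f) : exists v, q = pif f (psi v).
  have [c <-] := pif_surj q; have [v <-] := psi_surjP c.
  by exists v.
have key r : Nw fl (Psi ((r - (eps r)%:A) *: u)).
  move: r; apply: (eps_ind e_irr e_conn n_ge3 epsE (Q := fun r => Nw fl (Psi (r *: u)))) => // [|a r s Nr Ns].
    have [N0 _] := Nf_closed e_sym e_irr e_conn n_ge3 w fl; move: N0; congr (Nf _ _ _ _).
    by apply/funext => i; apply/funext => l; rewrite scale0r Psi0.
  have [_ ND] := Nf_closed e_sym e_irr e_conn n_ge3 w fl.
  have := ND a _ _ Nr Ns; congr (Nf _ _ _ _).
  by apply/funext => i; apply/funext => l; rewrite scalerDl -scalerA Psi_lin.
apply: (@has_k_summand_functional k R eps eps_alg eps_part eps_ker (@apart_alg k n e) (@apart0 k n e)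
  (gmodf C f) _ j (pif f (psi u)) T' hq).
- by exists (psi u) => //; exact: psi_morph.
- move=> a q q'; have [[v ->] [v' ->]] := conj (piP q) (piP q').
  by rewrite -pifP -psiP !T'E Tl.
- move=> i _ [c ci <-] ij.
  have [pr pr_gr] := exists_grading_W.
  have [v vi <-] := graded_lift pr_gr C_graded psi_morph psi_surj ci.
  by apply: etrans (T'E v) _; exact: Tp vi ij.
- by rewrite T'E.
move=> a ea; rewrite -pifZ; apply/pif_eq0; rewrite -psiZ.
have [y [r [oy aE]]] := key a; have [y' y'E] := Psi_surj oy.
exists (psi y'); rewrite -psiZ; apply/eqP; rewrite -subr_eq0 -psiB; apply/eqP/psi_ker; exists r => i l.
by rewrite PsiB !PsiZ y'E; move: (aE i l); rewrite ea scale0r subr0 PsiZ => ->; rewrite addrC addKr.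
Qed.

(** The form f is arbitrary here, so some of its coefficients may be 0; at those vertices regularity
    on C replaces division by the coefficient. *)
Lemma flat_no_cut_no_summand (f : R) : w = flat m -> m \in cyclesp -> (forall v, ~ cut_vertex e v) ->
  apart R 1 f -> regular_on f C -> ~ has_k_summand (gmodf C f).
Proof.
move=> wE mz nc f1 fC ks.
have [j [q [T [qj q_ann q0 Tq Tp]]]] :=
  @k_summand_generator k R eps eps_part eps_ker (@apart_alg k n e) (gmodf C f) ks.
have m0 i l : e i l -> m i l != 0 by exact: flat_neq0 wE.
have d00 : d0 = 0%N.
  case: w_shape => [[]//|[d1 [wE' _]]]; have [i [l il]] := exists_edge e_conn n_ge3.
  have := congr1 (fun g : darts => (g i l)`_0`_0) wE; rewrite wE' coef_axis coef_flat /= subrr.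
  by move=> /esym/eqP; rewrite (negPf (m0 i l il)).
have [F [FE Fl]] := exists_flat_lift Psi_lin Psi_inj Psi_model Psi_surj.
have F0 z : z \in cyclesp -> part W 0 (F z).
  by move=> zc; apply/Psi_part => i l; rewrite FE // d00; exact: flat_bihom.
(* C is generated by the images of cycles, in degree 0; a projection living in another degree would
   vanish on all generators. *)
have j0 : j = 0.
  apply/eqP; apply: contraT => jn0; exfalso; apply: Tq.
  have [c <-] := pif_surj q.
  have : span [set psi (F z) | z in [set z | z \in cyclesp]] c.
    rewrite (generate_no_cut e_sym e_irr e_conn n_ge3 Psi_lin Psi_inj Psi_model psi_surj nc) // => z zc.
    by exists (F z); split; [exact: FE|apply: span_sub; exists z].
  have TP (a : R) c1 c2 : T (pif f (a *: c1 + c2)) = a *: T (pif f c1) + T (pif f c2).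
    by rewrite pifP; exact: linearP.
  move: c {q qj q_ann q0}; apply: spanC_ind.
  - by rewrite pif0; exact: linear0.
  - by move=> a c c' cT c'T; rewrite TP cT c'T addr0; exact: scaler0.
  - move=> _ [z zc <-]; apply: (Tp 0); last by rewrite eq_sym.
    by exists (psi (F z)) => //; apply: psi_morph; exact: F0.
have [cu cu0 qE] : exists2 c, part C 0 c & pif f c = q.
  by move: qj; rewrite j0 => -[c]; exists c.
have [pr pr_gr] := exists_grading_W.
have [u u0 uE] := graded_lift pr_gr C_graded psi_morph psi_surj cu0.
have [z zc zE] : exists2 z, z \in cyclesp & Psi u = flat z.
  apply: model_degree0 => // i l; have /Psi_part/(_ i l) := u0; by rewrite d00.
have [fl fE] := degree1_form e_sym e_irr e_conn n_ge3 f1.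
(* In degree one, x_l u is congruent to f y modulo R w. *)
have step l : exists y (r : 'I_n -> k), y \in cyclesp /\ forall i b, e i b ->
    (i == l)%:R * z i b = fl i * y i b + r i * m i b.
  have : pif f (x l *: cu) = 0.
    by rewrite pifZ qE; apply: q_ann; exact: (eps_var e_irr e_conn n_ge3 epsE).
  move=> /pif_eq0[c' cE]; have [y yE] := psi_surjP c'.
  have /psi_ker[r rE] : psi (x l *: u - f *: y) = 0 by rewrite psiB !psiZ uE yE cE subrr.
  have [y0 y0c y0E] := model_degree0 (omega_model_hpart 0 (Psi_model y))
    (fun i b => @bihom_hpart k 0 (Psi y i b)).
  exists y0, (fun i => (rho i (xchoose (exists_neighbour e_conn n_ge3 i)) r)`_0`_1).
  split=> // i b ib.
  rewrite (rho_axis r (xchooseP (exists_neighbour e_conn n_ge3 i)) ib).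
  have := congr1 (fun p : S => p`_0`_1) (rE i b).
  rewrite PsiB !PsiZ zE wE fE rho_linear_form // => E.
  have yc : (Psi y i b)`_0`_0 = y0 i b.
    have := congr1 (fun g : darts => (g i b)`_0`_0) y0E.
    by rewrite coef_hpart coef_flat /=.
  move: E; rewrite 2!coefB coef01_linear !coef01_constant yc => E.
  have xE : (rho i b (x l))`_0`_1 = (i == l)%:R.
    rewrite rho_var /edge_var ib /= eq_sym; case: eqP => _; first by rewrite coefC /= coefX.
    by case: eqP => _; rewrite ?coefX ?coef0 //= coef0.
  by move: E; rewrite xE => /eqP; rewrite subr_eq addrC => /eqP.
(* Regularity of f on C: where f has no x_i term, the rows at i are proportional. *)
have prop i v : v \in starsp -> fl i = 0 -> exists c, forall b, v i b = c * m i b.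
  move=> vs fi; have [v1 _] := elimT (mem_starsp _ _) vs.
  have rs := row_part_starsp i vs; have [U UE] := Psi_surj (axis_model e_sym 0 rs).
  have /psi_ker[s sE] : psi U = 0.
    apply: fC; rewrite -psiZ; apply/psi_ker.
    (* With no x_i in f, f is f_b x_b on the row at i in the edge ib, and f_b v_ib x_i x_b equals
       (f_b v_ib / m_ib) x_i x_b m_ib. *)
    exists (\sum_b (fl b * v i b / m i b)%:A * (x i * x b)) => a b; rewrite PsiZ UE.
    have [ab|nab] := boolP (e a b); last first.
      by rewrite (axis_non_edge e_sym _ rs nab) wE /flat; have [-> // _ _] := elimT (mem_cyclesp _ _) mz; rewrite !polyC0 !mulr0.
    rewrite fE rho_linear_form // rho_sum /axis !row_partE !expr1 wE /flat.
    have nil h : h != a -> h != b -> rho a b (x h) = 0 by exact: rho_var_other.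
    have sc (t : k) (y y' : R) : rho a b (t%:A * (y * y')) = t%:P%:P * (rho a b y * rho a b y').
      by rewrite (rhoM _ _ _%:A) rho_alg rhoM.
    have [ai|ai] := eqVneq a i.
      subst a; rewrite fi !polyC0 mul0r add0r eq_sym (negPf (edge_neq e_irr ab)) polyC0 mul0r subr0.
      rewrite (bigD1 b) //= big1 ?addr0 => [|h hb].
        rewrite sc rho_var_l // rho_var_r //.
        rewrite polyCC_divK ?m0 // !polyCM; ring.
      have [->|hi] := eqVneq h i; last by rewrite sc (nil h hi hb) !mulr0.
      by rewrite sc v1 ?e_irr // mulr0 mul0r !polyC0 mul0r.
    have [bi|bi] := eqVneq b i.
      subst b; rewrite fi !polyC0 !mul0r addr0 sub0r.
      have ba : e i a by rewrite e_sym.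
      have [_ m2 _] := elimT (mem_cyclesp _ _) mz.
      rewrite (bigD1 a) //= big1 ?addr0 => [|h ha].
        rewrite sc rho_var_l // rho_var_r //.
        rewrite (m2 a) !polyCN !mulrN polyCC_divK ?m0 // !polyCM; ring.
      have [->|hi] := eqVneq h i; last by rewrite sc (nil h ha hi) !mulr0.
      by rewrite sc v1 ?e_irr // mulr0 mul0r !polyC0 mul0r.
    rewrite !polyC0 !mul0r subrr mulr0 big1 ?mul0r // => h _.
    by rewrite sc (nil i) 1?eq_sym // mul0r mulr0.
  have /mem_rowsp[r rE] : row_part i v \in rowsp m.
    apply/(axis_rowsp e_sym e_irr e_conn n_ge3 wE mz rs); exists s => a b.
    by rewrite -sE UE.
  by exists (r i) => b; rewrite -rE row_partE eqxx.
have cyc_star v : v \in cyclesp -> v \in starsp.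
  by move=> /mem_cyclesp[v1 _ v3]; apply/mem_starsp.
(* Away from l the rows of y are multiples of those of m. The factors agree along edges, hence all
   agree since l is not a cut vertex, and antisymmetry carries the common factor into the row at
   l. *)
have kap l : exists c, forall b, z l b = c * m l b.
  have [y [r [yc E]]] := step l.
  have [_ y2 _] := elimT (mem_cyclesp _ _) yc; have [mn m2 _] := elimT (mem_cyclesp _ _) mz.
  have [y1 _ _] := elimT (mem_cyclesp _ _) yc; have [z1 _ _] := elimT (mem_cyclesp _ _) zc.
  have rowc i : exists c, i != l -> forall b, y i b = c * m i b.
    have [fi|fi] := eqVneq (fl i) 0.
      by have [c cE] := prop i y (cyc_star y yc) fi; exists c.
    exists (- r i / fl i) => il b; have [ib|nib] := boolP (e i b); last by rewrite y1 // mn // mulr0.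
    have := E i b ib; rewrite (negPf il) mul0r => /eqP; rewrite eq_sym addr_eq0 => /eqP fy.
    by apply: (mulfI fi); rewrite fy mulrA mulrCA mulfV // mulr1 mulNr.
  have [c cP] := choice rowc.
  have cc a b : a != l -> b != l -> e a b -> c a = c b.
    move=> al bl ab; apply: (mulIf (m0 a b ab)); rewrite -cP // y2 m2 mulrN -cP //.
  have [i il] : exists i, i != l.
    have [i li] := exists_neighbour e_conn n_ge3 l; exists i; rewrite eq_sym; exact: edge_neq li.
  have call a : a != l -> c a = c i.
    move=> al; have := nc l; rewrite /cut_vertex => /contrapT/(_ i a il al)/connectP[p + ->].
    elim: p i {il} => [|b p IH] i //= /andP[/and3P[ib il bl] bp].
    by rewrite IH // (cc i b).
  exists (fl l * c i + r l) => b; have [lb|nlb] := boolP (e l b); last by rewrite z1 // mn // mulr0.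
  have bl : b != l by rewrite eq_sym; exact: edge_neq lb.
  have := E l b lb; rewrite eqxx mul1r => ->.
  by rewrite y2 cP // call // (m2 b l) !mulrN opprK mulrDl mulrA.
have [ka kaP] := choice kap.
have ka_eq a b : e a b -> ka a = ka b.
  move=> ab; apply: (mulIf (m0 a b ab)); rewrite -kaP.
  have [_ z2 _] := elimT (mem_cyclesp _ _) zc; have [_ m2 _] := elimT (mem_cyclesp _ _) mz.
  by rewrite z2 m2 mulrN -kaP.
have [i0 _] := exists_edge e_conn n_ge3.
have kac a : ka a = ka i0.
  have : a \in [pred a | ka a == ka i0].
    apply: (connected_mem e_conn (x := i0)); first by rewrite inE.
    by move=> a' b; rewrite !inE => /eqP <- /ka_eq ->.
  by rewrite inE => /eqP.
apply: q0; rewrite -qE -uE; have -> : psi u = 0.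
  apply/psi_ker; exists (ka i0)%:A => a b; rewrite zE wE rho_alg /flat -!polyCM.
  by rewrite kaP kac.
exact: pif0.
Qed.

End CokernelNoCutVertex.

(** * Functionals on generators for trees and for cut vertices *)

Section CokernelSummands.
Variables (k : fieldType) (n : nat) (e : rel 'I_n).
Hypotheses (e_sym : symmetric e) (e_irr : irreflexive e) (e_conn : connected e).
Hypothesis n_ge3 : (3 <= n)%N.
Local Notation R := (SRring k e).
Local Notation S := {poly {poly k}}.
Local Notation X := ('X%:P : S).
Local Notation x := (SRvar k e).
Local Notation darts := ('I_n -> 'I_n -> S).
Local Notation omega_model := (@omega_model k n e).
Local Notation cyclesp := (@cyclesp k n e).
Local Notation starsp := (@starsp k n e).

Local Notation edge_dart := (@edge_dart k n).

Variables (W : gmod R) (Psi : W -> darts) (d0 : nat).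
Hypotheses (Psi_lin : forall a u v i j, Psi (a *: u + v) i j = rho i j a * Psi u i j + Psi v i j)
  (Psi_inj : injective Psi) (Psi_model : forall u, omega_model (Psi u))
  (Psi_surj : forall g, omega_model g -> exists u, Psi u = g)
  (Psi_part : forall d u, part W d u <-> forall i j, bihom (d + d0%:Z) (Psi u i j)).
Variables (C : gmod R) (psi : {linear W -> C}) (w : darts) (m : 'M[k]_n).
Hypotheses (psi_surj : range psi = [set: C]) (psi_morph : gmorph psi) (C_graded : graded C).
Hypothesis psi_ker : forall u, psi u = 0 <-> exists r : R, forall i j, Psi u i j = rho i j r * w i j.
Hypothesis w_shape : ((d0 = 0)%N /\ w = flat m /\ m \in cyclesp) \/
  ((d0 = 1)%N /\ w = axis 1 m /\ m \in starsp).
Hypothesis w_neq0 : forall i j, e i j -> w i j != 0.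
Local Notation PsiZ := (PsiZ Psi_lin).
Local Notation Psi0 := (Psi0 Psi_lin).
Local Notation Psi_eq := (Psi_eq Psi_inj Psi_model).
Local Notation w_model := (w_model e_sym w_shape).
Hypothesis W_neg : forall (d : int) u, (d < 0)%R -> part W d u -> u = 0.
Local Notation Nw := (@Nf k n e w).
Local Notation lform fl := (\sum_l (fl l : k)%:A * x l : R).
Variable eps : {rmorphism R -> k}.
Hypothesis epsE : forall a b r, e a b -> (rho a b r)`_0`_0 = eps r.

Lemma coef01M (p q : S) : (p * q)`_0`_1 = p`_0`_0 * q`_0`_1 + p`_0`_1 * q`_0`_0.
Proof. by rewrite coef0M coefM !big_ord_recl big_ord0 addr0. Qed.

Lemma constant_part u : exists2 z, z \in cyclesp & forall i j, (Psi u i j)`_0`_0 = z i j.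
Proof.
have [z zc zE] := model_degree0 (omega_model_hpart 0 (Psi_model u)) (fun i j => @bihom_hpart k 0 (Psi u i j)).
exists z => // i j; have := congr1 (fun g : darts => (g i j)`_0`_0) zE.
by rewrite coef_hpart coef_flat.
Qed.

Lemma part_coef01 (i : int) u a b : part W i u -> i + d0%:Z != 1 -> (Psi u a b)`_0`_1 = 0.
Proof.
move=> /Psi_part ui i1; apply/eqP; apply: contraNT i1 => /(ui a b) <-.
by [].
Qed.

Lemma ker_scale u0 u : Psi u0 = w -> psi u = 0 -> exists r : R, u = r *: u0.
Proof.
move=> u0E /psi_ker[r rE]; exists r; apply: Psi_eq => i j _.
by rewrite rE PsiZ u0E.
Qed.

Lemma degree2_Nf fl u l : (forall l, fl l != 0) -> (forall i j, e i j -> Nw fl (edge_dart i j)) ->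
  (forall i j, bihom 1 (Psi u i j)) -> Nw fl (Psi (x l *: u)).
Proof.
move=> fl0 eN ub; apply: (top_Nf e_sym e_irr e_conn n_ge3 fl0 eN (d := 0)) => // i j.
rewrite PsiZ; have [ij|nij] := boolP (e i j).
  exact: (bihomM (bihom_rho e_irr ij (apart_SRvar k e l)) (ub i j)).
by have [-> // _ _] := Psi_model u; rewrite mulr0; exact: bihom0.
Qed.

Section Tree.
Hypotheses (wE : w = axis 1 m) (ms : m \in starsp) (z0 : cyclesp = 0%VS).

Let L (u : W) : 'M[k]_n := \matrix_(i, j) (Psi u i j)`_0`_1.

(** In the product rule for linear coefficients the term with the linear part of a is multiplied by
    the constant terms of u, which form a cycle and vanish in a tree. *)
Lemma linear_partP a u v : L (a *: u + v) = eps a *: L u + L v.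
Proof.
apply/matrixP => i j; rewrite !mxE Psi_lin 2!coefD coef01M; congr (_ + _).
have [z + zE] := constant_part u; rewrite z0 memv0 => /eqP z00.
rewrite zE z00 mxE mulr0 addr0; have [ij|nij] := boolP (e i j); first by rewrite (epsE _ ij).
by have [-> // _ _] := Psi_model u; rewrite !coef0 !mulr0.
Qed.

Lemma linear_part_axis u v : Psi u = axis 1 v -> L u = v.
Proof. by move=> uE; apply/matrixP => i j; rewrite mxE uE coef_axis /= subr0. Qed.

Lemma linear_part_ker u : psi u = 0 -> L u \in <[m]>%VS.
Proof.
move=> u0; have [u1 u1E] := Psi_surj w_model; have [r ->] := ker_scale u1E u0.
have L0 : L 0 = 0 by apply/matrixP => i j; rewrite !mxE Psi0 !coef0.
rewrite -[r *: u1]addr0 linear_partP L0 addr0 (linear_part_axis (v := m)) ?memvZ ?memv_line //.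
by rewrite u1E.
Qed.

Lemma d0_axis : d0 = 1%N.
Proof.
case: w_shape => [[d00 [wE' _]]|[]//]; have [i [j ij]] := exists_edge e_conn n_ge3.
have mij : m i j = 0.
  have := congr1 (fun g : darts => (g i j)`_0`_0) wE; by rewrite wE' coef_axis coef_flat /= subrr.
by have := w_neq0 ij; rewrite wE' /flat mij !polyC0 eqxx.
Qed.

Lemma axis_summand fl prC v : (forall l, fl l != 0) ->
  (forall a b, e a b -> (w a b).[- (fl a / fl b) *: 'X] != 0) ->
  @graded_by k R C prC -> v \in starsp -> v \notin <[m]>%VS -> m != 0 ->
  has_k_summand (gmodf C (lform fl)).
Proof.
move=> fl0 fw hC vs vm m0; have [u uE] := Psi_surj (axis_model e_sym 0 vs).
(* The functional is the coordinate along v in the span of v and m; it ignores m and so descends to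
   C. *)
pose b := [tuple v; m]; have bf : free b.
  by rewrite /= free_cons span_seq1 vm seq1_free.
apply: (@has_k_summandI _ _ _ e_sym e_irr e_conn n_ge3 _ _ _ Psi_lin Psi_inj Psi_model Psi_surj Psi_part
  _ _ _ psi_surj psi_morph C_graded psi_ker W_neg eps epsE fl prC 0 u (fun u => coord b ord0 (L u))) => //.
- by apply/Psi_part => i j; rewrite uE d0_axis; exact: axis_bihom.
- by move=> a y y'; rewrite linear_partP linearP.
- move=> y /linear_part_ker/vlineP[c ->]; rewrite linearZ /=.
  by have := coord_free (Ordinal (isT : (1 < 2)%N)) ord0 bf; rewrite /= => ->; rewrite mulr0.
- move=> i y yi i0; rewrite (_ : L y = 0) ?linear0 //; apply/matrixP => c d; rewrite !mxE.
  by apply: part_coef01 yi _; rewrite d0_axis; move: i0; lia.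
- by rewrite (linear_part_axis uE); have := coord_free ord0 ord0 bf; rewrite /= => ->.
move=> l; apply: degree2_Nf => // [i j ij|i j].
  exact: (edge_Nf_axis e_sym e_irr e_conn n_ge3 fl0 fw wE ms z0 ij).
by rewrite uE; exact: axis_bihom.
Qed.

(** Two cases give a line in the support: a vertex with three neighbours, whose axis works, or an
    edge with no leaf, inside which w has a line of zeros. If neither occurs, the graph is a path on
    three vertices. *)
Lemma axis_krull_dim : (4 <= n)%N -> (forall i j l, e i j -> e i l -> l != j -> m i j != 0) ->
  krull_dim C = 1%N.
Proof.
move=> n4 mnz; have edge i j : e i j -> m i j != 0 -> m j i != 0 -> krull_dim C = 1%N.
  by move=> ij; exact: (krull_dim_edge e_sym e_irr e_conn n_ge3 Psi_lin Psi_model Psi_surj psi_surj psi_ker w_shape w_neq0 ij wE ms).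
have [i [a [b [ia ib ab]]]] : exists i a b, [/\ e i a, e i b & b != a].
  have [i [j ij]] := exists_edge e_conn n_ge3.
  have [[l il lj]|[l jl li]] := exists_nonleaf e_conn n_ge3 ij; first by exists i, j, l.
  by exists j, i, l; split=> //; rewrite e_sym.
have [/existsP[c /and3P[ic ca cb]]|nc] := boolP [exists c, [&& e i c, c != a & c != b]].
  have vs : delta_mx i a - delta_mx i b \in starsp by exact: dart_starsp.
  apply: (krull_dim_axis e_sym e_irr e_conn n_ge3 Psi_lin Psi_model Psi_surj psi_surj psi_ker w_shape w_neq0 (i := i) vs).
  move=> [t tE]; have mic : m i c != 0 by apply: (mnz i c a) => //; rewrite eq_sym.
  have := tE c; rewrite !mxE eqxx (negPf ca) (negPf cb) subrr => /esym/eqP.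
  rewrite mulf_eq0 (negPf mic) orbF => /eqP t0.
  have := tE a; rewrite t0 mul0r !mxE !eqxx eq_sym (negPf ab) subr0 => /eqP.
  by rewrite oner_eq0.
have nbr c : e i c -> c = a \/ c = b.
  move=> ic; have [->|ca] := eqVneq c a; first by left.
  have [->|cb] := eqVneq c b; first by right.
  by case/negP: nc; apply/existsP; exists c; rewrite ic ca cb.
have [/existsP[l /andP[al li]]|na] := boolP [exists l, e a l && (l != i)].
  apply: (edge i a ia); first exact: mnz ia ib ab.
  by apply: (mnz a i l) => //; rewrite e_sym.
have [/existsP[l /andP[bl li]]|nb] := boolP [exists l, e b l && (l != i)].
  apply: (edge i b ib); first by apply: (mnz i b a) => //; rewrite eq_sym.
  by apply: (mnz b i l) => //; rewrite e_sym.
have all3 y : y \in [set i; a; b]%SET.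
  apply: (connected_mem e_conn (x := i)); first by rewrite !inE eqxx.
  move=> c d; rewrite !inE => /orP[/orP[]|] /eqP-> cd.
  - by case: (nbr d cd) => ->; rewrite eqxx ?orbT.
  - have [->|di] := eqVneq d i; first by [].
    by case/negP: na; apply/existsP; exists d; rewrite cd di.
  - have [->|di] := eqVneq d i; first by [].
    by case/negP: nb; apply/existsP; exists d; rewrite cd di.
have : (n <= 3)%N.
  rewrite -[X in (X <= _)%N]card_ord -cardsT (_ : [set: 'I_n]%SET = [set i; a; b]%SET).
    by rewrite -finset.setUA cardsU1 cards2; case: (i \notin _); case: (a != b).
  by apply/setP => y; rewrite all3 inE.
by rewrite leqNgt n4.
Qed.

(** The multiplicity dim V - 1 is positive and bounded by the number of generators, since L maps
    onto V and sends w to a line. *)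
Lemma axis_multiplicity fl : (4 <= n)%N -> (forall l, fl l != 0) ->
  (forall a b, e a b -> (w a b).[- (fl a / fl b) *: 'X] != 0) ->
  (forall i j l, e i j -> e i l -> l != j -> m i j != 0) -> (1 < \dim starsp)%N ->
  (multiplicity C < 2 * (min_gens C)%:R)%R.
Proof.
move=> n4 fl0 fw mnz s1.
have kd := axis_krull_dim n4 mnz.
rewrite (@multiplicity_dim1 k R C (\dim starsp).-1 1 kd) => [|i i1]; last first.
  exact: (dimk_axis e_sym e_irr e_conn n_ge3 Psi_lin Psi_inj Psi_model Psi_surj Psi_part psi_surj psi_morph
    C_graded psi_ker w_shape w_neq0 W_neg fl0 fw wE ms z0 i1).
have [l gl] := finitely_generated e_sym e_irr e_conn n_ge3 Psi_lin Psi_inj Psi_model Psi_surj psi_surj.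
have sl := generators_lower psi_surj (generated_min_gens gl) linear_partP linear_part_ker (U := starsp).
have : (\dim starsp <= (min_gens C).+1)%N.
  apply: sl => v vs; have [u uE] := Psi_surj (axis_model e_sym 0 vs).
  by exists u; exact: linear_part_axis.
by rewrite -natrM ltr_nat; lia.
Qed.

End Tree.

Section CutVertex.
Variables (v : 'I_n) (A : {pred 'I_n}) (c : 'M[k]_n).
Hypotheses (wE : w = flat m) (mz : m \in cyclesp).
Hypothesis A_cycle : forall z, z \in cyclesp -> \sum_(j in A) z v j = 0.
Hypotheses (cs : c \in starsp) (cA : \sum_(j in A) c v j = 1).

Let T (u : W) : k := \sum_(j in A) (Psi u v j)`_0`_1.

(** The disturbing term is the linear coefficient of a at x_v times the sum over A of the constant
    terms of u at v, which form a cycle; this sum is 0. *)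
Lemma cutP a u y : T (a *: u + y) = eps a * T u + T y.
Proof.
rewrite /T mulr_sumr; under eq_bigr do rewrite Psi_lin 2!coefD coef01M.
rewrite big_split; congr (_ + _).
have [l vl] := exists_neighbour e_conn n_ge3 v; have [z zc zE] := constant_part u.
rewrite (eq_bigr (fun j => eps a * (Psi u v j)`_0`_1 + (rho v l a)`_0`_1 * z v j)) => [|j _].
  by rewrite big_split /= -[X in _ + X]mulr_sumr A_cycle // mulr0 addr0.
rewrite -zE; have [vj|nvj] := boolP (e v j).
  by rewrite (epsE _ vj) (rho_axis a vj vl).
by have [-> // _ _] := Psi_model u; rewrite !coef0 !mulr0.
Qed.

Lemma d0_flat : d0 = 0%N.
Proof.
case: w_shape => [[]//|[d1 [wE' _]]]; have [i [j ij]] := exists_edge e_conn n_ge3.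
have := congr1 (fun g : darts => (g i j)`_0`_0) wE; rewrite wE' coef_axis coef_flat /= subrr.
by move=> /esym/eqP; rewrite (negPf (flat_neq0 w_neq0 wE ij)).
Qed.

Lemma cut_flat u z : Psi u = flat z -> T u = 0.
Proof. by move=> uE; rewrite /T big1 // => j _; rewrite uE coef_flat. Qed.

Lemma cut_axis u : Psi u = axis 1 c -> T u = 1.
Proof. by move=> uE; rewrite /T -cA; apply: eq_bigr => j _; rewrite uE coef_axis /= subr0. Qed.

Lemma cut_ker u : psi u = 0 -> T u = 0.
Proof.
move=> u0; have [u1 u1E] := Psi_surj w_model; have [r ->] := ker_scale u1E u0.
have T0 : T 0 = 0 by rewrite /T big1 // => j _; rewrite Psi0 !coef0.
by rewrite -[r *: u1]addr0 cutP T0 addr0 (cut_flat (z := m)) ?mulr0 // u1E.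
Qed.

Lemma cut_summand prC : @graded_by k R C prC -> has_k_summand (gmodf C (lform (fun=> 1))).
Proof.
move=> hC; have [u uE] := Psi_surj (axis_model e_sym 0 cs).
apply: (@has_k_summandI _ _ _ e_sym e_irr e_conn n_ge3 _ _ _ Psi_lin Psi_inj Psi_model Psi_surj Psi_part
  _ _ _ psi_surj psi_morph C_graded psi_ker W_neg eps epsE (fun=> 1) prC 1 u T) => //.
- by apply/Psi_part => i j; rewrite uE d0_flat addr0; exact: axis_bihom.
- exact: cutP.
- exact: cut_ker.
- move=> i y yi i1; rewrite /T big1 // => j _; apply: part_coef01 yi _.
  by rewrite d0_flat addr0.
- exact: cut_axis.
move=> l; apply: degree2_Nf => // [l'|i j ij|i j].
- exact: oner_neq0.
- exact: (edge_Nf_flat e_sym e_irr w_neq0 (fun=> 1) wE mz ij).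
by rewrite uE; exact: axis_bihom.
Qed.

(** If dim Z were at most 1, the dimension formula would give V = [rowsp]; but the functional
    vanishes on rescaled rows of m, and it is 1 on c. *)
Lemma cut_dim_cyclesp : (1 < \dim cyclesp)%N.
Proof.
have m0 i j : e i j -> m i j != 0 by exact: flat_neq0 wE.
have dE := dim_starsp_cyclesp k e_sym e_irr e_conn n_ge3.
rewrite ltnNge; apply/negP => z1.
have dr := dim_rowsp e_conn n_ge3 m0.
have : rowsp m == starsp.
  by rewrite eqEdim (rowsp_starsp w_shape) dr; lia.
move=> /eqP rs; move: cs; rewrite -rs => /mem_rowsp[r rE].
have := cA; under eq_bigr do rewrite rE; rewrite -mulr_sumr A_cycle // mulr0 => /eqP.
by rewrite eq_sym oner_eq0.
Qed.

(** The constant terms together with T need at least dim Z generators, one more than without a cut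
    vertex, while the multiplicity is 2 (dim Z - 1). *)
Lemma cut_multiplicity : (multiplicity C < 2 * (min_gens C)%:R)%R.
Proof.
have z1 := cut_dim_cyclesp.
rewrite (multiplicity_flat e_sym e_irr e_conn n_ge3 Psi_lin Psi_inj Psi_model Psi_surj Psi_part
    psi_surj psi_morph C_graded psi_ker w_shape w_neq0 W_neg wE mz z1).
have [l gl] := finitely_generated e_sym e_irr e_conn n_ge3 Psi_lin Psi_inj Psi_model Psi_surj psi_surj.
(* T is stored in the diagonal entry at v, where every cycle is 0. *)
pose L (u : W) : 'M[k]_n := T u *: delta_mx v v + \matrix_(i, j) (Psi u i j)`_0`_0.
have LP a u y : L (a *: u + y) = eps a *: L u + L y.
  rewrite /L cutP scalerDl -scalerA scalerDr [RHS]addrACA; congr (_ + _).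
  apply/matrixP => i j; rewrite !mxE Psi_lin 2!coefD coef0M coef0M; congr (_ + _).
  have [ij|nij] := boolP (e i j); first by rewrite (epsE _ ij).
  by have [-> // _ _] := Psi_model u; rewrite !coef0 !mulr0.
have Lflat u z : Psi u = flat z -> L u = z.
  move=> uE; rewrite /L (cut_flat uE) scale0r add0r; apply/matrixP => i j.
  by rewrite mxE uE coef_flat.
have L0 : L 0 = 0.
  apply: Lflat; apply/funext => i; apply/funext => j.
  by rewrite Psi0 /flat mxE !polyC0.
have Lk u : psi u = 0 -> L u \in <[m]>%VS.
  move=> u0; have [u1 u1E] := Psi_surj w_model; have [r ->] := ker_scale u1E u0.
  by rewrite -[r *: u1]addr0 LP L0 addr0 (Lflat _ m) ?memvZ ?memv_line // u1E.
pose U := (cyclesp + <[delta_mx v v]>)%VS.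
have dU : \dim U = (\dim cyclesp).+1.
  have dn : delta_mx v v \notin cyclesp.
    apply/negP => /mem_cyclesp[d1 _ _]; have := d1 v v; rewrite mxE eqxx e_irr => /(_ isT)/eqP.
    by rewrite oner_eq0.
  rewrite dimv_disjoint_sum.
    rewrite dim_vline (_ : delta_mx v v != 0) ?addn1 //.
    by apply: contraNneq dn => ->; exact: mem0v.
  apply/eqP; rewrite -subv0; apply/subvP => y /memv_capP[yc /vlineP[t yE]].
  rewrite memv0; have [t0|t0] := eqVneq t 0; first by rewrite yE t0 scale0r.
  by case/negP: dn; rewrite -[delta_mx v v]scale1r -(mulVf t0) -scalerA -yE memvZ.
have LU y : y \in U -> exists u, L u = y.
  move=> /memv_addP[z zc [_ /vlineP[t ->] ->]].
  have [u uE] := Psi_surj (flat_model zc); have [u' u'E] := Psi_surj (axis_model e_sym 0 cs).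
  exists (t%:A *: u' + u); rewrite LP (Lflat u z) // (eps_alg e_conn n_ge3 epsE) addrC; congr (_ + _ *: _).
  rewrite /L (cut_axis u'E) scale1r -[RHS]addr0; congr (_ + _); apply/matrixP => i j.
  by rewrite !mxE u'E coef_axis /= subrr.
have := generators_lower psi_surj (generated_min_gens gl) LP Lk LU.
by rewrite dU -natrM ltr_nat; lia.
Qed.

End CutVertex.

End CokernelSummands.

(** * The equivalence for an abstract copy of omega(-a) *)

Section Abstract.
Variables (k : fieldType) (n : nat) (e : rel 'I_n).
Hypotheses (e_sym : symmetric e) (e_irr : irreflexive e) (e_conn : connected e).
Hypothesis n_ge3 : (3 <= n)%N.
Local Notation R := (SRring k e).
Local Notation S := {poly {poly k}}.
Local Notation x := (SRvar k e).
Local Notation darts := ('I_n -> 'I_n -> S).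
Local Notation omega_model := (@omega_model k n e).
Local Notation cyclesp := (@cyclesp k n e).
Local Notation starsp := (@starsp k n e).
Local Notation lform fl := (\sum_l (fl l : k)%:A * x l : R).

Variables (W : gmod R) (Psi : W -> darts) (d0 : nat).
Hypotheses (Psi_lin : forall a u v i j, Psi (a *: u + v) i j = rho i j a * Psi u i j + Psi v i j)
  (Psi_inj : injective Psi) (Psi_model : forall u, omega_model (Psi u))
  (Psi_surj : forall g, omega_model g -> exists u, Psi u = g)
  (Psi_part : forall d u, part W d u <-> forall i j, bihom (d + d0%:Z) (Psi u i j)).
Hypothesis d0_case : (d0 = 0%N /\ cyclesp <> 0%VS) \/ (d0 = 1%N /\ cyclesp = 0%VS).

(** The only doubtful case is degree -1 for [d0] = 1: this is model degree 0, the space of cycles,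
    which is 0 in that case. *)
Lemma part_neg (d : int) u : (d < 0)%R -> part W d u -> u = 0.
Proof.
move=> d_neg /Psi_part ud; apply: (Psi_eq Psi_inj Psi_model) => i j _; rewrite (Psi0 Psi_lin).
case: d0_case => [[d00 _]|[d01 z0]]; first by apply: bihom_eq0 (ud i j) _; rewrite d00 addr0.
have [dm|dm] := eqVneq (d + 1) 0; last by apply: bihom_eq0 (ud i j) _; rewrite d01; lia.
have [|z + ->] := model_degree0 (Psi_model u); first by move=> a b; have := ud a b; rewrite d01 dm.
by rewrite z0 memv0 => /eqP->; rewrite /flat mxE !polyC0.
Qed.

Definition model_shape (w : darts) (m : 'M[k]_n) :=
  ((d0 = 0)%N /\ w = flat m /\ m \in cyclesp) \/ ((d0 = 1)%N /\ w = axis 1 m /\ m \in starsp).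

Lemma exists_shape g : omega_model g -> (forall i j, bihom d0%:Z (g i j)) -> exists m, model_shape g m.
Proof.
move=> og gd; case: d0_case => [[d00 _]|[d01 _]].
  by rewrite d00 in gd; have [z zc gE] := model_degree0 og gd; exists z; left.
by rewrite d01 in gd; have [v vs gE] := model_degree1 og gd; exists v; right.
Qed.

(** If w vanished on the edge ij, then x_i x_j, which lives on that edge only, would be in the
    kernel of phi. *)
Lemma short_exact_model (C : gmod R) (phi : {linear gself R -> W}) (psi : {linear W -> C}) :
  short_exact phi psi -> exists m, [/\ model_shape (Psi (phi 1)) m,
    forall i j, e i j -> Psi (phi 1) i j != 0, range psi = [set: C], gmorph psi &
    forall u, psi u = 0 <-> exists r : R, forall i j, Psi u i j = rho i j r * Psi (phi 1) i j].
Proof.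
move=> [[phim psim] phi_inj ex psi_surj].
have phiE (r : R) : phi r = r *: phi 1.
  by rewrite -linearZ; congr (phi _); exact: (esym (mulr1 r)).
have one0 : part W 0 (phi 1).
  by apply: phim; have := apart_alg e (1 : k); rewrite scale1r.
have [m mS] : exists m, model_shape (Psi (phi 1)) m.
  by apply: exists_shape => // i j; have /Psi_part/(_ i j) := one0; rewrite add0r.
exists m; split=> // [i j ij|u].
  apply/eqP => w0; have : x i * x j = 0.
    apply: phi_inj; rewrite (linear0 phi) phiE; apply: (Psi_eq Psi_inj Psi_model) => a b ab.
    rewrite (PsiZ Psi_lin) (Psi0 Psi_lin).
    have [[<- <-]|ab1] := eqVneq (i, j) (a, b); first by rewrite w0 mulr0.
    have [[ai bj]|ab2] := eqVneq (i, j) (b, a).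
      have [_ p2 _] := Psi_model (phi 1).
      by rewrite -ai -bj -[Psi _ j i]opprK -p2 w0 rmorph0 oppr0 mulr0.
    by rewrite (rho_edge_var2 k e_irr ab ij ab1 ab2) mul0r.
  move=> /(congr1 (rho i j)); rewrite rhoM rho_var_l // rho_var_r // rmorph0 => /eqP.
  by rewrite mulf_eq0 polyC_eq0 !polyX_eq0.
have -> : psi u = 0 <-> range phi u by rewrite ex.
split=> [[r _ <-]|[r rE]]; first by exists r => i j; rewrite phiE (PsiZ Psi_lin).
exists r => //; rewrite phiE; apply: (Psi_eq Psi_inj Psi_model) => i j _.
by rewrite rE (PsiZ Psi_lin).
Qed.

Lemma exists_cokernel w m : model_shape w m -> (forall i j, e i j -> w i j != 0) ->
  exists (C : gmod R) (phi : {linear gself R -> W}) (psi : {linear W -> C}) prC,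
    [/\ @graded_by k R C prC, short_exact phi psi & Psi (phi 1) = w].
Proof.
move=> wS w0.
have [u0 u0E] := Psi_surj (w_model e_sym wS).
have phil : linear (fun r : gself R => (r : R) *: u0 : W).
  by move=> a r s; rewrite scalerDl scalerA.
have [phi phiE] := linear_fun phil.
pose N : set W := [set r *: u0 | r in [set: R]].
have spanN u : span N u <-> exists r, u = r *: u0.
  split=> [|[r ->]]; last by apply: span_sub; exists r.
  have := @span_min _ W N [set u | exists r, u = r *: u0] => h; apply: h.
  - by exists 0; rewrite scale0r.
  - by move=> a _ _ [r ->] [s ->]; exists (a * r + s); rewrite scalerDl scalerA.
  - by move=> v [r _ <-]; exists r.
have [pr [pr_gr prE]] := exists_grading_hpart e_irr Psi_lin Psi_inj Psi_model Psi_surj Psi_part part_neg.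
have u00 : part W 0 u0.
  by apply/Psi_part => i j; rewrite u0E add0r; exact: (w_bihom wS).
have prN d u : span N u -> span N (pr d u).
  move=> /spanN[r ->]; apply/spanN; have [rd _ rdE] := apart_hpart e_irr d r.
  exists rd; apply: (Psi_eq Psi_inj Psi_model) => i j ij.
  rewrite prE !(PsiZ Psi_lin) u0E rdE //; apply: hpartMr_homog; exact: (w_bihom wS).
exists (gquot N), phi, (quotmod_pi N : {linear W -> gquot N}), (quot_pr pr (N := N)).
split; first exact: graded_quot.
  split.
  - split=> [i r ri|i u ui]; last by exists u.
    by rewrite phiE -[i]addr0; exact: (gr_scale pr_gr).
  - move=> r s; rewrite !phiE => rs; apply: (rho_eq e_irr e_conn n_ge3) => i j ij.
    have := congr1 (fun u => Psi u i j) rs; rewrite !(PsiZ Psi_lin) u0E => /(mulIf (w0 i j ij)).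
    by [].
  - apply/seteqP; split=> u /=.
      by move=> [r _ <-]; apply/quotmod_eq0/spanN; exists r; rewrite phiE.
    by move=> /quotmod_eq0/spanN[r ->]; exists r; rewrite // phiE.
  - apply/seteqP; split=> // q _; exists (repr (q : quotmod N)) => //; exact: quotmod_reprK.
by rewrite phiE scale1r.
Qed.

Hypothesis k_infinite : infinite_set [set: k].

Let cond_i := exists (C : gmod R) (phi : {linear gself R -> W}) (psi : {linear W -> C}),
  [/\ graded C, short_exact phi psi & exists f : R, [/\ apart R 1 f, regular_on f (gself R),
     regular_on f C & has_k_summand (gmodf C f)]].
Let cond_ii := exists (C : gmod R) (phi : {linear gself R -> W}) (psi : {linear W -> C}),
  [/\ graded C, short_exact phi psi & (multiplicity C < 2 * (min_gens C)%:R)%R].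
Let cond_iii := (tree e /\ (4 <= n)%N) \/
  ((forall u v, ~ bridge e u v) /\ (exists v, cut_vertex e v)).

Lemma m_neq0 w m : model_shape w m -> (forall i j, e i j -> w i j != 0) -> m != 0.
Proof.
move=> wS w0; have [i [j ij]] := exists_edge e_conn n_ge3; apply: contraNneq (w0 i j ij) => m0.
by case: wS => [[_ [-> _]]|[_ [-> _]]]; rewrite ?/flat ?/axis m0 !mxE !polyC0 ?mul0r ?subrr.
Qed.

(** For n = 3 the dimension formula gives dim V = 1, and hence C = 0; this is why trees need n >=
    4. *)
Lemma tree_small m : cyclesp = 0%VS -> m \in starsp -> m != 0 -> (n < 4)%N -> starsp = <[m]>%VS.
Proof.
move=> z0 ms m0 n4; have := dim_starsp_cyclesp k e_sym e_irr e_conn n_ge3.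
rewrite z0 dimv0 => dE; apply/eqP; rewrite eq_sym eqEdim -memvE ms dim_vline m0 /=; lia.
Qed.

(** A nowhere zero cycle w excludes bridges, so the case of cycles is decided by the existence of a
    cut vertex; the tree with three vertices leaves C = 0, for which both conditions fail. *)
Lemma cond_iii_or (C : gmod R) (phi : {linear gself R -> W}) (psi : {linear W -> C}) :
  graded C -> short_exact phi psi -> cond_iii \/ (forall c : C, c = 0) \/
  (multiplicity C < 2 * (min_gens C)%:R -> False)%R /\
  (forall f, apart R 1 f -> regular_on f C -> has_k_summand (gmodf C f) -> False).
Proof.
move=> C_gr se; have [m [wS w0 psi_surj psi_morph psi_ker]] := short_exact_model se.
have m0 := m_neq0 wS w0.
have [i [j ij]] := exists_edge e_conn n_ge3.
have [eps epsE] := @exists_augmentation k n e i j ij.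
case: (wS) => [[d00 [wE mz]]|[d01 [wE ms]]].
  have [hc|nc] := pselect (exists v, cut_vertex e v).
    left; right; split=> // u v b.
    have := flat_neq0 w0 wE b.1; rewrite (bridge_cycle0 e_sym e_irr e_conn b mz).
    by rewrite eqxx.
  have nc' v : ~ cut_vertex e v by move=> cv; apply: nc; exists v.
  right; right; split=> [|f f1 fC].
    exact: (flat_no_cut_multiplicity e_sym e_irr e_conn n_ge3 Psi_lin Psi_inj Psi_model Psi_surj Psi_part
      psi_surj psi_morph C_gr psi_ker wS w0 part_neg wE mz m0 nc').
  exact: (flat_no_cut_no_summand e_sym e_irr e_conn n_ge3 Psi_lin Psi_inj Psi_model Psi_surj Psi_part
      psi_surj psi_morph C_gr psi_ker wS w0 part_neg epsE wE mz nc' f1 fC).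
have z0 : cyclesp = 0%VS by case: d0_case => [[]|[]//]; rewrite d01.
have [n4|n4] := leqP 4 n; first by left; left; split=> //; apply/(cyclesp0_tree k e_sym e_irr e_conn).
right; left; apply: (axis_dim1_trivial e_sym e_irr e_conn n_ge3 Psi_lin Psi_inj Psi_model Psi_surj
  psi_surj psi_ker wE z0); exact: tree_small.
Qed.

Lemma trivial_min_gens (C : gmod R) : (forall c : C, c = 0) -> min_gens C = 0%N.
Proof.
move=> C0; apply/eqP; rewrite -leqn0; apply: min_gens_le; exists (fun=> 0).
apply/seteqP; split=> // c _; rewrite (C0 c); exact: span0.
Qed.

Lemma cond_i_iii : cond_i -> cond_iii.
Proof.
move=> [C [phi [psi [C_gr se [f [f1 _ fC ks]]]]]].
have [//|[C0|[_ no]]] := cond_iii_or C_gr se; last by case: (no f f1 fC ks).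
have [i [j ij]] := exists_edge e_conn n_ge3.
have [eps epsE] := @exists_augmentation k n e i j ij.
have [l [q [T [_ _ q0 _ _]]]] := @k_summand_generator k R eps (eps_part e_irr e_conn n_ge3 epsE)
  (eps_ker e_irr e_conn n_ge3 epsE) (@apart_alg k n e) (gmodf C f) ks.
by case: q0; have [c <-] := pif_surj q; rewrite (C0 c); exact: pif0.
Qed.

Lemma cond_ii_iii : cond_ii -> cond_iii.
Proof.
move=> [C [phi [psi [C_gr se lt]]]].
have [//|[C0|[no _]]] := cond_iii_or C_gr se; last by case: (no lt).
by move: lt; rewrite (multiplicity_trivial C0) (trivial_min_gens C0) mulr0 ltxx.
Qed.

Lemma tree_conditions : tree e -> (4 <= n)%N -> cond_i /\ cond_ii.
Proof.
move=> tr n4; have z0 : cyclesp = 0%VS by apply/(cyclesp0_tree k e_sym e_irr e_conn).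
have d01 : d0 = 1%N by case: d0_case => [[_ /(_ z0)]|[]].
have [m ms mnz] := star_nowhere_zero e k_infinite.
have medge i j : e i j -> (m i j != 0) || (m j i != 0).
  move=> ij; have [[l il lj]|[l jl li]] := exists_nonleaf e_conn n_ge3 ij; first by rewrite (mnz i j l).
  by rewrite (mnz j i l) ?orbT // e_sym.
pose w := axis 1 m; have wS : model_shape w m by right.
have w0 i j : e i j -> w i j != 0.
  move=> /medge mij; apply/eqP => wij.
  have := congr1 (fun p : S => p`_0`_1) wij; have := congr1 (fun p : S => p`_1`_0) wij.
  rewrite !coef_axis !coef0 /= subr0 sub0r => /eqP; rewrite oppr_eq0 => mji mij0.
  by move: mij; rewrite mij0 eqxx mji.
(* The coefficients of f must be nonzero, and m_ij f_j + m_ji f_i, which up to f_j is the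
   coefficient of w_ij on the line f = 0, must be nonzero on edges. Non-edges receive a harmless
   nonzero functional. *)
pose lf (t : ('I_n + 'I_n * 'I_n)%type) (u : 'rV[k]_n) : k := match t with inl i => u 0 i
  | inr (i, j) => if e i j then m i j * u 0 j + m j i * u 0 i else u 0 i end.
have [t a u v|t|fr _ frP] := @avoid_zeros k 'rV[k]_n fullv ('I_n + 'I_n * 'I_n)%type (enum {: 'I_n + 'I_n * 'I_n}) lf k_infinite.
- case: t => [i|[i j]] /=; rewrite !mxE //; case: ifP => // _; ring.
- move=> _; case: t => [i|[i j]] /=.
    by exists (delta_mx 0 i); rewrite ?memvf // mxE !eqxx oner_eq0.
  have [ij|nij] := boolP (e i j); last by exists (delta_mx 0 i); rewrite ?memvf // mxE !eqxx oner_eq0.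
  have inj := edge_neq e_irr ij; have := medge i j ij; have [mij0 /=|mij _] := eqVneq (m i j) 0.
    move=> mji; exists (delta_mx 0 i); rewrite ?memvf // !mxE !eqxx (eq_sym j) (negPf inj) /=.
    by rewrite mulr0 add0r mulr1.
  by exists (delta_mx 0 j); rewrite ?memvf // !mxE !eqxx (negPf inj) /= mulr0 addr0 mulr1.
pose fl i := fr 0 i.
have fl0 l : fl l != 0 by apply: (frP (inl l)); rewrite mem_enum.
have fw i j : e i j -> (w i j).[- (fl i / fl j) *: 'X] != 0.
  move=> ij; have := frP (inr (i, j)); rewrite mem_enum /= ij => /(_ isT).
  apply: contraNneq => E; have : m i j + m j i * (fl i / fl j) = 0.
    have := congr1 (fun p : {poly k} => p`_1) E.
    rewrite /w /axis hornerD hornerN !hornerM !expr1 !hornerC hornerX coef0 coefB.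
    by rewrite !coefCM coefZ coefX /= !mulr1 mulrN opprK.
  move=> /(congr1 (fun t => t * fl j)); rewrite mul0r mulrDl -mulrA divfK // => mE.
  exact/eqP.
have [C [phi [psi [prC [hC se wE]]]]] := exists_cokernel wS w0.
have C_gr := graded_by_graded hC.
have [m' [_ w0' psi_surj psi_morph psi_ker]] := short_exact_model se; rewrite wE in psi_ker.
have [i [j ij]] := exists_edge e_conn n_ge3.
have [eps epsE] := @exists_augmentation k n e i j ij.
have dE := dim_starsp_cyclesp k e_sym e_irr e_conn n_ge3; rewrite z0 dimv0 in dE.
have s1 : (1 < \dim starsp)%N by lia.
have m0 := m_neq0 wS w0.
split.
  exists C, phi, psi; split=> //; exists (lform fl); split.
  - exact: apart_linear_form.
  - exact: (linear_form_regular e_irr e_conn n_ge3 fl0).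
  - exact: (linear_form_regular_quotient e_sym e_irr e_conn n_ge3 Psi_lin Psi_model psi_surj psi_ker wS fl0 fw).
  have [v vs vm] : exists2 v, v \in starsp & v \notin <[m]>%VS.
    apply: contrapT => nv; have : (starsp <= <[m]>)%VS.
      by apply/subvP => v vs; apply: contrapT => vm; apply: nv; exists v => //; exact/negP.
    by move=> /dimvS; rewrite dim_vline m0; lia.
  exact: (axis_summand e_sym e_irr e_conn n_ge3 Psi_lin Psi_inj Psi_model Psi_surj Psi_part psi_surj psi_morph
    C_gr psi_ker wS w0 part_neg epsE (erefl w) ms z0 fl0 fw hC vs vm m0).
exists C, phi, psi; split=> //.
exact: (axis_multiplicity e_sym e_irr e_conn n_ge3 Psi_lin Psi_inj Psi_model Psi_surj Psi_part psi_surj psi_morph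
    C_gr psi_ker wS w0 part_neg epsE (erefl w) ms z0 n4 fl0 fw mnz s1).
Qed.

Lemma cut_conditions v : (forall a b, ~ bridge e a b) -> cut_vertex e v -> cond_i /\ cond_ii.
Proof.
move=> nb cv; have [m mz mnz] := bridgeless_nowhere_zero e_sym e_irr k_infinite nb.
have [i [j ij]] := exists_edge e_conn n_ge3.
have d00 : d0 = 0%N.
  case: d0_case => [[]//|[_ z0]]; have := mnz i j ij.
  by move: mz; rewrite z0 memv0 => /eqP->; rewrite mxE eqxx.
pose w : darts := flat m; have wS : model_shape w m by left.
have w0 a b : e a b -> w a b != 0 by move=> ab; rewrite /w /flat !polyC_eq0; exact: mnz.
have [C [phi [psi [prC [hC se wE]]]]] := exists_cokernel wS w0.
have C_gr := graded_by_graded hC.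
have [m' [_ w0' psi_surj psi_morph psi_ker]] := short_exact_model se; rewrite wE in psi_ker.
have [eps epsE] := @exists_augmentation k n e i j ij.
have [A [A_cycle [c cs cA]]] := cut_vertex_functional k e_sym e_irr e_conn cv.
pose c1 := (\sum_(j in A) c v j)^-1 *: c.
have c1s : c1 \in starsp by exact: memvZ.
have c1A : \sum_(j in A) c1 v j = 1.
  by under eq_bigr do rewrite mxE; rewrite -mulr_sumr mulVf.
(* Since w is a nonzero constant on each edge, the sum of all variables already serves as f. *)
pose fl : 'I_n -> k := fun=> 1.
have fl0 l : fl l != 0 by exact: oner_neq0.
have fw a b : e a b -> (w a b).[- (fl a / fl b) *: 'X] != 0.
  by move=> ab; rewrite /w /flat hornerC polyC_eq0; exact: mnz.
split.
  exists C, phi, psi; split=> //; exists (lform fl); split.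
  - exact: apart_linear_form.
  - exact: (linear_form_regular e_irr e_conn n_ge3 fl0).
  - exact: (linear_form_regular_quotient e_sym e_irr e_conn n_ge3 Psi_lin Psi_model psi_surj psi_ker wS fl0 fw).
  exact: (cut_summand e_sym e_irr e_conn n_ge3 Psi_lin Psi_inj Psi_model Psi_surj Psi_part psi_surj psi_morph
    C_gr psi_ker wS w0 part_neg epsE (erefl w) mz A_cycle c1s c1A hC).
exists C, phi, psi; split=> //.
exact: (cut_multiplicity e_sym e_irr e_conn n_ge3 Psi_lin Psi_inj Psi_model Psi_surj Psi_part psi_surj psi_morph
    C_gr psi_ker wS w0 part_neg epsE (erefl w) mz A_cycle c1s c1A).
Qed.

Lemma conditions_equivalent : (cond_i <-> cond_ii) /\ (cond_ii <-> cond_iii).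
Proof.
have back : cond_iii -> cond_i /\ cond_ii.
  by move=> [[tr n4]|[nb [v cv]]]; [exact: tree_conditions|exact: cut_conditions cv].
split; split.
- by move=> /cond_i_iii/back[].
- by move=> /cond_ii_iii/back[].
- exact: cond_ii_iii.
- by move=> /back[].
Qed.

End Abstract.

Lemma initial_degree_eq (k : fieldType) (A : gralg k) (M : gmod A) (d : int) (m : M) :
  part M d m -> m <> 0 -> (forall i u, part M i u -> u <> 0 -> (d <= i)%R) -> initial_degree M = d.
Proof.
move=> md m0 dmin; apply: xget_unique.
  by split; [exists m|move=> i [u ui u0]; exact: dmin ui u0].
move=> i [[u ui u0] imin]; apply/eqP; rewrite eq_le (dmin i u) // andbT.
by apply: imin; exists m.
Qed.

Theorem theorem1p4 (k : fieldType) (n : nat) (e : rel 'I_n)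
    (k_infinite : infinite_set [set: k])
    (e_sym : symmetric e) (e_irr : irreflexive e)
    (n_ge3 : (3 <= n)%N) (e_conn : connected e) :
  let R := SRring k e in
  let W := shift (omega k e) (- a_invariant k e) in
  let cond_i :=
    exists (C : gmod R) (phi : {linear gself R -> W}) (psi : {linear W -> C}),
      [/\ graded C, short_exact phi psi
        & exists f : R,
            [/\ apart R 1 f, regular_on f (gself R), regular_on f C
              & has_k_summand (gmodf C f)]] in
  let cond_ii :=
    exists (C : gmod R) (phi : {linear gself R -> W}) (psi : {linear W -> C}),
      [/\ graded C, short_exact phi psi
        & multiplicity C < 2 * (min_gens C)%:R] in
  let cond_iii :=
    (tree e /\ (4 <= n)%N) \/
    ((forall u v, ~ bridge e u v) /\ (exists v, cut_vertex e v)) in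
  (cond_i <-> cond_ii) /\ (cond_ii <-> cond_iii).
Proof.
move=> R W; have [Psi [Psi_lin Psi_inj Psi_model Psi_surj Psi_part]] := omega_darts k e_sym e_irr e_conn n_ge3.
(* The offset is the initial degree of omega: 0 if there are cycles, and otherwise 1, because dim V
   = n - 2 is positive. *)
have [d0 [d0_case aE]] : exists d0 : nat, ((d0 = 0%N /\ cyclesp k e <> 0%VS) \/
    (d0 = 1%N /\ cyclesp k e = 0%VS)) /\ - a_invariant k e = d0%:Z.
  have nn i u : part (omega k e) i u -> u <> 0 -> (0 <= i)%R.
    move=> /Psi_part ui u0; rewrite leNgt; apply/negP => i0; apply: u0.
    apply: (Psi_eq Psi_inj Psi_model) => a b _; rewrite (Psi0 Psi_lin).
    exact: bihom_eq0 (ui a b) i0.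
  have [z0|zn0] := pselect (cyclesp k e = 0%VS); last first.
    exists 0%N; split; [by left|rewrite /a_invariant opprK].
    have [z zc z0] : exists2 z, z \in cyclesp k e & z != 0.
      by exists (vpick (cyclesp k e)); [exact: memv_pick|rewrite vpick0; apply/eqP].
    have [u uE] := Psi_surj _ (flat_model zc).
    apply: (initial_degree_eq (m := u)) => [|u0|]; last exact: nn.
      by apply/Psi_part => a b; rewrite uE; exact: flat_bihom.
    case/eqP: z0; apply/matrixP => a b; rewrite mxE.
    have := congr1 (fun g : 'I_n -> 'I_n -> {poly {poly k}} => (g a b)`_0`_0) uE; rewrite u0 (Psi0 Psi_lin) coef_flat !coef0 /=.
    by move=> ->.
  exists 1%N; split; [by right|rewrite /a_invariant opprK].
  have dE := dim_starsp_cyclesp k e_sym e_irr e_conn n_ge3; rewrite z0 dimv0 in dE.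
  have [v vs v0] : exists2 v, v \in starsp k e & v != 0.
    exists (vpick (starsp k e)); [exact: memv_pick|rewrite vpick0].
    by apply/eqP => s0; move: dE; rewrite s0 dimv0; lia.
  have [u uE] := Psi_surj _ (axis_model e_sym 0 vs).
  apply: (initial_degree_eq (m := u)) => [|u0|i y yi y0].
  - by apply/Psi_part => a b; rewrite uE; exact: axis_bihom.
  - case/eqP: v0; apply/matrixP => a b; rewrite mxE.
    have := congr1 (fun g : 'I_n -> 'I_n -> {poly {poly k}} => (g a b)`_0`_1) uE; rewrite u0 (Psi0 Psi_lin) coef_axis !coef0 /= subr0.
    by move=> ->.
  have i0 := nn i y yi y0; have [iE|] := eqVneq i 0; last by lia.
  case: y0; apply: (Psi_eq Psi_inj Psi_model) => a b _.
  have [|z + ->] := model_degree0 (Psi_model y); first by rewrite -iE; apply/Psi_part.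
  by rewrite z0 memv0 (Psi0 Psi_lin) => /eqP->; rewrite /flat mxE !polyC0.
rewrite /W aE.
exact: (conditions_equivalent e_sym e_irr e_conn n_ge3 (W := shift (omega k e) d0%:Z) (Psi := Psi)
  Psi_lin Psi_inj Psi_model Psi_surj (fun d u => Psi_part (d + d0%:Z) u) d0_case k_infinite).
Qed.
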